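(* Let $u_0\in H^1(0,1)$, and for each $\varepsilon\in(0,1)$ let $u_0^\varepsilon\in H^1(0,1)$ satisfy $\|u_0^\varepsilon-u_0\|_{H^1(0,1)}\le\varepsilon$ and $u_0^\varepsilon(0)=u_0^\varepsilon(1)=0$. Let $\beta=\beta(\varepsilon)\in(0,1)$ with $\beta\to0$ as $\varepsilon\to0$, let $\mathbf{Q}_\varepsilon^\beta$ be perturbing operators with associated space $\mathbb{W}\subset L^2(0,1)$ and constant $C_0$, and assume that $\mathbf{P}_\varepsilon^\beta=\mathbf{Q}_\varepsilon^\beta+2\,\partial^2/\partial y^2$ are stabilized operators with constant $C_1<6/7$. Let $u\in C([0,1];\mathbb{W})$ be the unique (strong, i.e. $H^2((0,1)\times(0,1))$) solution of $$u_{xx}+u_{yy}=0\ \text{in }(0,1)\times(0,1),\quad u(x,0)=u(x,1)=0\ (x\in[0,1]),\quad u(0,y)=u_0(y),\ u_x(0,y)=0\ (y\in[0,1]).$$ Let $u_\beta^{\varepsilon,0}=0$ and, for $k\ge1$, let $u_\beta^{\varepsilon,k}$ be the weak solution of $$\partial_x^2u_\beta^{\varepsilon,k}-\partial_y^2u_\beta^{\varepsilon,k}=-\mathbf{P}_\varepsilon^\beta u_\beta^{\varepsilon,k-1},\quad u_\beta^{\varepsilon,k}(x,0)=u_\beta^{\varepsilon,k}(x,1)=0,\quad u_\beta^{\varepsilon,k}(0,y)=u_0^\varepsilon(y),\ \partial_xu_\beta^{\varepsilon,k}(0,y)=0.$$ For each $\varepsilon$ let $\bar x=\bar x_\beta\in(0,1]$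 be small enough that $\eta_\beta^2:=2C_1\log(\gamma(\beta))\,\bar x\,\gamma^{C_1\bar x}(\beta)<1$. (a) If $\lim_{\varepsilon\to0}\varepsilon\,\gamma(\beta)\log(\gamma(\beta))=K_1\in(0,\infty)$, then there is a constant $C\ge0$, independent of $\varepsilon$, $k$ and $x$, such that for all sufficiently small $\varepsilon$, all $k\ge1$ and all $x\in[0,\bar x]$ $$\|\partial_xu_\beta^{\varepsilon,k}(x,\cdot)-\partial_xu(x,\cdot)\|^2+\|u_\beta^{\varepsilon,k}(x,\cdot)-u(x,\cdot)\|_{H^1(0,1)}^2\le C\left[\gamma^{\frac{7C_1}{3}-2}(\beta)+\eta_\beta^{2k}\right].$$ (b) If $\lim_{\varepsilon\to0}\varepsilon\,\gamma(\beta)=K_2\in(0,\infty)$, then there is a constant $C\ge0$, independent of $\varepsilon$, $k$ and $x$, such that for all sufficiently small $\varepsilon$, all $k\ge1$ and all $x\in[0,\bar x]$ $$\|u_\beta^{\varepsilon,k}(x,\cdot)-u(x,\cdot)\|^2\le C\left[\gamma^{\frac{7C_1}{3}-2}(\beta)+\eta_\beta^{2k}\right].$$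
   Context: All functions are real-valued. $\|\cdot\|$ is the norm of $L^2(0,1)$ (in the variable $y$), and $\langle\cdot,\cdot\rangle$ is the $L^2(0,1)$ inner product or the duality pairing between $H^{-1}(0,1)$ and $H_0^1(0,1)$. Functions of $(x,y)$ are viewed as functions of $x\in[0,1]$ with values in function spaces in $y\in(0,1)$; the operators $\mathbf{Q}_\varepsilon^\beta,\mathbf{P}_\varepsilon^\beta$ act in the variable $y$. Auxiliary function: $\gamma:(0,1)\to\mathbb{R}$ with $\gamma(\beta)\ge1$ for all $\beta\in(0,1)$ and $\lim_{\beta\to0}\gamma(\beta)=\infty$; $\gamma^a(\beta)=(\gamma(\beta))^a$. Perturbing operator: a linear map $\mathbf{Q}_\varepsilon^\beta:L^2(0,1)\to L^2(0,1)$ for which there are a (normed) function space $\mathbb{W}\subset L^2(0,1)$ and a constant $C_0>0$ independent of $\varepsilon$ with $\|\mathbf{Q}_\varepsilon^\beta u\|\le C_0\|u\|_{\mathbb{W}}/\gamma(\beta)$ for all $u\in\mathbb{W}$. Stabilized operator: a linear map $\mathbf{P}_\varepsilon^\beta:H^1(0,1)\to L^2(0,1)$ for which there is a constant $C_1>0$ independent of $\varepsilon$ with $\|\mathbf{P}_\varepsilon^\beta u\|\le C_1\log(\gamma(\beta))\|u\|_{H^1(0,1)}$ for all $u\in H^1(0,1)$. The relation $\mathbf{P}_\varepsilon^\beta=\mathbf{Q}_\varepsilon^\beta+2\,\partial^2/\partial y^2$ means $\mathbf{P}_\varepsilon^\beta v=\mathbf{Q}_\varepsilon^\beta v+2v_{yy}$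 for $v\in H^2(0,1)\cap H_0^1(0,1)$. Weak solution of $\partial_x^2v-\partial_y^2v=g$ with zero Dirichlet conditions at $y=0,1$ and initial data $u_0^\varepsilon,0$ (here $g=-\mathbf{P}_\varepsilon^\beta u_\beta^{\varepsilon,k-1}$): $v\in C([0,1];H_0^1(0,1))$, $\partial_xv\in C([0,1];L^2(0,1))$, $\partial_x^2v\in L^2(0,1;H^{-1}(0,1))$; for every $\psi\in H_0^1(0,1)$, $\langle\partial_x^2v,\psi\rangle+\langle\partial_yv,\partial_y\psi\rangle=\langle g,\psi\rangle$ for a.e. $x\in(0,1)$; $v(0)=u_0^\varepsilon$, $\partial_xv(0)=0$. These weak solutions exist and are unique. *)

(* Defs.v *)
From HB Require Import structures.
From mathcomp Require Export all_boot all_order all_algebra.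
From mathcomp Require Export all_classical all_reals all_analysis.

Set Implicit Arguments.
Unset Strict Implicit.
Unset Printing Implicit Defensive.

Export Order.TTheory GRing.Theory Num.Theory.
Export numFieldNormedType.Exports.

#[export] Set Implicit Arguments.
#[export] Unset Strict Implicit.
#[export] Unset Printing Implicit Defensive.

Local Open Scope classical_set_scope.
Local Open Scope ring_scope.

Section Measure01.
Variable R : realType.

Lemma lebesgue_itv01_lty :
  (lebesgue_measure (`]0%R, 1%R[%classic : set (measurableTypeR R)) < +oo)%E.
Proof.
rewrite lebesgue_measure_itv/=; case: ifP => _; last exact: ltry.
by rewrite -EFinB ltry.
Qed.

(* Lebesgue measure on (0,1), as a measure on R that vanishes outside (0,1). *)
Definition mu01 : {finite_measure set (measurableTypeR R) -> \bar R} :=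
  @mfrestr _ (measurableTypeR R) R _ lebesgue_measure (measurable_itv `]0, 1[)
    lebesgue_itv01_lty.

Definition mu01sq := (mu01 \x mu01)%E.

End Measure01.
Arguments mu01 {R}.
Arguments mu01sq {R}.

(* L^2(0,1): square-integrable functions, before the quotient by equality a.e.
   Identifications of elements are therefore written [f = g %[ae mu01]], and
   the values of [f] outside (0,1) are irrelevant. *)
Notation L2 R := (LfunType (@mu01 R) (lee1n 2)).

Section Sobolev.
Variable R : realType.
Implicit Types (f g v w psi : L2 R) (phi : R -> R).

Definition L2norm f : R := fine ('N[mu01]_2%:E[EFin \o f])%E.

Definition inner f g : R := \int[mu01]_y (f y * g y).

(* C_c^oo(0,1) *)
Definition test_fun phi : Prop :=
  (forall n y, derivable (derive1n n phi) y 1) /\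
  exists a b : R, [/\ 0 < a, b < 1 & forall y, ~~ (a <= y <= b) -> phi y = 0].

Definition weak_deriv f g : Prop := forall phi, test_fun phi ->
  \int[mu01]_y (f y * derive1 phi y) = - \int[mu01]_y (g y * phi y).

Definition H1 : set (L2 R) := [set f | exists g, weak_deriv f g].

(* A weak derivative of f; it is unique a.e. if f is in H1, and the value is a
   dummy otherwise. *)
Definition wd f : L2 R := xget 0 [set g | weak_deriv f g].

Definition H2 : set (L2 R) := [set f | H1 f /\ H1 (wd f)].

Definition H1norm f : R := Num.sqrt (L2norm f ^+ 2 + L2norm (wd f) ^+ 2).

(* H_0^1(0,1): the closure of C_c^oo(0,1) in H^1(0,1) *)
Definition H01 : set (L2 R) := [set f | H1 f /\
  forall e : R, 0 < e -> exists phi g,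
    [/\ test_fun phi, g = phi %[ae mu01] & H1norm (f - g) < e]].

(* f(0) = f(1) = 0, for the continuous representative of f *)
Definition vanishes_at_ends f : Prop := exists h : R -> R,
  [/\ {within `[0, 1], continuous h}, f = h %[ae mu01], h 0 = 0 & h 1 = 0].

(* H^{-1}(0,1), the dual of H_0^1(0,1): only the restriction of F to H01
   is relevant. *)
Definition Hm1 : set (L2 R -> R) := [set F |
  (forall (a : R) f g, H01 f -> H01 g -> F (a *: f + g) = a * F f + F g) /\
  exists M : R, forall f, H01 f -> `|F f| <= M * H1norm f].

Definition Hm1norm (F : L2 R -> R) : R :=
  sup [set `|F f| | f in [set f | H01 f /\ H1norm f <= 1]].

(* L^2(0,1; H^{-1}(0,1)).  Since H^{-1}(0,1) is separable and reflexive,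
   measurability may be tested against the elements of H_0^1(0,1). *)
Definition L2_Hm1 : set (R -> L2 R -> R) := [set F |
  [/\ (forall x : R, x \in `]0, 1[ -> Hm1 (F x)),
      (forall psi, H01 psi -> measurable_fun (`]0, 1[ : set (measurableTypeR R)) (fun x => F x psi)),
      measurable_fun (`]0, 1[ : set (measurableTypeR R)) (fun x => Hm1norm (F x)) &
      (\int[mu01]_x ((Hm1norm (F x)) ^+ 2)%:E < +oo)%E]].

End Sobolev.
Arguments H1 {R}.
Arguments H2 {R}.
Arguments H01 {R}.
Arguments L2_Hm1 {R}.

Section Curves.
Variable R : realType.
Implicit Types (v vx g : R -> L2 R).

(* v in C([0,1]; X), where X is normed by N *)
Definition cont01 (N : L2 R -> R) v : Prop := forall x, x \in `[0, 1] ->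
  N (v t - v x) @[t --> within `[0, 1] (nbhs x)] --> (0 : R).

(* v in C^1([0,1]; L^2(0,1)) with derivative vx (one-sided at 0 and 1).  The
   values at all x in [0,1] of the x-derivative of v are understood so. *)
Definition C1_L2 v vx : Prop :=
  (forall x, x \in `[0, 1] ->
     L2norm ((t - x)^-1 *: (v t - v x) - vx x)
       @[t --> within `[0, 1] (x^')] --> (0 : R)) /\
  cont01 (@L2norm R) vx.

(* vxx is the distributional derivative of vx, with values in H^{-1}(0,1) *)
Definition weak_deriv_Hm1 vx (vxx : R -> L2 R -> R) : Prop :=
  forall phi psi, test_fun phi -> H01 psi ->
  \int[mu01]_x (inner (vx x) psi * derive1 phi x) =
    - \int[mu01]_x (vxx x psi * phi x).

(* v is the weak solution of v_xx - v_yy = g, v(x,0) = v(x,1) = 0, v(0,.) = v0,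
   v_x(0,.) = 0, and vx is its x-derivative. *)
Definition wave_weak_solution g (v0 : L2 R) v vx : Prop :=
  [/\ (forall x, x \in `[0, 1] -> H01 (v x)) /\ cont01 (@H1norm R) v,
      C1_L2 v vx,
      exists vxx : R -> L2 R -> R,
        [/\ L2_Hm1 vxx, weak_deriv_Hm1 vx vxx &
            forall psi, H01 psi -> {ae mu01, forall x,
              vxx x psi + inner (wd (v x)) (wd psi) = inner (g x) psi}],
      v 0 = v0 %[ae mu01] & vx 0 = 0 %[ae mu01]].

End Curves.

Section Square.
Variable R : realType.

(* D 0 0 is in C_c^oo((0,1)x(0,1)), and D i j is d_x^i d_y^j (D 0 0). *)
Definition test_fun2 (D : nat -> nat -> R -> R -> R) : Prop :=
  [/\ (forall i j, continuous (fun z : R * R => D i j z.1 z.2)),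
      (forall i j (x y : R), is_derive x 1 (fun s => D i j s y) (D i.+1 j x y)),
      (forall i j (x y : R), is_derive y 1 (fun s => D i j x s) (D i j.+1 x y)) &
      exists a b : R, [/\ 0 < a, b < 1 &
        forall x y, ~~ ((a <= x <= b) && (a <= y <= b)) -> D 0%N 0%N x y = 0]].

(* U is in H^2((0,1)x(0,1)), and G i j is its weak derivative d_x^i d_y^j U
   for i + j <= 2 (so that U = G 0 0 a.e.). *)
Definition H2_square (U : R * R -> R) (G : nat -> nat -> R * R -> R) : Prop :=
  forall i j, (i + j <= 2)%N ->
    (G i j : measurableTypeR R * measurableTypeR R -> R) \in Lfun mu01sq 2%:E /\
    forall D, test_fun2 D ->
      \int[mu01sq]_z (U z * D i j z.1 z.2) =
        (-1) ^+ (i + j) * \int[mu01sq]_z (G i j z * D 0%N 0%N z.1 z.2).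

(* u is the strong solution of u_xx + u_yy = 0, u(x,0) = u(x,1) = 0,
   u(0,.) = u0, u_x(0,.) = 0, seen as a function of x with values in L^2(0,1),
   and ux is its x-derivative.  U is the representative of u that is continuous
   on the closed square. *)
Definition laplace_strong_solution (u0 : L2 R) (u ux : R -> L2 R) : Prop :=
  exists (U : R * R -> R) (G : nat -> nat -> R * R -> R),
  [/\ {within `[0, 1] `*` `[0, 1], continuous U} /\ H2_square U G,
      {ae mu01sq, forall z, G 2%N 0%N z + G 0%N 2%N z = 0},
      forall x, x \in `[0, 1] -> U (x, 0) = 0 /\ U (x, 1) = 0,
      (forall x, x \in `[0, 1] -> u x = (fun y => U (x, y)) %[ae mu01]) /\
        C1_L2 u ux &
      u 0 = u0 %[ae mu01] /\ ux 0 = 0 %[ae mu01]].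

End Square.

Section Operators.
Variable R : realType.

(* T is a linear map from the subspace D of L^2(0,1) to L^2(0,1). *)
Definition linear_on (D : set (L2 R)) (T : L2 R -> L2 R) : Prop :=
  (forall f g, D f -> D g -> f = g %[ae mu01] -> T f = T g %[ae mu01]) /\
  (forall (a : R) f g, D f -> D g ->
     T (a *: f + g) = a *: T f + T g %[ae mu01]).

(* iW identifies the normed space W with a subspace of L^2(0,1). *)
Definition L2_subspace (W : normedModType R) (iW : W -> L2 R) : Prop :=
  (forall (a : R) v w, iW (a *: v + w) = a *: iW v + iW w %[ae mu01]) /\
  (forall w, iW w = 0 %[ae mu01] -> w = 0).

(* u in C([0,1]; W) *)
Definition cont01_in (W : normedModType R) (iW : W -> L2 R) (u : R -> L2 R) :=
  exists uW : R -> W, {within `[0, 1], continuous uW} /\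
    forall x, x \in `[0, 1] -> u x = iW (uW x) %[ae mu01].

(* In the next two definitions, c is the value gamma(beta). *)
Definition perturbing (W : normedModType R) (iW : W -> L2 R) (C0 c : R)
    (Q : L2 R -> L2 R) : Prop :=
  linear_on setT Q /\ forall w : W, L2norm (Q (iW w)) <= C0 * `|w| / c.

Definition stabilized (C1 c : R) (P : L2 R -> L2 R) : Prop :=
  linear_on H1 P /\ forall f, H1 f -> L2norm (P f) <= C1 * ln c * H1norm f.

(* P = Q + 2 d^2/dy^2 *)
Definition stabilizes (P Q : L2 R -> L2 R) : Prop := forall v, H2 v -> H01 v ->
  P v = Q v + 2 *: wd (wd v) %[ae mu01].

(* eta_beta^2, where c is gamma(beta) and xbar is in (0,1] *)
Definition eta2 (C1 c xbar : R) : R := 2 * C1 * ln c * xbar * c `^ (C1 * xbar).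

End Operators.

(* Main.v *)
(** Put [w = u^k - u].  Since
    [u_xx - u_yy = - 2 u_yy = Q u - P u], the difference solves the wave equation
    [w_xx - w_yy = P u - P u^(k-1) - Q u] with zero boundary values, and the energy
    [|w_x|^2 + |w|^2 + |w_y|^2] satisfies Gronwall's inequality.  As [P] is bounded
    by [L = C1 ln gamma] and [|Q u| <= C0 M / gamma], the suprema [F_k] over
    [[0, xbar]] of the square root of the energy satisfy
    [F_k <= r F_(k-1) + e^(1/2) (eps + C0 M / gamma)] with [r = e^(1/2) L xbar].
    With [t = L xbar], the hypothesis [eta^2 = 2 t e^t < 1] forces [r <= 3/4] and
    [r^2 <= eta^2], so that [F_k^2 <= C (eta^(2k) + eps^2 + gamma^-2)].  In both
    regimes [eps = O(gamma^-1)], and [gamma^-2 <= gamma^(7 C1 / 3 - 2)] because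
    [gamma >= 1]; hence (b) holds in the same norm as (a).

    The weak formulations are only tested against products of test functions, and
    everything is reduced to one variable.  For the Laplace solution, [u] is
    continuous into [H1] because [u x - u x'] has the weak derivative
    [int_x'^x u_xy(s, .) ds], and [u x] is in [H2] for a.e. [x] because countably
    many test functions suffice.  The energy identity for functions which are only
    [C^1] into [L2] follows from symmetric difference quotients of
    [A (x, t) = <w_x x, w t>]. *)

(* Gronwall is applied to the square root of the energy, not to the energy: the bound on [P] then
   enters linearly, which makes the errors obey an affine recursion. The factor [e^(1/2)] comes from
   the term [|w|^2] of the energy, whose derivative [2 <w, w_x>] is at most the energy, over a time
   at most 1. The obstacle is regularity: the equation cannot be tested with [w_x], which is not in
   H01. It is tested with [w t] for a frozen [t], and the remaining derivative is taken in the
   second factor. This asks for a source that is continuous into L2: [P u] is, because [u] is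
   continuous into H1, and [Q u] is, because [u] is continuous into [W]. The relation between [P]
   and [Q] applies to [u x] only where [u x] is in H2, that is for almost every [x]. It yields
   [<Q u - P u, psi> = 2 <u_y, psi_y>] there, and both sides are continuous in [x], so that the
   identity holds for all [x]. The same passage from almost every to every [x] turns the weak
   formulations in [x] into ordinary derivatives. *)
Require Import Defs.
From mathcomp Require Import measurable_realfun.
From mathcomp Require Import ring lra.

Local Open Scope classical_set_scope.
Local Open Scope ring_scope.

(** * The space L2(0,1) *)

Section RintegralAux.
Context d (T : measurableType d) (R : realType).
Variable mu : {measure set T -> \bar R}.
Implicit Types f g : T -> R.

Lemma Rintegral_ae_eq f g : measurable_fun setT f -> measurable_fun setT g ->
  f = g %[ae mu] -> \int[mu]_x f x = \int[mu]_x g x.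
Proof.
move=> mf mg fg; congr fine; apply: ae_eq_integral => //.
- exact/measurable_EFinP.
- exact/measurable_EFinP.
- by apply: filterS fg => x + _ /= => /(_ I) ->.
Qed.

Lemma Rintegral_dominated (f_ : nat -> T -> R) f g :
  (forall n, measurable_fun setT (f_ n)) -> measurable_fun setT f ->
  mu.-integrable setT (EFin \o g) ->
  {ae mu, forall x, f_ n x @[n --> \oo] --> f x} ->
  (forall n, {ae mu, forall x, `|f_ n x| <= g x}) ->
  mu.-integrable setT (EFin \o f) /\
  \int[mu]_x f_ n x @[n --> \oo] --> \int[mu]_x f x.
Proof.
move=> mf_ mf ig fcv fg.
have [|||||fi _ H] := @dominated_convergence _ _ _ mu _ measurableT
   (fun n => EFin \o f_ n) (EFin \o f) (EFin \o g).
- by move=> n; apply/measurable_EFinP.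
- exact/measurable_EFinP.
- by apply: filterS fcv => x h _; apply/fine_cvgP; split => //; exact: nearW.
- exact: ig.
- apply/ae_foralln => n; by apply: filterS (fg n) => x h _; rewrite /= lee_fin.
split => //; apply: fine_cvg; rewrite fineK//.
exact: integrable_fin_num.
Qed.

End RintegralAux.

Section FiniteMeasureAux.
Context d (T : measurableType d) (R : realType).
Variable mu : {finite_measure set T -> \bar R}.

Lemma integrable_bounded (f : T -> R) (M : R) : measurable_fun setT f ->
  (forall x, `|f x| <= M) -> mu.-integrable setT (EFin \o f).
Proof.
move=> mf fM.
apply: (@le_integrable _ _ _ mu _ measurableT _ (cst M%:E)).
- exact/measurable_EFinP.
- by move=> x _ /=; rewrite lee_fin (le_trans (fM x))// ler_norm.
- exact: finite_measure_integrable_cst.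
Qed.

Lemma Lfun2P (f : T -> R) : measurable_fun setT f ->
  mu.-integrable setT (EFin \o (fun x => f x ^+ 2)) -> f \in Lfun mu 2%:E.
Proof.
move=> mf /integrableP[_ fi]; rewrite inE; apply/andP; split; rewrite inE//=.
rewrite /finite_norm unlock poweR_lty//.
rewrite (eq_integral (fun x => `|(EFin \o (fun x => f x ^+ 2)%R) x|)%E)// => x _ /=.
by rewrite normrX powR_mulrn.
Qed.

Lemma bounded_Lfun2 (f : T -> R) (M : R) : measurable_fun setT f ->
  (forall x, `|f x| <= M) -> f \in Lfun mu 2%:E.
Proof.
move=> mf fM; apply: Lfun2P => //; apply: (@integrable_bounded _ (M ^+ 2)).
  exact: measurable_funX.
by move=> x; rewrite normrX lerXn2r// ?nnegrE// (le_trans _ (fM x)).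
Qed.

End FiniteMeasureAux.

Section Mu01.
Variable R : realType.
Notation mu := (@mu01 R).
Notation leb := (@lebesgue_measure R).
Notation "'mR'" := (measurableTypeR R).

#[global] Instance ae_mu01_filter : Filter (nbhs (almost_everywhere mu)).
Proof. exact: (ae_filter_ringOfSetsType mu). Qed.

Lemma mu01E (A : set mR) : mu A = leb (A `&` `]0, 1[).
Proof. by []. Qed.

Lemma measurable_oo01 : measurable (`]0, 1[ : set mR).
Proof. exact: measurable_itv. Qed.

Lemma negligible_mu01P (A : set mR) :
  mu.-negligible A <-> leb.-negligible (A `&` `]0, 1[).
Proof.
split=> [[B [mB B0 AB]]|[B [mB B0 AB]]].
  exists (B `&` `]0, 1[); split => //; first exact: measurableI.
  by move=> x [/AB].
exists (B `|` ~` `]0, 1[); split.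
- by apply: measurableU => //; apply: measurableC; exact: measurable_itv.
- rewrite mu01E setIUl setICl setU0; apply/eqP; rewrite eq_le measure_ge0 andbT.
  by rewrite -B0 le_measure ?inE//; exact: measurableI.
- by move=> x Ax; have [?|?] := pselect (`]0, 1[%classic x); [left; apply: AB|right].
Qed.

Lemma ae_mu01P (P : R -> Prop) :
  {ae mu, forall x, P x} <-> {ae leb, forall x, x \in `]0, 1[ -> P x}.
Proof.
rewrite /prop_near1/= /almost_everywhere/= /nbhs/= /almost_everywhere.
rewrite negligible_mu01P.
rewrite (_ : ~` (fun x => P x) `&` _ =
  ~` (fun x => x \in `]0, 1[ -> P x)); first by [].
apply/seteqP; split => x /=.
  by move=> [nP x01] /(_ x01).
by move=> /not_implyP[x01 nP].
Qed.

Lemma ae_mu01_itv : {ae mu, forall x, x \in `]0, 1[}.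
Proof. by apply/ae_mu01P/nearW. Qed.

Lemma integral_mu01 (f : mR -> \bar R) : measurable_fun setT f ->
  (\int[mu]_x f x = \int[leb]_(x in `]0%R, 1%R[) f x)%E.
Proof.
move=> mf; pose D : set mR := `]0%R, 1%R[%classic.
(* The indicator of (0,1) alters [f] only on a [mu]-null set; what remains lives where [mu] and
   Lebesgue measure agree. *)
rewrite (@ae_eq_integral _ _ _ mu _ (fun x => f x * (\1_D x)%:E)%E f)//.
- transitivity (\int[mu]_(x in D) f x)%E; last first.
    apply: eq_measure_integral => A mA A01.
    by transitivity (leb (A `&` `]0, 1[)) => //; rewrite setIidl.
  rewrite [RHS]integral_mkcond; apply: eq_integral => x _.
  by rewrite patchE indicE; case: ifP => _; rewrite ?mule1 ?mule0.
- apply: emeasurable_funM => //; apply/measurable_EFinP.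
  by apply: measurable_indic; exact: measurable_oo01.
- apply/ae_mu01P/nearW => x x01 _.
  by rewrite indicE mem_setE x01 mule1.
Qed.

Lemma Rintegral_mu01 (f : mR -> R) : measurable_fun setT f ->
  \int[mu]_x f x = \int[leb]_(x in `]0, 1[) f x.
Proof. by move=> mf; rewrite /Rintegral integral_mu01//; exact/measurable_EFinP. Qed.

Lemma integrable_mu01 (f : mR -> \bar R) : measurable_fun setT f ->
  mu.-integrable setT f <-> leb.-integrable `]0, 1[ f.
Proof.
move=> mf; split => /integrableP[_ fi]; apply/integrableP; split => //.
- exact: measurable_funTS.
- by rewrite -integral_mu01//; exact: measurableT_comp.
- by rewrite integral_mu01//; exact: measurableT_comp.
Qed.

Lemma mu01T : mu setT = 1%:E.
Proof.
rewrite mu01E setTI/= lebesgue_measure_itv/= lte_fin ltr01.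
by rewrite oppr0 adde0.
Qed.

End Mu01.

Section L2.
Variable R : realType.
Notation mu := (@mu01 R).
Implicit Types f g h : L2 R.

Definition toL2 (f : R -> R) (Hf : f \in Lfun mu 2%:E) : L2 R :=
  Lfun_Sub (lee1n 2) Hf.

Lemma toL2E (f : R -> R) (Hf : f \in Lfun mu 2%:E) : toL2 Hf = f :> (R -> R).
Proof. by rewrite /toL2 Lfun_valP. Qed.

Lemma L2_measurable f : measurable_fun setT f.
Proof. exact: measurable_funPT. Qed.
#[local] Hint Resolve L2_measurable : core.

Lemma L2_Lfun f : (f : R -> R) \in Lfun mu 2%:E.
Proof. exact: (LfunP (p1:=lee1n 2)). Qed.

Lemma integrable_L2M f g : mu.-integrable setT (EFin \o (fun y => f y * g y)).
Proof. by apply/Lfun1_integrable/Lfun2_mul_Lfun1; exact: L2_Lfun. Qed.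

Lemma integrable_L2 f : mu.-integrable setT (EFin \o f).
Proof.
have H1 : (fun=> 1 : R) \in Lfun mu 2%:E by exact: Lfun_cst.
have := integrable_L2M f (toL2 H1).
rewrite (_ : (fun y => _) = f) ?toL2E//.
by apply/funext => y; rewrite mulr1.
Qed.

Lemma innerC f g : inner f g = inner g f.
Proof. by apply: eq_Rintegral => y _; rewrite mulrC. Qed.

Lemma innerDl f g h : inner (f + g) h = inner f h + inner g h.
Proof.
rewrite -RintegralD//; try exact: integrable_L2M.
by apply: eq_Rintegral => y _; rewrite -mulrDl.
Qed.

Lemma innerZl (a : R) f g : inner (a *: f) g = a * inner f g.
Proof.
rewrite -RintegralZl//; try exact: integrable_L2M.
by apply: eq_Rintegral => y _; rewrite mulrA.
Qed.

Lemma innerNl f g : inner (- f) g = - inner f g.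
Proof. by rewrite -scaleN1r innerZl mulN1r. Qed.

Lemma innerBl f g h : inner (f - g) h = inner f h - inner g h.
Proof. by rewrite innerDl innerNl. Qed.

Lemma innerDr f g h : inner h (f + g) = inner h f + inner h g.
Proof. by rewrite !(innerC h) innerDl. Qed.

Lemma innerZr (a : R) f g : inner g (a *: f) = a * inner g f.
Proof. by rewrite !(innerC g) innerZl. Qed.

Lemma innerBr f g h : inner h (f - g) = inner h f - inner h g.
Proof. by rewrite !(innerC h) innerBl. Qed.

Lemma inner0l f : inner 0 f = 0.
Proof. by rewrite -(scale0r 0) innerZl mul0r. Qed.

Lemma inner0r f : inner f 0 = 0.
Proof. by rewrite innerC inner0l. Qed.

Lemma inner_aer f g h : f = g %[ae mu] -> inner h f = inner h g.
Proof.
move=> fg; apply: Rintegral_ae_eq; try exact: measurable_funM.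
by apply: filterS fg => y + _ => /(_ I) ->.
Qed.

Lemma inner_ael f g h : f = g %[ae mu] -> inner f h = inner g h.
Proof. by move=> fg; rewrite !(innerC _ h) (inner_aer _ fg). Qed.

Lemma inner_ge0 f : 0 <= inner f f.
Proof. by apply: Rintegral_ge0 => y _; rewrite -expr2 sqr_ge0. Qed.

Lemma L2norm_ge0 f : 0 <= L2norm f.
Proof. by apply: fine_ge0; exact: Lnorm_ge0. Qed.

Lemma L2norm_sqr f : L2norm f ^+ 2 = inner f f.
Proof.
have ff : inner f f = fine (\int[mu]_y (`|(EFin \o f) y| `^ 2)).
  by congr fine; apply: eq_integral => y _ /=; rewrite powR_mulrn// real_normK ?num_real// expr2.
have := @powR_Lnorm _ _ _ mu (EFin \o f) 2 (lt0r_neq0 (ltr0Sn _ _)).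
rewrite ff => <-.
rewrite fine_poweR powR_mulrn ?L2norm_ge0//.
Qed.

Lemma L2normE f : L2norm f = Num.sqrt (inner f f).
Proof. by rewrite -L2norm_sqr sqrtr_sqr ger0_norm// L2norm_ge0. Qed.

Lemma L2norm_ae f g : f = g %[ae mu] -> L2norm f = L2norm g.
Proof. by move=> fg; rewrite !L2normE (inner_aer _ fg) (inner_ael _ fg). Qed.

Lemma CauchySchwarz f g : `|inner f g| <= L2norm f * L2norm g.
Proof.
have [/eqP g0|g0] := boolP (L2norm g == 0).
  have gg0 : inner g g = 0 by rewrite -L2norm_sqr g0 expr0n.
  rewrite g0 mulr0 normr_le0; apply: contraT => fg0.
  (* the quadratic [inner (f + t g) (f + t g)] would be affine in [t] *)
  pose t := - (inner f f + 1) / (2 * inner f g).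
  have := inner_ge0 (f + t *: g).
  rewrite !(innerDl, innerDr, innerZl, innerZr) gg0 (innerC g f) !mulr0 addr0.
  have -> : inner f f + t * inner f g + t * inner f g = - 1.
    by rewrite /t; field.
  by rewrite lerNr oppr0 ler10.
have gp : 0 < L2norm g ^+ 2 by rewrite exprn_gt0// lt_def g0 L2norm_ge0.
rewrite -(@ler_pXn2r _ 2) ?nnegrE// ?mulr_ge0 ?L2norm_ge0//.
rewrite real_normK ?num_real// exprMn L2norm_sqr.
(* [f] minus its orthogonal projection on [g]. *)
have := inner_ge0 (f - (inner f g / L2norm g ^+ 2) *: g).
rewrite !(innerBl, innerBr, innerZl, innerZr) -(L2norm_sqr g) (innerC g f).
set b := inner f g; set c := L2norm g ^+ 2 in gp *; set a := inner f f.
have -> : a - b / c * b - (b / c * b - b / c * (b / c * c)) = a - b ^+ 2 / c.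
  by field; rewrite gt_eqF.
by rewrite subr_ge0 ler_pdivrMr.
Qed.

Lemma L2normD f g : L2norm (f + g) <= L2norm f + L2norm g.
Proof. exact: ler_LnormD. Qed.

Lemma L2normZ (a : R) f : L2norm (a *: f) = `|a| * L2norm f.
Proof.
by rewrite !L2normE innerZl innerZr mulrA -expr2 sqrtrM ?sqr_ge0// sqrtr_sqr.
Qed.

Lemma L2normN f : L2norm (- f) = L2norm f.
Proof. by rewrite -scaleN1r L2normZ normrN1 mul1r. Qed.

Lemma L2normB f g : L2norm (f - g) = L2norm (g - f).
Proof. by rewrite -opprB L2normN. Qed.

Lemma L2norm0 : L2norm (0 : L2 R) = 0.
Proof. by rewrite L2normE inner0l sqrtr0. Qed.

End L2.
#[export] Hint Resolve L2_measurable : core.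

(** * Smooth functions and bumps *)

Section Derive1.
Variable R : realType.
Implicit Types (f g : R -> R) (x a b : R).

Lemma is_derive1D f g x a b : is_derive x 1 f a -> is_derive x 1 g b ->
  is_derive x 1 (fun y => f y + g y) (a + b).
Proof. exact: is_deriveD. Qed.

Lemma is_derive1M f g x a b : is_derive x 1 f a -> is_derive x 1 g b ->
  is_derive x 1 (fun y => f y * g y) (a * g x + f x * b).
Proof.
move=> fa gb; apply: (is_derive_eq (is_deriveM fa gb)).
by rewrite /GRing.scale/= addrC mulrC.
Qed.

Lemma is_derive1Z f x (c : R) a : is_derive x 1 f a ->
  is_derive x 1 (fun y => c * f y) (c * a).
Proof. exact: is_deriveZ. Qed.

Lemma is_derive1B f g x a b : is_derive x 1 f a -> is_derive x 1 g b ->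
  is_derive x 1 (fun y => f y - g y) (a - b).
Proof. exact: is_deriveB. Qed.

Lemma is_derive1_chain f g x a b : is_derive (g x) 1 f a ->
  is_derive x 1 g b -> is_derive x 1 (fun y => f (g y)) (a * b).
Proof. exact: is_derive1_comp. Qed.

End Derive1.

Section Smooth.
Variable R : realType.
Implicit Types f g : R -> R.

Definition smooth f := forall n y, derivable (derive1n n f) y 1.

(** Smoothness is shown below by enclosing a function in a class closed under differentiation, so
    that no formula for higher derivatives is needed. *)
Lemma smooth_coind (S : set (R -> R)) :
  (forall f, S f -> (forall y, derivable f y 1) /\ S (derive1 f)) ->
  forall f, S f -> smooth f.
Proof.
move=> HS f + n; elim: n f => [|n IH] f Sf y.
  by rewrite derive1n0; apply: (HS _ Sf).1.
by rewrite derive1Sn; apply: IH; apply: (HS _ Sf).2.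
Qed.

Lemma smooth_derivable f y : smooth f -> derivable f y 1.
Proof. by move=> /(_ 0%N y); rewrite derive1n0. Qed.

Lemma smooth_derive1 f : smooth f -> smooth (derive1 f).
Proof. by move=> sf n y; rewrite -derive1Sn; exact: sf. Qed.

Lemma smooth_is_derive f (y : R) : smooth f -> is_derive y 1 f (derive1 f y).
Proof.
by move=> sf; rewrite derive1E; apply: derivableP; exact: smooth_derivable.
Qed.

Lemma smooth_continuous f : smooth f -> continuous f.
Proof.
by move=> sf x; apply/differentiable_continuous/derivable1_diffP/smooth_derivable.
Qed.

Lemma is_derive_derive1 f g : (forall y : R, is_derive y 1 f (g y)) -> derive1 f = g.
Proof. by move=> fg; apply/funext => y; rewrite derive1E; apply: derive_val. Qed.

Lemma smoothS f g : (forall y : R, is_derive y 1 f (g y)) -> smooth g -> smooth f.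
Proof.
move=> fg sg [|n] y; first by rewrite derive1n0; have [] := fg y.
by rewrite derive1Sn (is_derive_derive1 fg); exact: sg.
Qed.

Lemma smooth_cst (c : R) : smooth (fun=> c).
Proof.
apply: (@smooth_coind [set f | exists c, f = fun=> c]); last by exists c.
move=> _ [{}c ->]; split; first by move=> y; exact: derivable_cst.
exists 0; apply: is_derive_derive1 => y; exact: is_derive_cst.
Qed.

Lemma smoothD f g : smooth f -> smooth g -> smooth (fun y => f y + g y).
Proof.
move=> sf sg.
pose S := [set h | exists f g, [/\ smooth f, smooth g & h = fun y : R => f y + g y]].
apply: (@smooth_coind S); last by exists f, g.
move=> _ [{}f [{}g [{}sf {}sg ->]]].
have D (y : R) : is_derive y 1 (fun y : R => f y + g y) (derive1 f y + derive1 g y).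
  by apply: is_derive1D; exact: smooth_is_derive.
split; first by move=> y; have [] := D y.
rewrite (is_derive_derive1 D).
by exists (derive1 f), (derive1 g); split; [exact: smooth_derive1..|].
Qed.

(** The product rule leaves the class of products but not that of sums of products; this replaces
    Leibniz' formula. *)
Inductive smooth_products : (R -> R) -> Prop :=
| smooth_product f g of smooth f & smooth g :
    smooth_products (fun y => f y * g y)
| smooth_products_sum f g of smooth_products f & smooth_products g :
    smooth_products (fun y => f y + g y).

Lemma smooth_productsP f : smooth_products f ->
  exists2 g, smooth_products g & forall y : R, is_derive y 1 f (g y).
Proof.
elim=> {f} [f g sf sg|f g _ [f' Sf ff'] _ [g' Sg gg']].
  exists (fun y => derive1 f y * g y + f y * derive1 g y).
    apply: smooth_products_sum; apply: smooth_product; [exact: smooth_derive1|exact: sg|exact: sf|exact: smooth_derive1].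
  by move=> y; apply: is_derive1M; exact: smooth_is_derive.
exists (fun y => f' y + g' y); first exact: smooth_products_sum.
by move=> y; apply: is_derive1D.
Qed.

Lemma smoothM f g : smooth f -> smooth g -> smooth (fun y => f y * g y).
Proof.
move=> sf sg; apply: (@smooth_coind smooth_products); last exact: smooth_product.
move=> h /smooth_productsP[h' Sh' hh']; split; first by move=> y; have [] := hh' y.
by rewrite (is_derive_derive1 hh').
Qed.

Lemma smooth_affine f (a b : R) : smooth f -> smooth (fun y => f (a * y + b)).
Proof.
move=> sf.
(* The factor [c] collects the powers of [a] produced by the chain rule. *)
pose S := [set h | exists c f, smooth f /\ h = fun y : R => c * f (a * y + b)].
rewrite (_ : (fun y => _) = fun y => 1 * f (a * y + b)); last first.
  by apply/funext => y; rewrite mul1r.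
apply: (@smooth_coind S); last by exists 1, f.
move=> _ [c [{}f [{}sf ->]]].
have D (y : R) : is_derive y 1 (fun y : R => c * f (a * y + b))
                         (c * a * derive1 f (a * y + b)).
  rewrite -mulrA; apply: (is_derive1Z (f := fun y => f (a * y + b))).
  rewrite mulrC; apply: (is_derive1_chain (g := fun y => a * y + b)).
    exact: smooth_is_derive.
  rewrite -[X in is_derive _ _ _ X]addr0 -[X in is_derive _ _ _ (X + _)]mulr1.
  by apply: is_derive1D; apply: is_derive1Z.
split; first by move=> y; have [] := D y.
rewrite (is_derive_derive1 D).
by exists (c * a), (derive1 f); split; first exact: smooth_derive1.
Qed.

(* This family is closed under differentiation, which gives smoothness. *)
Definition flat (p : {poly R}) (x : R) : R :=
  if 0 < x then p.[x^-1] * expR (- x^-1) else 0.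

(** With [t = 1 / x >= 1], one has [|p(t)| <= S t^n] and [exp t >= t^(n+1) / (n+1)!], so the
    exponential wins by one power of [t], which is the factor [x]. *)
Lemma flat_le (p : {poly R}) :
  exists K : R, forall x, 0 < x <= 1 -> `|flat p x| <= K * x.
Proof.
pose n := size p.
pose S := \sum_(i < n) `|p`_i|.
have S0 : 0 <= S by apply: sumr_ge0.
exists (S * (n.+1)`!%:R) => x /andP[x0 x1]; rewrite /flat x0.
set t := x^-1; have t0 : 0 < t by rewrite invr_gt0.
have t1 : 1 <= t by rewrite invf_ge1.
have pt : `|p.[t]| <= S * t ^+ n.
  rewrite horner_coef (le_trans (ler_norm_sum _ _ _))// mulr_suml ler_sum// => i _.
  rewrite normrM ler_wpM2l// normrX ger0_norm ?(ltW t0)//.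
  by rewrite ler_weXn2l// ltnW.
have et : t ^+ n * expR (- t) <= (n.+1)`!%:R * x.
  rewrite expRN ler_pdivrMr ?expR_gt0//.
  have et := expR_ge1Dxn n (ltW t0).
  apply: (@le_trans _ _ ((n.+1)`!%:R * x * (1 + t ^+ n.+1 / (n.+1)`!%:R))); last first.
    by rewrite ler_pM2l// mulr_gt0// ltr0n fact_gt0.
  have f0 : (n.+1)`!%:R != 0 :> R by rewrite pnatr_eq0 -lt0n fact_gt0.
  rewrite (_ : t ^+ n = (n.+1)`!%:R * x * (t ^+ n.+1 / (n.+1)`!%:R)).
    by rewrite ler_pM2l ?lerDr// mulr_gt0// ltr0n fact_gt0.
  by rewrite exprS /t; field; rewrite f0 gt_eqF.
rewrite normrM (ger0_norm (expR_ge0 _)) -mulrA.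
by rewrite (le_trans (ler_wpM2r (expR_ge0 _) pt))// -mulrA ler_wpM2l.
Qed.

Lemma is_derive_flat p (x : R) :
  is_derive x 1 (flat p) (flat ('X^2 * (p - p^`())) x).
Proof.
have [x0|x0|->] := ltgtP x 0.
- rewrite /flat ltNge (ltW x0)/=.
  apply: (@near_eq_is_derive _ _ _ (fun=> 0 : R)).
  near=> y; rewrite ltNge (_ : y <= 0)//.
  by apply/ltW; near: y; exact: lt_nbhsl.
- have -> : flat ('X^2 * (p - p^`())) x = 
      - x ^- 2 *: p^`().[x^-1] * expR (- x^-1) + p.[x^-1] * (expR (- x^-1) * x ^- 2).
    rewrite /flat x0 hornerM hornerXn hornerD hornerN exprVn /GRing.scale/=; ring.
  have x00 : x != 0 by rewrite gt_eqF.
  have D1 : is_derive x 1 (fun y : R => y^-1) (- x ^- 2).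
    have := @is_deriveV _ id x 1 1 x00 (is_derive_id _ _).
    by rewrite /GRing.scale/= mulr1.
  have D2 := is_derive1_chain (is_derive_poly p x^-1) D1.
  have D1N : is_derive x 1 (fun y : R => - y^-1) (- - x ^- 2) := is_deriveN D1.
  have D3 := is_derive1_chain (g := fun y => - y^-1) (is_derive_expR (- x^-1)) D1N.
  apply: near_eq_is_derive (is_derive_eq (is_derive1M D2 D3) _).
    near=> y; rewrite /flat (_ : 0 < y)//.
    by near: y; exact: lt_nbhsr.
  by rewrite opprK /GRing.scale/=; ring.
(* At 0 the difference quotient [h^-1 * flat p h] is [flat ('X * p) h] for [h > 0], which [flat_le]
   bounds by a multiple of [h]. *)
- have D : h^-1 *: (flat p (h *: 1 + 0) - flat p 0) @[h --> 0^'] --> (0 : R).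
    have [K HK] := flat_le ('X * p).
    apply/cvgr0Pnorm_le => e e0; near=> h.
    rewrite /GRing.scale/= mulr1 addr0 {2}/flat ltxx subr0.
    have h0 : h != 0 by near: h; exact: nbhs_dnbhs_neq.
    have [hp|hn] := ltP 0 h; last by rewrite /flat ltNge hn/= mulr0 normr0 ltW.
    have -> : h^-1 * flat p h = flat ('X * p) h.
      by rewrite /flat hp hornerM hornerX mulrA.
    have h1 : `|h| < 1 by near: h; apply: dnbhs0_lt.
    rewrite (le_trans (HK h _))//; first by rewrite hp -(ger0_norm (ltW hp)) ltW.
    rewrite (@le_trans _ _ (`|K| * h))// ?ler_wpM2r ?(ltW hp) ?ler_norm//.
    have : `|h| < e / (`|K| + 1) by near: h; apply: dnbhs0_lt; rewrite divr_gt0// ltr_wpDl.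
    rewrite (ger0_norm (ltW hp)) ltr_pdivlMr; last by rewrite ltr_wpDl.
    move=> /ltW; apply: le_trans; rewrite mulrDr mulr1 mulrC lerDl; exact: ltW.
  have dv : derivable (flat p) 0 1 by apply/cvg_ex; exists 0.
  apply: DeriveDef => //.
  rewrite /flat ltxx; apply/cvg_lim => //.
Unshelve. all: by end_near.
Qed.

Lemma smooth_flat p : smooth (flat p).
Proof.
apply: (@smooth_coind [set f | exists p, f = flat p]); last by exists p.
move=> _ [{}p ->]; split; first by move=> y; have [] := is_derive_flat p y.
by rewrite (is_derive_derive1 (is_derive_flat p)); eexists.
Qed.

(** This is [exp (- 1 / x)] for [x > 0]. It tends to 1 at infinity, so its dilations converge to the
    indicator of the positive half-line. *)
Definition smooth_step : R -> R := flat 1.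

Lemma smooth_step_ge0 x : 0 <= smooth_step x.
Proof.
by rewrite /smooth_step /flat; case: ifP => // _; rewrite hornerC mul1r expR_ge0.
Qed.

Lemma smooth_step_le1 x : smooth_step x <= 1.
Proof.
rewrite /smooth_step /flat; case: ifP => // x0; rewrite hornerC mul1r.
by rewrite -expR0 ler_expR oppr_le0 invr_ge0 ltW.
Qed.

Lemma smooth_step_cvg x :
  smooth_step (n.+1%:R * x) @[n --> \oo] --> ((0 < x)%R%:R : R).
Proof.
rewrite /smooth_step /flat; have [x0|x0] := ltP 0 x; last first.
  apply: cvg_near_cst; apply: nearW => n; case: ifP => //.
  by rewrite pmulr_rgt0// ltNge x0.
under eq_fun => n do rewrite pmulr_rgt0// x0 hornerC mul1r.
have -> : true%:R = expR (- 0) :> R by rewrite oppr0 expR0.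
apply: (@continuous_cvg _ _ _ _ _ (fun n => (n.+1%:R * x)^-1) (fun y : R => expR (- y))).
  by apply: continuous_comp; [exact: opp_continuous|exact: continuous_expR].
under eq_fun => n do rewrite invfM.
rewrite -(mul0r x^-1); apply: cvgM; last exact: cvg_cst.
exact: cvg_harmonic.
Qed.

(** For every [n] the bump vanishes outside []a, b[], and it tends to the indicator of this interval
    as [n] grows. With rational end points this is a countable family of test functions that detects
    every element of L2. *)
Definition bump (a b : R) (n : nat) (y : R) : R :=
  smooth_step (n.+1%:R * (y - a)) * smooth_step (n.+1%:R * (b - y)).

Lemma smooth_bump a b n : smooth (bump a b n).
Proof.
apply: smoothM.
  under eq_fun => y do rewrite mulrBr.
  by apply: (@smooth_affine smooth_step); exact: smooth_flat.
under eq_fun => y do rewrite mulrBr addrC -mulNr.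
by apply: (@smooth_affine smooth_step); exact: smooth_flat.
Qed.

Lemma bump_ge0 a b n y : 0 <= bump a b n y.
Proof. by rewrite mulr_ge0// smooth_step_ge0. Qed.

Lemma bump_le1 a b n y : bump a b n y <= 1.
Proof. by rewrite mulr_ile1// ?smooth_step_ge0 ?smooth_step_le1. Qed.

Lemma bump_out a b n y : ~~ (a < y < b) -> bump a b n y = 0.
Proof.
rewrite negb_and -!leNgt => /orP[ya|yb]; rewrite /bump.
  by rewrite {1}/smooth_step /flat pmulr_rgt0// subr_gt0 ltNge ya/= mul0r.
by rewrite mulrC {1}/smooth_step /flat pmulr_rgt0// subr_gt0 (ltNge y) yb/= mul0r.
Qed.

Lemma bump_cvg a b y : bump a b n y @[n --> \oo] --> (\1_(`]a, b[) y : R).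
Proof.
rewrite indicE (_ : (y \in _)%:R = (0 < y - a)%R%:R * (0 < b - y)%R%:R :> R).
  by apply: cvgM; exact: smooth_step_cvg.
by rewrite mem_setE in_itv/= !subr_gt0 -natrM mulnb.
Qed.

Lemma test_fun_bump a b n : 0 < a -> b < 1 -> test_fun (bump a b n).
Proof.
move=> a0 b1; split; first exact: smooth_bump.
exists a, b; split => // y yab; apply: bump_out; apply: contra yab => /andP[ay yb].
by rewrite !ltW.
Qed.

End Smooth.

(** * Fubini, test functions and primitives *)

Section RFubini.
Context d1 d2 (T1 : measurableType d1) (T2 : measurableType d2) (R : realType).
Variables (m1 : {sigma_finite_measure set T1 -> \bar R}).
Variables (m2 : {sigma_finite_measure set T2 -> \bar R}).
Variable f : T1 * T2 -> R.
Hypothesis fi : (m1 \x m2)%E.-integrable setT (EFin \o f).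

Lemma integrable_Rfubini_F :
  m1.-integrable setT (EFin \o (fun x => \int[m2]_y f (x, y))).
Proof.
apply: le_integrable (integrable_fubini_F fi) => //.
- apply/measurable_EFinP; apply: measurableT_comp (fine_measurable measurableT) _ => //.
  exact: measurable_fubini_F fi.
(* Where the inner integral is infinite, [Rintegral] takes the default value 0, which respects the
   bound. *)
- move=> x _; rewrite /Rintegral/= /fubini_F/=.
  by case: (\int[m2]_y _)%E => [r| |]//=; rewrite normr0 leey.
Qed.

Lemma integrable_fubini_G : m2.-integrable setT (fubini_G m1 (EFin \o f)).
Proof.
have mf : measurable_fun setT (EFin \o f) by case/integrableP: fi.
apply/integrableP; split; first exact: measurable_fubini_G fi.
apply: le_lt_trans ((integrable21ltyP m1 m2 mf).1 fi).
apply: ge0_le_integral => //.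
- by apply: measurableT_comp => //; exact: measurable_fubini_G fi.
- apply: (measurable_fun_fubini_tonelli_G (fun z => `|(EFin \o f) z|%E)) => //.
  exact: measurableT_comp.
- move=> y _; apply: le_abse_integral => //.
  exact: measurableT_comp mf (measurable_pair2 y).
Qed.

Lemma integrable_Rfubini_G :
  m2.-integrable setT (EFin \o (fun y => \int[m1]_x f (x, y))).
Proof.
apply: le_integrable integrable_fubini_G => //.
- apply/measurable_EFinP; apply: measurableT_comp (fine_measurable measurableT) _ => //.
  exact: measurable_fubini_G fi.
- move=> x _; rewrite /Rintegral/= /fubini_G/=.
  by case: (\int[m1]_y _)%E => [r| |]//=; rewrite normr0 leey.
Qed.

Lemma Rintegral12_prod :
  \int[m1]_x \int[m2]_y f (x, y) = \int[(m1 \x m2)%E]_z f z.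
Proof.
rewrite /Rintegral -(integral12_prod_meas1 fi); congr fine.
apply: ae_eq_integral => //.
- by have /integrableP[] := integrable_Rfubini_F.
- exact: measurable_fubini_F fi.
- have /(integrable_ae measurableT) := integrable_fubini_F fi.
  by apply: filterS => x /= /(_ I) fx _; rewrite -[RHS]fineK.
Qed.

Lemma Rintegral21_prod :
  \int[m2]_y \int[m1]_x f (x, y) = \int[(m1 \x m2)%E]_z f z.
Proof.
rewrite /Rintegral -(integral21_prod_meas1 fi); congr fine.
apply: ae_eq_integral => //.
- by have /integrableP[] := integrable_Rfubini_G.
- exact: measurable_fubini_G fi.
- have /(integrable_ae measurableT) := integrable_fubini_G.
  by apply: filterS => x /= /(_ I) fx _; rewrite -[RHS]fineK.
Qed.

Lemma RFubini :
  \int[m1]_x \int[m2]_y f (x, y) = \int[m2]_y \int[m1]_x f (x, y).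
Proof. by rewrite Rintegral12_prod Rintegral21_prod. Qed.

End RFubini.

Section Test.
Variable R : realType.
Notation mu := (@mu01 R).
Implicit Types (f g b : L2 R) (phi psi : R -> R).

Lemma test_fun_smooth phi : test_fun phi -> smooth phi.
Proof. by case. Qed.

Lemma test_fun_continuous phi : test_fun phi -> continuous phi.
Proof. by move=> /test_fun_smooth; exact: smooth_continuous. Qed.

Lemma test_fun_measurable phi : test_fun phi ->
  measurable_fun setT (phi : measurableTypeR R -> R).
Proof. by move=> /test_fun_continuous; exact: continuous_measurable_fun. Qed.

Lemma test_fun_out phi y : test_fun phi -> y \notin `]0, 1[ -> phi y = 0.
Proof.
move=> [_ [a [b [a0 b1 H]]]] y01; apply: H; apply: contra y01 => /andP[ay yb].
by rewrite in_itv/= (lt_le_trans a0 ay) (le_lt_trans yb b1).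
Qed.

Lemma compact_support_bounded phi : continuous phi ->
  (forall y, y \notin `[0, 1] -> phi y = 0) ->
  exists M : R, forall y, `|phi y| <= M.
Proof.
move=> cphi phi0.
have cn : {within `[0%R, 1%R], continuous (fun y => `|phi y|)}.
  apply: continuous_subspaceT => y.
  by apply: (@continuous_comp _ _ _ phi Num.norm); [exact: cphi|exact: norm_continuous].
have [c _ Hc] := EVT_max ler01 cn.
exists `|phi c| => y; have [y01|y01] := boolP (y \in `[0, 1]); first exact: Hc.
by rewrite phi0// normr0.
Qed.

Lemma test_fun_bounded phi : test_fun phi -> exists M : R, forall y, `|phi y| <= M.
Proof.
move=> tphi; apply: compact_support_bounded (test_fun_continuous tphi) _ => y y01.
apply: test_fun_out => //; apply: contra y01; rewrite !in_itv/= => /andP[? ?].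
by rewrite !ltW.
Qed.

Lemma test_fun_Lfun phi : test_fun phi -> phi \in Lfun mu 2%:E.
Proof.
move=> tphi; have [M HM] := test_fun_bounded tphi.
exact: bounded_Lfun2 (test_fun_measurable tphi) HM.
Qed.

Definition testL2 phi (t : test_fun phi) : L2 R := toL2 (test_fun_Lfun t).

Lemma testL2E phi (t : test_fun phi) : testL2 t = phi :> (R -> R).
Proof. exact: toL2E. Qed.

Lemma test_fun_derive1 phi : test_fun phi -> test_fun (derive1 phi).
Proof.
move=> tphi; have [sphi [a [b [a0 b1 H]]]] := tphi.
split; first exact: smooth_derive1.
exists a, b; split=> // y; rewrite negb_and -!ltNge => yab.
have phi0 : \near y, phi y = (fun=> 0) y.
  case/orP: yab => yab; near=> z; apply: H; rewrite negb_and -!ltNge.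
    by apply/orP; left; near: z; exact: lt_nbhsl.
  by apply/orP; right; near: z; exact: lt_nbhsr.
by rewrite derive1E (near_eq_derive _ phi0) derive_cst.
Unshelve. all: by end_near.
Qed.

Lemma test_fun_cst0 : test_fun (fun=> 0 : R).
Proof.
split; first exact: smooth_cst.
by exists 2^-1, 2^-1; split => //; rewrite ?invr_gt0// invf_lt1// ltr1n.
Qed.

Lemma test_funD phi psi : test_fun phi -> test_fun psi ->
  test_fun (fun y => phi y + psi y).
Proof.
move=> [sphi [a [b [a0 b1 Hp]]]] [spsi [a' [b' [a0' b1' Hp']]]].
split; first exact: smoothD.
exists (Num.min a a'), (Num.max b b'); split.
- by rewrite lt_min a0.
- by rewrite gt_max b1.
move=> y yab; rewrite Hp ?Hp' ?addr0//; apply: contra yab => /andP[ya yb].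
  by rewrite ge_min ya le_max yb !orbT.
by rewrite ge_min ya le_max yb.
Qed.

Lemma test_funZ (c : R) phi : test_fun phi -> test_fun (fun y => c * phi y).
Proof.
move=> [sphi [a [b [a0 b1 Hp]]]]; split.
  by apply: smoothM sphi; exact: smooth_cst.
by exists a, b; split => // y /Hp ->; rewrite mulr0.
Qed.

Lemma measurable_step (x : R) : measurable_fun setT (fun s : measurableTypeR R => (s < x)%R%:R : R).
Proof.
rewrite (_ : (fun s => _) = \1_(`]-oo, x[%classic : set R)); last first.
  by apply/funext => s; rewrite indicE mem_setE in_itv.
exact: measurable_indic.
Qed.

Lemma step_Lfun (x : R) : (fun s : measurableTypeR R => (s < x)%R%:R : R) \in Lfun mu 2%:E.
Proof.
apply: (@bounded_Lfun2 _ _ _ _ _ 1); first exact: measurable_step.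
by move=> s; case: (s < x); rewrite ?normr1 ?normr0.
Qed.

Definition stepL2 (x : R) : L2 R := toL2 (step_Lfun x).

(** Written as a pairing with a step function, the primitive inherits linearity and bounds from
    [inner]. It is defined on the whole line: 0 to the left of 0, the total integral to the right of
    1. *)
Definition prim (b : R -> R) (x : R) : R := \int[mu]_s (b s * (s < x)%R%:R).

Lemma primE b x : prim b x = inner b (stepL2 x).
Proof. by rewrite /prim /inner toL2E. Qed.

(** For [x <= y] the square of the difference is the indicator of [[x, y[]. The resulting modulus of
    order 1/2 gives the continuity of primitives and, later, that of the Laplace solution into
    H1. *)
Lemma L2norm_stepB x y : L2norm (stepL2 x - stepL2 y) ^+ 2 <= `|x - y|.
Proof.
wlog xy : x y / x <= y.
  move=> H; have [xy|yx] := leP x y; first exact: H.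
  by rewrite L2normB distrC; apply: H; exact: ltW.
rewrite L2norm_sqr /inner.
have -> : \int[mu]_s ((stepL2 x - stepL2 y : L2 R) s * (stepL2 x - stepL2 y : L2 R) s)
  = \int[mu]_s (\1_(`[x, y[%classic : set R) s).
  apply: eq_Rintegral => s _.
  have -> : (stepL2 x - stepL2 y : L2 R) s = (s < x)%R%:R - (s < y)%R%:R.
    by transitivity (stepL2 x s - stepL2 y s) => //; rewrite !toL2E.
  rewrite indicE mem_setE in_itv/=.
  by have [sx|sx] := ltP s x; have [sy|sy] := ltP s y; rewrite /=; try lra;
    have := lt_le_trans sx xy; rewrite ltNge sy.
have -> : \int[mu]_s (\1_(`[x, y[%classic : set R) s) =
    fine (lebesgue_measure ((`[x, y[ `&` `]0, 1[)%classic : set R)).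
  by rewrite /Rintegral integral_indic// setIT.
rewrite ler0_norm ?subr_le0// opprB -lee_fin fineK; last first.
  rewrite ge0_fin_numE// (@le_lt_trans _ _ (lebesgue_measure (`]0%R, 1%R[%classic : set R)))//.
    by rewrite le_measure ?inE//; exact: measurableI.
  exact: lebesgue_itv01_lty.
apply: (@le_trans _ _ (lebesgue_measure (`[x, y[%classic : set R))).
  by rewrite le_measure ?inE//; exact: measurableI.
rewrite lebesgue_measure_itv/=; case: ifPn => // _.
by rewrite lee_fin subr_ge0.
Qed.

Lemma prim_holder b x y : (prim b x - prim b y) ^+ 2 <= `|x - y| * L2norm b ^+ 2.
Proof.
rewrite !primE -innerBr mulrC -[leLHS]ger0_norm ?sqr_ge0// normrX.
rewrite (@le_trans _ _ ((L2norm b * L2norm (stepL2 x - stepL2 y)) ^+ 2))//.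
  rewrite lerXn2r ?nnegrE// ?mulr_ge0 ?L2norm_ge0//.
  exact: CauchySchwarz.
by rewrite exprMn ler_wpM2l ?sqr_ge0// L2norm_stepB.
Qed.

Lemma prim_continuous b : continuous (prim b).
Proof.
move=> x; apply/cvgrPdist_lt => e e0.
have N0 : 0 < L2norm b ^+ 2 + 1 by rewrite ltr_wpDl// sqr_ge0.
have eN0 : 0 < e ^+ 2 / (L2norm b ^+ 2 + 1) by rewrite divr_gt0// exprn_gt0.
near=> t; rewrite -(@ltr_pXn2r _ 2) ?nnegrE ?(ltW e0)// -normrX ger0_norm ?sqr_ge0//.
rewrite (le_lt_trans (prim_holder _ _ _))//.
have : `|x - t| < e ^+ 2 / (L2norm b ^+ 2 + 1).
  by near: t; apply: (@cvgr_dist_lt _ _ _ _ _ id x cvg_id); exact: eN0.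
rewrite ltr_pdivlMr//; apply: le_lt_trans.
by rewrite ler_wpM2l// lerDl.
Unshelve. all: by end_near.
Qed.

Lemma prim_le0 b x : x <= 0 -> prim b x = 0.
Proof.
move=> x0; rewrite primE -[RHS](inner0r b); apply: inner_aer.
apply: filterS (ae_mu01_itv R) => s; rewrite in_itv/= => /andP[s0 _] _.
by rewrite ltNge (le_trans x0 (ltW s0)).
Qed.

Lemma prim_ge1 b x : 1 <= x -> prim b x = \int[mu]_s b s.
Proof.
move=> x1; apply: Rintegral_ae_eq => //.
  by apply: measurable_funM => //; exact: measurable_step.
apply: filterS (ae_mu01_itv R) => s; rewrite in_itv/= => /andP[_ s1] _.
by rewrite (lt_le_trans s1 x1) mulr1.
Qed.

Lemma prim_itv b x : x < 1 ->
  prim b x = \int[lebesgue_measure]_(t in `]0, x]) b t.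
Proof.
move=> x1; rewrite /prim Rintegral_mu01; last first.
  by apply: measurable_funM => //; exact: measurable_step.
have bi : lebesgue_measure.-integrable `]0%R, 1%R[ (EFin \o b).
  apply/integrable_mu01; last exact: integrable_L2.
  by apply/measurable_EFinP; exact: L2_measurable.
rewrite -Rintegral_itv_bndo_bndc; last first.
  apply: integrableS bi => //.
  by move=> y /=; rewrite !in_itv/= => /andP[-> /lt_le_trans]; apply; exact: ltW.
have -> : [set` `]0, x[] = `]0, 1[%classic `&` `]-oo, x[%classic :> set R.
  apply/seteqP; split => y /=; rewrite !in_itv/=.
    by move=> /andP[y0 yx]; rewrite y0 yx (lt_trans yx x1).
  by move=> [/andP[-> _] ->].
rewrite Rintegral_mkcondr; apply: eq_Rintegral => s _.
by rewrite patchE mem_setE in_itv/=; case: ifP; rewrite ?mulr1 ?mulr0.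
Qed.

Lemma is_derive_prim b x : x \in `]0, 1[ -> {for x, continuous b} ->
  is_derive x 1 (prim b) (b x).
Proof.
rewrite in_itv/= => /andP[x0 x1] cb.
pose u := (x + 1) / 2; have xu : x < u by rewrite /u; lra.
have u1 : u < 1 by rewrite /u; lra.
have bi : lebesgue_measure.-integrable `]0%R, 1%R[ (EFin \o b).
  apply/integrable_mu01; last exact: integrable_L2.
  by apply/measurable_EFinP; exact: L2_measurable.
have bi' : lebesgue_measure.-integrable `]0%R, u] (EFin \o b).
  apply: integrableS bi => //.
  by move=> y /=; rewrite !in_itv/= => /andP[-> /le_lt_trans]; apply.
have [D1 D2] := @continuous_FTC1 _ b (BRight 0) x u xu bi' x0 cb.
have D : is_derive x 1 (fun x : R => \int[lebesgue_measure]_(t in `]0, x]) b t) (b x).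
  by apply: (DeriveDef D1); rewrite -derive1E; exact: D2.
apply: near_eq_is_derive D; near=> y; rewrite prim_itv//.
by near: y; exact: lt_nbhsl.
Unshelve. all: by end_near.
Qed.

(** Outside (0,1) the primitive is locally constant, because the support of [phi] stays away from 0
    and 1. *)
Lemma is_derive_prim_test phi (tphi : test_fun phi) (x : R) :
  is_derive x 1 (prim phi) (phi x).
Proof.
have [x01|x01] := boolP (x \in `]0, 1[).
  have := @is_derive_prim (testL2 tphi) x x01; rewrite testL2E; apply.
  exact: test_fun_continuous.
rewrite (test_fun_out tphi x01).
have [_ [a [c [a0 c1 H]]]] := tphi.
have := x01; rewrite in_itv/= negb_and -!leNgt => /orP[x0|x1].
- apply: (@near_eq_is_derive _ _ _ (fun=> 0 : R)).
  near=> t; rewrite /prim (_ : (fun s => _) = fun=> 0) ?Rintegral_cst ?mul0r//.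
  apply/funext => s; have [st|] := ltP s t; rewrite ?mulr0// H ?mul0r//.
  rewrite negb_and -!ltNge (lt_trans st)//.
  by near: t; apply: lt_nbhsl; exact: le_lt_trans a0.
- apply: (@near_eq_is_derive _ _ _ (fun=> \int[mu]_s phi s : R)).
  near=> t; apply: eq_Rintegral => s _.
  have [st|ts] := ltP s t; rewrite ?mulr1// H ?mul0r//.
  rewrite negb_and -!ltNge; apply/orP; right; apply: lt_le_trans ts.
  by near: t; apply: lt_nbhsr; exact: lt_le_trans x1.
Unshelve. all: by end_near.
Qed.

(** The zero mean makes the primitive vanish also to the right of the support of [phi]. *)
Lemma test_fun_prim phi : test_fun phi -> \int[mu]_s phi s = 0 ->
  test_fun (prim phi).
Proof.
move=> tphi phi0; have [sphi [a [c [a0 c1 H]]]] := tphi; split.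
  by apply: smoothS sphi => y; exact: is_derive_prim_test.
exists a, c; split => // y; rewrite negb_and -!ltNge => /orP[ya|cy].
  rewrite /prim (_ : (fun s => _) = fun=> 0) ?Rintegral_cst ?mul0r//.
  apply/funext => s; have [st|] := ltP s y; rewrite ?mulr0// H ?mul0r//.
  by rewrite negb_and -!ltNge (lt_trans st).
rewrite -[RHS]phi0; apply: eq_Rintegral => s _.
have [st|ts] := ltP s y; rewrite ?mulr1// H ?mul0r//.
by rewrite negb_and -!ltNge (lt_le_trans cy ts) orbT.
Qed.

Lemma prim_derive1 phi : test_fun phi -> prim (derive1 phi) = phi.
Proof.
move=> tphi; have td := test_fun_derive1 tphi.
apply/funext => x; apply/eqP; rewrite -subr_eq0; apply/eqP.
have D (y : R) : is_derive y 1 (fun y => prim (derive1 phi) y - phi y) (0 : R).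
  rewrite -(subrr (derive1 phi y)); apply: is_derive1B.
    exact: is_derive_prim_test.
  exact/smooth_is_derive/test_fun_smooth.
rewrite (is_derive_0_is_cst x 0 D) (test_fun_out tphi) ?in_itv/= ?ltxx//.
have := prim_le0 (testL2 td) (lexx 0); rewrite testL2E => ->.
by rewrite subrr.
Qed.

Lemma Rintegral_derive1 phi : test_fun phi -> \int[mu]_s derive1 phi s = 0.
Proof.
move=> tphi; have td := test_fun_derive1 tphi.
have := prim_ge1 (testL2 td) (lexx 1); rewrite testL2E prim_derive1//.
by rewrite (test_fun_out tphi) ?in_itv/= ?ltxx ?andbF// => <-.
Qed.

(** By Fubini the left-hand side pairs [b s] with the integral of [derive1 phi] over []s, 1[]. This
    is [- phi s], since [derive1 phi] has integral 0 and primitive [phi]. *)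
Lemma prim_weak_deriv b phi : test_fun phi ->
  \int[mu]_x (prim b x * derive1 phi x) = - \int[mu]_x (b x * phi x).
Proof.
move=> tphi; have td := test_fun_derive1 tphi.
pose F (z : R * R) : R := b z.2 * (z.2 < z.1)%R%:R * derive1 phi z.1.
have [M HM] := test_fun_bounded td.
have M0 : 0 <= M by rewrite (le_trans _ (HM 0)).
have mF : measurable_fun setT (F : measurableTypeR R * measurableTypeR R -> R).
  apply: measurable_funM; last first.
    by apply: measurableT_comp (test_fun_measurable td) _; exact: measurable_fst.
  apply: measurable_funM.
    by apply: measurableT_comp (L2_measurable b) _; exact: measurable_snd.
  apply: (measurableT_comp (f := fun c : bool => c%:R : R)) => //.
  by apply: measurable_fun_ltr.
have Fi : (mu \x mu)%E.-integrable setT (EFin \o F).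
  apply/integrable12ltyP; first exact/measurable_EFinP.
  apply: (@le_lt_trans _ _ (\int[mu]_x \int[mu]_y (`|b y| * M)%:E)%E).
    apply: ge0_le_integral => //.
    - by move=> x _; apply: integral_ge0.
    - apply: (@measurable_fun_fubini_tonelli_F _ _ _ _ _ mu (fun z => `|(EFin \o F) z|%E)) => //.
      by apply: measurableT_comp => //; exact/measurable_EFinP.
    move=> x _; apply: ge0_le_integral => //.
    - apply: measurableT_comp => //; apply/measurable_EFinP.
      by apply: measurableT_comp mF _; exact: measurable_pair1.
    - by apply/measurable_EFinP; apply: measurable_funM => //; apply: measurableT_comp.
    - move=> y _; rewrite lee_fin /F/= !normrM ler_pM//.
      by case: (y < x); rewrite ?normr1 ?normr0 ?mulr1 ?mulr0.
  have bMi : (\int[mu]_y (`|b y| * M)%:E < +oo)%E.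
    under eq_integral => y _ do rewrite EFinM.
    rewrite integralZr//; last exact/integrable_norm/integrable_L2.
    have /integrableP[_ bi] := integrable_L2 b.
    by rewrite muleC lte_mul_pinfty// ?lee_fin// ge0_fin_numE ?integral_ge0.
  have bM0 : (0 <= \int[mu]_y (`|b y| * M)%:E)%E.
    by apply: integral_ge0 => y _; rewrite lee_fin mulr_ge0.
  rewrite integral_cst// lte_mul_pinfty// ?ge0_fin_numE//.
  by rewrite ltey_eq fin_num_measure.
transitivity (\int[mu]_x \int[mu]_y F (x, y)).
  apply: eq_Rintegral => x _; rewrite /F/= RintegralZr//.
  by have := integrable_L2M b (stepL2 x); rewrite toL2E.
rewrite (RFubini Fi) -mulN1r -RintegralZl//; last first.
  by have := integrable_L2M b (testL2 tphi); rewrite testL2E.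
apply: Rintegral_ae_eq.
- by have /integrableP[/measurable_EFinP] := integrable_Rfubini_G Fi.
- apply: measurable_funM => //; apply: measurable_funM => //.
  exact: test_fun_measurable.
apply: aeW => s _; rewrite /F/=.
under eq_Rintegral => x _ do rewrite -mulrA.
rewrite RintegralZl//; last first.
  apply: (@integrable_bounded _ _ _ mu _ M).
    apply: measurable_funM; last exact: test_fun_measurable.
    apply: (measurableT_comp (f := fun c : bool => c%:R : R)) => //.
    by apply: measurable_fun_ltr.
  by move=> x; rewrite normrM; case: (s < x); rewrite ?normr1 ?normr0 ?mul1r ?mul0r.
rewrite mulN1r -mulrN; congr (_ * _).
have := Rintegral_derive1 tphi.
have -> : \int[mu]_s derive1 phi s =
  \int[mu]_x ((s < x)%R%:R * derive1 phi x) + \int[mu]_x (derive1 phi x * (x < s)%R%:R).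
  rewrite -RintegralD//.
  - apply: Rintegral_ae_eq.
    + exact: test_fun_measurable.
    + apply: measurable_funD; apply: measurable_funM; try exact: test_fun_measurable.
        apply: (measurableT_comp (f := fun c : bool => c%:R : R)) => //.
        by apply: measurable_fun_ltr.
      exact: measurable_step.
    have : {ae mu, forall x, x != s}.
      apply/ae_mu01P; exists [set s]; split => //; first exact: lebesgue_measure_set1.
      by move=> x /=; apply: contra_notP => /eqP xs _.
    apply: filterS => x xs _; have [sx|sx|sx] := ltgtP s x; rewrite ?mul1r ?mulr1 ?mul0r ?mulr0 ?addr0 ?add0r//.
    by rewrite sx eqxx in xs.
  - apply: (@integrable_bounded _ _ _ mu _ M).
      apply: measurable_funM; last exact: test_fun_measurable.
      apply: (measurableT_comp (f := fun c : bool => c%:R : R)) => //.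
      by apply: measurable_fun_ltr.
    by move=> x; rewrite normrM; case: (s < x); rewrite ?normr1 ?normr0 ?mul1r ?mul0r.
  - by have := integrable_L2M (testL2 td) (stepL2 s); rewrite testL2E toL2E.
rewrite -/(prim (derive1 phi) s) prim_derive1// => /eqP.
by rewrite addr_eq0 => /eqP.
Qed.

End Test.

(** * The fundamental lemma and weak derivatives *)

Section Fundamental.
Variable R : realType.
Notation mu := (@mu01 R).
Implicit Types (f g b : L2 R) (phi psi : R -> R).

Lemma continuous_measurable (g : R -> R) : continuous g ->
  measurable_fun setT (g : measurableTypeR R -> R).
Proof. exact: continuous_measurable_fun. Qed.

Lemma Rintegral_mu01_cst (c : R) : \int[mu]_y c = c.
Proof.
transitivity (c * fine (mu setT)); first exact: Rintegral_cst.
by rewrite mu01T mulr1.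
Qed.

Lemma ae_continuous_eq (g : R -> R) (c : R) : continuous g ->
  g = (fun=> c) %[ae mu] -> forall x, x \in `[0, 1] -> g x = c.
Proof.
move=> cg gc x; rewrite in_itv/= => /andP[x0 x1]; apply: contrapT => gx.
have : \near x, g x != c.
  have e0 : 0 < `|g x - c| by rewrite normr_gt0 subr_eq0; exact/eqP.
  near=> t; apply/eqP => gt.
  have : `|g x - g t| < `|g x - c|.
    by near: t; exact: (@cvgr_dist_lt _ _ _ _ _ g (g x) (cg x)).
  by rewrite gt ltxx.
move=> /nbhs_ballP[d /= d0 gd].
(* The ball around [x] meets (0,1) in a nondegenerate interval even if [x] is an end point, and such
   an interval is not null. *)
pose a := Num.max 0 (x - d); pose b := Num.min 1 (x + d).
have ab : a < b by rewrite /a /b lt_min !gt_max; lra.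
have [N [mN N0 HN]] : (@lebesgue_measure R).-negligible `]a, b[.
  have /ae_mu01P : {ae mu, forall x, g x = c} by apply: filterS gc => y; apply.
  apply: negligibleS => y /=; rewrite in_itv/= /a /b gt_max lt_min.
  move=> /andP[/andP[y0 ya] /andP[y1 yb]]; apply/not_implyP; split.
    by rewrite in_itv/= y0.
  apply/eqP/gd; rewrite /ball/= ltr_distlC; apply/andP; lra.
have := le_measure lebesgue_measure (_ : `]a, b[%classic \in measurable) _ HN.
rewrite !inE => /(_ (measurable_itv _) mN); rewrite [X in (_ <= X)%E]N0.
have lab : ((b - a)%:E <= lebesgue_measure (`]a, b[%classic : set R))%E.
  by rewrite lebesgue_measure_itv/= lte_fin ab EFinB.
by move=> /(le_trans lab); rewrite lee_fin subr_le0 leNgt ab.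
Unshelve. all: by end_near.
Qed.

Lemma prim_bound b x : `|prim b x| <= L2norm b.
Proof.
have H y : 0 <= y <= 1 -> `|prim b y| <= L2norm b.
  move=> /andP[y0 y1]; rewrite -(@ler_pXn2r _ 2) ?nnegrE ?L2norm_ge0//.
  have := prim_holder b y 0; rewrite (prim_le0 _ (lexx 0)) !subr0 -normrX.
  rewrite (ger0_norm (sqr_ge0 _)) => /le_trans; apply.
  by rewrite (ger0_norm y0) ler_piMl ?sqr_ge0.
have [x0|x0] := leP x 0; first by rewrite prim_le0// normr0 L2norm_ge0.
have [x1|x1] := leP x 1; first by apply: H; rewrite ltW.
by rewrite prim_ge1 ?(ltW x1)// -(prim_ge1 _ (lexx 1)) H ?ler01/=.
Qed.

Lemma prim_Lfun b : prim b \in Lfun mu 2%:E.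
Proof.
apply: (@bounded_Lfun2 _ _ _ _ _ (L2norm b)); last exact: prim_bound.
by apply: continuous_measurable; exact: prim_continuous.
Qed.

Definition primL2 b : L2 R := toL2 (prim_Lfun b).

Lemma primL2E b : primL2 b = prim b :> (R -> R).
Proof. exact: toL2E. Qed.

Definition cstL2 (c : R) : L2 R := toL2 (Lfun_cst mu c 2).

Lemma cstL2E (c : R) : cstL2 c = (fun=> c) :> (R -> R).
Proof. exact: toL2E. Qed.

Lemma inner_testr f phi (t : test_fun phi) :
  inner f (testL2 t) = \int[mu]_y (f y * phi y).
Proof. by rewrite /inner testL2E. Qed.

Lemma L2norm_prim b : L2norm (primL2 b) <= L2norm b.
Proof.
rewrite -(@ler_pXn2r _ 2) ?nnegrE ?L2norm_ge0// L2norm_sqr /inner.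
have -> : L2norm b ^+ 2 = \int[mu]_y (cst (L2norm b ^+ 2) y).
  by rewrite Rintegral_mu01_cst.
apply: le_Rintegral => //; first exact: integrable_L2M.
  exact: finite_measure_integrable_cst.
move=> y _; rewrite primL2E -expr2 /= -[leLHS]ger0_norm ?sqr_ge0// normrX.
by rewrite lerXn2r ?nnegrE ?L2norm_ge0 ?prim_bound.
Qed.

(* Countably many test functions suffice: this lets quantifiers over test
   functions and almost everywhere statements be exchanged. *)
Lemma L2_eq0_bump f :
  (forall (p q : rat) n, 0 < ratr p :> R -> ratr q < 1 :> R ->
     \int[mu]_y (f y * bump (ratr p) (ratr q) n y) = 0) ->
  f = 0 %[ae mu].
Proof.
move=> H.
(* As [n] grows the bumps tend to the indicator of []p, q[], so that [f] has integral 0 over it. *)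
have Hpq (p q : rat) : 0 < ratr p :> R -> ratr q < 1 :> R -> (p < q) ->
    prim f (ratr p) = prim f (ratr q).
  move=> p0 q1 pq.
  have mb n : measurable_fun setT (bump (ratr p : R) (ratr q) n : measurableTypeR R -> R).
    by apply: test_fun_measurable; exact: test_fun_bump.
  have mi : measurable_fun setT
     (\1_(`]ratr p, ratr q[%classic : set R) : measurableTypeR R -> R).
    exact: measurable_indic.
  have [||_ Hlim] := @Rintegral_dominated _ _ _ mu
    (fun n y => f y * bump (ratr p) (ratr q) n y)
    (fun y => f y * \1_(`]ratr p, ratr q[) y) (fun y => `|f y|)
    (fun n => measurable_funM (L2_measurable f) (mb n))
    (measurable_funM (L2_measurable f) mi)
    (integrable_norm (integrable_L2 f)).
  - by apply: aeW => y; apply: cvgMr; exact: bump_cvg.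
  - move=> n; apply: aeW => y.
    by rewrite normrM ler_piMr// ger0_norm ?bump_ge0 ?bump_le1.
  have Hi : \int[mu]_y (f y * \1_(`]ratr p, ratr q[) y) = 0.
    have e0 : (fun n => \int[mu]_y (f y * bump (ratr p) (ratr q) n y)) = fun=> 0.
      by apply/funext => n; exact: H.
    by rewrite e0 in Hlim; exact: (cvg_unique _ Hlim (cvg_cst 0)).
  apply/eqP; rewrite eq_sym -subr_eq0 !primE -innerBr -Hi; apply/eqP.
  apply: Rintegral_ae_eq; try exact: measurable_funM.
  have : {ae mu, forall x, x != ratr p}.
    apply/ae_mu01P; exists [set ratr p]; split => //; first exact: lebesgue_measure_set1.
    by move=> x /=; apply: contra_notP => /eqP xs _.
  apply: filterS => y yp _; congr (_ * _).
  transitivity (stepL2 (ratr q) y - stepL2 (ratr p) y) => //; rewrite !toL2E.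
  rewrite indicE mem_setE in_itv/=.
  have pq' : ratr p < ratr q :> R by rewrite ltr_rat.
  have [yq|yq] := ltP y (ratr q); have [yp'|yp'] := ltP y (ratr p).
  - by rewrite subrr ltNge (ltW yp').
  - by rewrite subr0 lt_def yp yp'.
  - by have := lt_trans yp' pq'; rewrite ltNge yq.
  - by rewrite subrr andbF.
suff H0 : {ae mu, forall x, f x = 0} by apply: filterS H0 => x fx _; exact: fx.
have [p0] := @rat_in_itvoo _ (0 : R) 1 ltr01; rewrite in_itv/= => /andP[p00 p01].
(* The primitive takes the same value at all rationals of (0,1), hence is constant there by
   continuity. *)
have Hx x : x \in `]0, 1[ -> prim f x = prim f (ratr p0).
  rewrite in_itv/= => /andP[x0 x1]; apply: contrapT => Fx.
  have : \near x, prim f x != prim f (ratr p0).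
    have e0 : 0 < `|prim f x - prim f (ratr p0)| by rewrite normr_gt0 subr_eq0; exact/eqP.
    near=> t; apply/eqP => gt.
    have : `|prim f x - prim f t| < `|prim f x - prim f (ratr p0)|.
      by near: t; exact: (@cvgr_dist_lt _ _ _ _ _ (prim f) (prim f x) (@prim_continuous _ f x)).
    by rewrite gt ltxx.
  move=> /nbhs_ballP[d /= d0 gd].
  have ab : Num.max 0 (x - d) < Num.min 1 (x + d) by rewrite lt_min !gt_max; lra.
  have [q] := rat_in_itvoo ab.
  rewrite in_itv/= gt_max lt_min => /andP[/andP[q0 qa] /andP[q1 qb]].
  have /negP[] : prim f (ratr q) != prim f (ratr p0).
    by apply: gd; rewrite /ball/= ltr_distlC; apply/andP; lra.
  have [pq|pq|->//] := ltgtP q p0; first by rewrite (Hpq q p0).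
  by rewrite (Hpq p0 q).
have fi : lebesgue_measure.-integrable `]0%R, 1%R[ (EFin \o f).
  apply/integrable_mu01; last exact: integrable_L2.
  by apply/measurable_EFinP; exact: L2_measurable.
(* Cut off to (0,1), [f] is integrable on the line. Lebesgue's differentiation theorem then
   identifies it a.e. with the derivative of a constant primitive. *)
pose f' := f \_ `]0%R, 1%R[.
have fi' : lebesgue_measure.-integrable setT (EFin \o f').
  by move: fi; rewrite integrable_mkcond; [rewrite restrict_EFin|exact: measurable_itv].
have i1 (y : R) : lebesgue_measure.-integrable [set` Interval (BRight 0) (BRight y)] (EFin \o f').
  by apply: integrableS fi' => //; exact: measurable_itv.
have li : locally_integrable [set: R] f'.
  by apply: integrable_locally fi; exact: measurable_itv.
have /= := FTC1 i1 li.
move=> D; apply/ae_mu01P.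
apply: (@filterS _ _ (ae_filter_ringOfSetsType lebesgue_measure) _ _ _ D) => {D} x D.
rewrite in_itv/= => /andP[x0 x1].
have [_] := D x0; rewrite /f' patchE mem_setE in_itv/= x0 x1/= => <-.
rewrite derive1E; have : \near x, \int[lebesgue_measure]_(t in `]0, x]) f' t =
    (fun=> prim f (ratr p0)) x.
  near=> t.
  have t0 : 0 < t by near: t; exact: lt_nbhsr.
  have t1 : t < 1 by near: t; exact: lt_nbhsl.
  rewrite -(Hx t) ?in_itv/= ?t0// prim_itv//; apply: eq_Rintegral => s.
  rewrite mem_setE in_itv/= => /andP[s0 st].
  by rewrite /f' patchE mem_setE in_itv/= s0 (le_lt_trans st t1).
by move=> /near_eq_derive ->; rewrite derive_cst.
Unshelve. all: by end_near.
Qed.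

Lemma L2_eq0_test f :
  (forall phi, test_fun phi -> \int[mu]_y (f y * phi y) = 0) -> f = 0 %[ae mu].
Proof. by move=> H; apply: L2_eq0_bump => p q n p0 q1; apply: H; exact: test_fun_bump. Qed.

(** If all test functions had integral 0, the constant 1 would vanish a.e.; otherwise one of them
    can be normalized. *)
Lemma exists_unit_test : exists2 phi0 : R -> R, test_fun phi0 &
  \int[mu]_y phi0 y = 1.
Proof.
apply: contrapT => H.
have : cstL2 1 = 0 %[ae mu].
  apply: L2_eq0_test => phi tphi; rewrite cstL2E.
  under eq_Rintegral do rewrite mul1r.
  apply: contrapT => /eqP m0; apply: H.
  exists (fun y => (\int[mu]_y phi y)^-1 * phi y); first exact: test_funZ.
  rewrite RintegralZl ?mulVf//; have := integrable_L2 (testL2 tphi).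
  by rewrite testL2E.
rewrite cstL2E => /(@ae_continuous_eq _ 0 (fun=> @cvg_cst _ _ _ _ _)) /(_ 0).
by rewrite in_itv/= lexx ler01 => /(_ isT) /eqP; rewrite oner_eq0.
Qed.

(** For [phi0] of integral 1 this has integral 0, so that its primitive is again a test function. *)
Definition meanfree (phi0 phi : R -> R) (y : R) : R :=
  phi y - (\int[mu]_y phi y) * phi0 y.

Lemma test_fun_meanfree phi0 phi : test_fun phi0 -> test_fun phi ->
  test_fun (meanfree phi0 phi).
Proof.
move=> t0 tphi.
have := test_funD tphi (test_funZ (- (\int[mu]_y phi y)) t0).
by rewrite /meanfree; under [X in test_fun X]eq_fun do rewrite mulNr.
Qed.

Lemma Rintegral_meanfree phi0 phi : test_fun phi0 -> test_fun phi ->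
  \int[mu]_y phi0 y = 1 -> \int[mu]_y meanfree phi0 phi y = 0.
Proof.
move=> t0 tphi m0.
have i0 := integrable_L2 (testL2 t0); have i1 := integrable_L2 (testL2 tphi).
rewrite testL2E in i0; rewrite testL2E in i1.
rewrite RintegralB//; last first.
  exact: (integrableZl measurableT _ i0).
by rewrite RintegralZl// m0 mulr1 subrr.
Qed.

(** With [c = <f, phi0>], the pairing of [f] with the mean-free part of a bump is the pairing of
    [f - c] with the bump itself. *)
Lemma L2_eq_cst_bump f phi0 : test_fun phi0 -> \int[mu]_y phi0 y = 1 ->
  (forall (p q : rat) n, 0 < ratr p :> R -> ratr q < 1 :> R ->
     \int[mu]_y (f y * meanfree phi0 (bump (ratr p) (ratr q) n) y) = 0) ->
  exists c, f = cstL2 c %[ae mu].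
Proof.
move=> t0 m0 H; exists (inner f (testL2 t0)).
suff : f - cstL2 (inner f (testL2 t0)) = 0 %[ae mu].
  apply: filterS => y /(_ I) fy _.
  by apply/eqP; rewrite -subr_eq0; apply/eqP; exact: fy.
apply: L2_eq0_bump => p q n p0 q1.
have tb : test_fun (bump (ratr p : R) (ratr q) n) by exact: test_fun_bump.
have := H p q n p0 q1; set phi := bump _ _ n in tb *.
have <- := inner_testr (f - _) tb.
have <- := inner_testr f (test_fun_meanfree t0 tb).
have -> : inner f (testL2 (test_fun_meanfree t0 tb)) =
   inner f (testL2 tb - (\int[mu]_y phi y) *: testL2 t0).
  congr (inner f _); apply/LfuneqP => y; rewrite testL2E /meanfree.
  by transitivity (testL2 tb y - (\int[mu]_y phi y) * testL2 t0 y) => //; rewrite !testL2E.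
rewrite innerBr innerZr innerBl => <-; congr (_ - _).
rewrite [in LHS]/inner cstL2E testL2E RintegralZl 1?mulrC//.
by have := integrable_L2 (testL2 tb); rewrite testL2E.
Qed.

(** Every mean-free test function is the derivative of a test function, so [f] is orthogonal to all
    of them. *)
Lemma weak_deriv0_cst f : weak_deriv f 0 -> exists c, f = cstL2 c %[ae mu].
Proof.
move=> fd; have [phi0 t0 m0] := exists_unit_test.
apply: (L2_eq_cst_bump t0 m0) => p q n p0 q1.
have tb := test_fun_bump n p0 q1.
have tm := test_fun_meanfree t0 tb.
have tp := test_fun_prim tm (Rintegral_meanfree t0 tb m0).
have := fd _ tp; rewrite (is_derive_derive1 (is_derive_prim_test tm)) => ->.
under eq_Rintegral do rewrite mul0r.
by rewrite Rintegral_cst// mul0r oppr0.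
Qed.

Lemma weak_derivP f g : weak_deriv f g <-> forall phi (t : test_fun phi),
  inner f (testL2 (test_fun_derive1 t)) = - inner g (testL2 t).
Proof.
split=> H phi t; first by rewrite !inner_testr H.
by have := H phi t; rewrite !inner_testr.
Qed.

Lemma weak_deriv_prim b : weak_deriv (primL2 b) b.
Proof. by move=> phi tphi; rewrite primL2E prim_weak_deriv. Qed.

Lemma weak_deriv_lin (a : R) f g f' g' : weak_deriv f f' -> weak_deriv g g' ->
  weak_deriv (a *: f + g) (a *: f' + g').
Proof.
move=> /weak_derivP ff /weak_derivP gg; apply/weak_derivP => phi t.
by rewrite !innerDl !innerZl ff gg opprD mulrN.
Qed.

Lemma weak_derivD f g f' g' : weak_deriv f f' -> weak_deriv g g' ->
  weak_deriv (f + g) (f' + g').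
Proof. by move=> ff gg; have := weak_deriv_lin 1 ff gg; rewrite !scale1r. Qed.

Lemma weak_derivB f g f' g' : weak_deriv f f' -> weak_deriv g g' ->
  weak_deriv (f - g) (f' - g').
Proof.
by move=> ff gg; have := weak_deriv_lin (-1) gg ff; rewrite !scaleN1r !(addrC (- _)).
Qed.

Lemma weak_deriv_ae f g f' g' : f = g %[ae mu] -> f' = g' %[ae mu] ->
  weak_deriv f f' -> weak_deriv g g'.
Proof.
move=> fg fg' /weak_derivP H; apply/weak_derivP => phi t.
by rewrite -(inner_ael _ fg) -(inner_ael _ fg') H.
Qed.

Lemma weak_deriv_uniq f g g' : weak_deriv f g -> weak_deriv f g' -> g = g' %[ae mu].
Proof.
move=> /weak_derivP fg /weak_derivP fg'.
have : g - g' = 0 %[ae mu].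
  apply: L2_eq0_test => phi t; rewrite -(inner_testr _ t) innerBl.
  by have := fg _ t; rewrite fg' => /oppr_inj ->; rewrite subrr.
by apply: filterS => y /(_ I) fy _; apply/eqP; rewrite -subr_eq0; apply/eqP; exact: fy.
Qed.

Lemma weak_deriv_cst (c : R) : weak_deriv (cstL2 c) 0.
Proof.
apply/weak_derivP => phi t; rewrite inner0l oppr0 inner_testr cstL2E.
rewrite RintegralZl ?Rintegral_derive1 ?mulr0//.
by have := integrable_L2 (testL2 (test_fun_derive1 t)); rewrite testL2E.
Qed.

Lemma weak_deriv_repr f g : weak_deriv f g ->
  exists c, f = cstL2 c + primL2 g %[ae mu].
Proof.
move=> fg; have := weak_derivB fg (weak_deriv_prim g).
rewrite subrr => /weak_deriv0_cst[c fc]; exists c.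
apply: filterS fc => y /(_ I) fc _; apply/eqP; rewrite -subr_eq; apply/eqP; exact: fc.
Qed.

(** Composition with this 1-Lipschitz retraction extends a function continuous on [[0, 1]] to a
    bounded continuous function on the line, hence to an element of L2. *)
Definition clamp01 (x : R) : R := Num.max 0 (Num.min 1 x).

Lemma clamp01_itv x : clamp01 x \in `[0, 1].
Proof. by rewrite in_itv/= /clamp01 le_max lexx/= ge_max ler01 ge_min lexx. Qed.

Lemma clamp01_id x : x \in `[0, 1] -> clamp01 x = x.
Proof. by rewrite in_itv/= /clamp01 => /andP[x0 x1]; rewrite min_r// max_r. Qed.

Lemma clamp01_dist x y : `|clamp01 x - clamp01 y| <= `|x - y|.
Proof.
rewrite /clamp01 /Num.max /Num.min.
have n1 := ler_norm (x - y); have n2 := ler_norm (y - x); rewrite (distrC y) in n2.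
by repeat case: ifPn; rewrite -?leNgt; move=> *; rewrite ler_norml; apply/andP; split; lra.
Qed.

Lemma clamp01_continuous (a : R -> R) : {within `[0, 1], continuous a} ->
  continuous (a \o clamp01).
Proof.
move=> /subspace_continuousP ca x; apply/cvgrPdist_lt => e e0.
have /cvgrPdist_lt /(_ e e0) := ca _ (clamp01_itv x).
rewrite near_withinE => /nbhs_ballP[d /= d0 Hd].
near=> t; apply: Hd; last exact: clamp01_itv.
rewrite /ball/=; apply: le_lt_trans (clamp01_dist _ _) _.
by near: t; apply: (@cvgr_dist_lt _ _ _ _ _ id x cvg_id).
Unshelve. all: by end_near.
Qed.

Lemma continuous_bounded_clamp (a : R -> R) : {within `[0, 1], continuous a} ->
  exists M : R, forall y, `|(a \o clamp01) y| <= M.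
Proof.
move=> ca.
have cn : {within `[0%R, 1%R], continuous (fun y => `|(a \o clamp01) y|)}.
  apply: continuous_subspaceT => y.
  by apply: (@continuous_comp _ _ _ (a \o clamp01) Num.norm);
    [exact: clamp01_continuous|exact: norm_continuous].
have [c _ Hc] := EVT_max ler01 cn.
exists `|(a \o clamp01) c| => y; have := Hc _ (clamp01_itv y).
by rewrite /= (clamp01_id (clamp01_itv y)).
Qed.

Lemma clamp01_Lfun (a : R -> R) : {within `[0, 1], continuous a} ->
  a \o clamp01 \in Lfun mu 2%:E.
Proof.
move=> ca; have [M HM] := continuous_bounded_clamp ca.
apply: (@bounded_Lfun2 _ _ _ _ _ M); last exact: HM.
by apply: continuous_measurable; exact: clamp01_continuous.
Qed.

(** [weak_deriv_repr] gives the formula up to a constant a.e.; both sides are continuous, so it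
    holds on all of [[0, 1]], and the constant is read off at 0. *)
Lemma du_Bois_Reymond (a : R -> R) b : {within `[0, 1], continuous a} ->
  (forall phi, test_fun phi ->
     \int[mu]_x (a x * derive1 phi x) = - \int[mu]_x (b x * phi x)) ->
  forall x, x \in `[0, 1] -> a x = a 0 + prim b x.
Proof.
move=> ca H; pose A := toL2 (clamp01_Lfun ca).
have Ab : weak_deriv A b.
  move=> phi tphi; rewrite -H// toL2E; apply: eq_Rintegral => x _ /=.
  have [x01|x01] := boolP (x \in `]0, 1[).
    rewrite clamp01_id//; move: x01; rewrite !in_itv/= => /andP[? ?].
    by rewrite !ltW.
  by rewrite (test_fun_out (test_fun_derive1 tphi) x01) !mulr0.
have [c Ac] := weak_deriv_repr Ab.
have cA : continuous (fun x => (a \o clamp01) x - prim b x).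
  move=> x; apply: cvgB; first exact: clamp01_continuous.
  exact: prim_continuous.
have Hc x : x \in `[0, 1] -> a x - prim b x = c.
  move=> x01; rewrite -{1}(clamp01_id x01).
  apply: (ae_continuous_eq cA _ x01); apply: filterS Ac => y /(_ I).
  rewrite toL2E => -> _; apply/eqP; rewrite subr_eq; apply/eqP.
  by transitivity (cstL2 c y + primL2 b y) => //; rewrite cstL2E primL2E.
move=> x x01; apply/eqP; rewrite -subr_eq Hc// -(Hc 0).
  by rewrite prim_le0 ?subr0.
by rewrite in_itv/= lexx ler01.
Qed.

End Fundamental.
Arguments clamp01 {R}.

(** * Density of the test functions in L2(0,1) *)

Section Density.
Import HBSimple HBNNSimple.
Variable R : realType.
Notation mu := (@mu01 R).
Notation mR := (measurableTypeR R).
Implicit Types (f g b : L2 R) (phi psi : R -> R).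

(** The square of [f - f_ n] is dominated by [2 f^2 + 2 b^2]. One good index per [e] is all that a
    closure argument consumes. *)
Lemma L2_dominated (f_ : nat -> L2 R) f b :
  {ae mu, forall x, f_ n x @[n --> \oo] --> f x} ->
  (forall n, {ae mu, forall x, `|f_ n x| <= b x}) ->
  forall e : R, 0 < e -> exists n, L2norm (f - f_ n) < e.
Proof.
move=> fcv fb e e0.
have [|||||_ Hlim] := @Rintegral_dominated _ _ _ mu
    (fun n x => (f - f_ n) x * (f - f_ n) x) (fun=> 0)
    (fun x => 2 * (f x * f x) + 2 * (b x * b x)).
- by move=> n; exact: measurable_funM.
- by [].
- have i1 := integrable_L2M (2 *: f) f; have i2 := integrable_L2M (2 *: b) b.
  have := integrableD measurableT i1 i2; apply: eq_integrable => // x _.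
  by rewrite /= /GRing.scale/= -!EFinD !mulrA.
- apply: filterS fcv => x fx; rewrite -(mulr0 (f x - f x)).
  have d : f x - f_ n x @[n --> \oo] --> f x - f x by apply: cvgB => //; exact: cvg_cst.
  by rewrite -[X in _ * X](subrr (f x)); exact: cvgM.
- move=> n; apply: filterS (fb n) => x bx.
  rewrite ger0_norm -?expr2 ?sqr_ge0//.
  have -> : (f - f_ n) x = f x - f_ n x by [].
  have : (f_ n x) ^+ 2 <= b x ^+ 2.
    by rewrite -[leLHS]ger0_norm ?sqr_ge0// normrX lerXn2r// nnegrE// (le_trans _ bx).
  by have := sqr_ge0 (f x + f_ n x); nra.
rewrite Rintegral_mu01_cst in Hlim.
have e20 : 0 < e ^+ 2 by rewrite exprn_gt0.
have /cvgrPdist_lt /(_ _ e20) [N _ HN] := Hlim.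
exists N; have := HN N (leqnn N); rewrite sub0r normrN -/(inner (f - f_ N) (f - f_ N)).
rewrite -L2norm_sqr ger0_norm ?sqr_ge0//.
by rewrite ltr_pXn2r ?nnegrE ?L2norm_ge0// ltW.
Qed.

Definition test_closure f : Prop := forall e : R, 0 < e ->
  exists phi (t : test_fun phi), L2norm (f - testL2 t) < e.

Lemma test_closure_lim f :
  (forall e : R, 0 < e -> exists2 g, test_closure g & L2norm (f - g) < e) ->
  test_closure f.
Proof.
move=> H e e0; have e20 : 0 < e / 2 by rewrite divr_gt0.
have [g cg fg] := H _ e20; have [phi [t gt]] := cg _ e20; exists phi, t.
rewrite -(subrKA g) (le_lt_trans (L2normD _ _))// (splitr e) ltrD//.
Qed.

Lemma test_closure_ae f g : f = g %[ae mu] -> test_closure f -> test_closure g.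
Proof.
move=> fg H e /H[phi [t ft]]; exists phi, t.
rewrite (@L2norm_ae _ _ (f - testL2 t))//.
by apply: filterS fg => x + _ => /(_ I) fx; rewrite /= /GRing.add/= fx.
Qed.

Lemma test_closure_test phi (t : test_fun phi) : test_closure (testL2 t).
Proof. by move=> e e0; exists phi, t; rewrite subrr L2norm0. Qed.

Lemma test_closureZ (a : R) f : test_closure f -> test_closure (a *: f).
Proof.
move=> cf e e0.
have a0 : 0 < `|a| + 1 by rewrite ltr_wpDl.
have [|phi [t ft]] := cf (e / (`|a| + 1)); first by rewrite divr_gt0.
exists _, (test_funZ a t).
have -> : testL2 (test_funZ a t) = a *: testL2 t.
  by apply/LfuneqP => x; rewrite testL2E; transitivity (a * testL2 t x) => //; rewrite testL2E.
rewrite -scalerBr L2normZ; move: ft; rewrite ltr_pdivlMr// => /(le_lt_trans _); apply.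
by rewrite mulrC ler_wpM2l ?L2norm_ge0// lerDl.
Qed.

Lemma test_closureD f g : test_closure f -> test_closure g -> test_closure (f + g).
Proof.
move=> cf cg e e0; have e20 : 0 < e / 2 by rewrite divr_gt0.
have [phi [t ft]] := cf _ e20; have [psi [s gs]] := cg _ e20.
exists _, (test_funD t s).
have -> : testL2 (test_funD t s) = testL2 t + testL2 s.
  by apply/LfuneqP => x; rewrite testL2E; transitivity (testL2 t x + testL2 s x) => //; rewrite !testL2E.
rewrite opprD addrACA (le_lt_trans (L2normD _ _))// (splitr e) ltrD//.
Qed.

Lemma test_closure0 : test_closure 0.
Proof.
move=> e e0; exists _, (@test_fun_cst0 R).
rewrite (_ : testL2 _ = 0) ?subrr ?L2norm0//.
by apply/LfuneqP => x; rewrite testL2E.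
Qed.

Lemma test_closure_sum I (s : seq I) (F : I -> L2 R) :
  (forall i, test_closure (F i)) -> test_closure (\sum_(i <- s) F i).
Proof.
by move=> cF; apply: big_ind => //; [exact: test_closure0|exact: test_closureD].
Qed.

Lemma L2_sumE I (s : seq I) (F : I -> L2 R) x :
  (\sum_(i <- s) F i : L2 R) x = \sum_(i <- s) F i x.
Proof.
elim: s => [|i s IH]; first by rewrite !big_nil.
by rewrite !big_cons -IH.
Qed.

Lemma indic_Lfun (A : set mR) : measurable A -> (\1_A : mR -> R) \in Lfun mu 2%:E.
Proof.
move=> mA; apply: (@bounded_Lfun2 _ _ _ _ _ 1); first exact: measurable_indic.
by move=> x; rewrite indicE; case: (x \in A); rewrite ?normr1 ?normr0.
Qed.

Definition indL2 (A : set mR) (mA : measurable A) : L2 R := toL2 (indic_Lfun mA).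

Lemma test_closure_ind_itv_in (a b : R) (mA : measurable (`]a, b[%classic : set mR)) :
  0 < a -> b < 1 -> test_closure (indL2 mA).
Proof.
move=> a0 b1; apply: test_closure_lim => e e0.
have [||n Hn] := @L2_dominated (fun n => testL2 (test_fun_bump n a0 b1)) (indL2 mA)
  (cstL2 1) _ _ e e0.
- by apply: aeW => x; under eq_fun do rewrite testL2E; rewrite toL2E; exact: bump_cvg.
- move=> n; apply: aeW => x; rewrite testL2E cstL2E ger0_norm ?bump_ge0 ?bump_le1//.
- by exists (testL2 (test_fun_bump n a0 b1)) => //; exact: test_closure_test.
Qed.

(** An interval that touches 0 or 1 carries no bump that is a test function; it is exhausted from
    inside by intervals that do. *)
Lemma test_closure_ind_itv (a b : R) (mA : measurable (`]a, b[%classic : set mR)) :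
  0 <= a -> b <= 1 -> test_closure (indL2 mA).
Proof.
move=> a0 b1; apply: test_closure_lim => e e0.
pose d n : R := n.+1%:R^-1.
have d0 n : 0 < d n by rewrite invr_gt0.
have mI n : measurable (`]a + d n, b - d n[%classic : set mR) by exact: measurable_itv.
have [||n Hn] := @L2_dominated (fun n => indL2 (mI n)) (indL2 mA) (cstL2 1) _ _ e e0.
- apply: aeW => x; under eq_fun do rewrite toL2E; rewrite toL2E.
  have [|xab] := boolP (x \in `]a, b[).
    rewrite in_itv/= => /andP[ax xb]; apply: cvg_near_cst.
    have m0 : 0 < Num.min (x - a) (b - x) by rewrite lt_min !subr_gt0 ax.
    near=> n; have : d n < Num.min (x - a) (b - x).
      near: n; apply: (cvgr_lt (0 : R)) => //; exact: cvg_harmonic.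
    rewrite lt_min => /andP[dx xd]; rewrite !indicE !mem_setE !in_itv/= ax xb.
    by rewrite -ltrBrDl dx ltrBrDl addrC -ltrBrDl xd.
  apply: cvg_near_cst; apply: nearW => n; rewrite !indicE !mem_setE (negbTE xab).
  rewrite (_ : x \in _ = false)//; apply: contraNF xab; rewrite !in_itv/= => /andP[h1 h2].
  by have := d0 n; lra.
- by move=> n; apply: aeW => x; rewrite toL2E cstL2E indicE; case: (_ \in _); rewrite ?normr1 ?normr0.
- exists (indL2 (mI n)) => //; apply: test_closure_ind_itv_in.
    by rewrite ltr_wpDl.
  by rewrite ltrBlDr ltr_pwDr.
Unshelve. all: by end_near.
Qed.

(** Dynkin's theorem on the half-open intervals: complements are handled by linearity, disjoint
    unions by dominated convergence of the partial sums. *)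
Lemma test_closure_ind (A : set mR) (mA : measurable A) : test_closure (indL2 mA).
Proof.
have aeU (A' B : set mR) (mA' : measurable A') (mB : measurable B) :
    A' `&` `]0, 1[ = B `&` `]0, 1[ -> test_closure (indL2 mA') -> test_closure (indL2 mB).
  move=> AB; apply: test_closure_ae; apply: filterS (ae_mu01_itv R) => x x01 _.
  rewrite !toL2E !indicE; congr (_%:R); congr nat_of_bool.
  have /seteqP[AB1 AB2] := AB.
  by apply/idP/idP; rewrite !inE => xA; [have [] := AB1 x (conj xA x01)|have [] := AB2 x (conj xA x01)].
have mI : measurable (`]0%R, 1%R[%classic : set mR) by exact: measurable_itv.
have cI : test_closure (indL2 mI) by exact: test_closure_ind_itv.
have cT (mT : measurable (setT : set mR)) : test_closure (indL2 mT).
  by apply: aeU cI; rewrite setIid setTI.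
pose P := [set A : set mR | forall mA : measurable A, test_closure (indL2 mA)].
suff : P A by exact.
apply: (@dynkin_induction _ _ (@ocitv R) P) => //.
- exact: ocitvI.
- move=> _ [[a b] _ <-] mB /=.
  (* On (0,1) the interval []a, b]] is []max 0 a, min 1 b[] up to the point [b]. *)
  have mJ : measurable (`](Num.max 0 a), (Num.min 1 b)[%classic : set mR) by exact: measurable_itv.
  have : test_closure (indL2 mJ).
    by apply: test_closure_ind_itv; [rewrite le_max lexx|rewrite ge_min lexx].
  apply: test_closure_ae.
  have : {ae mu, forall x, x != b}.
    apply/ae_mu01P; exists [set b]; split => //; first exact: lebesgue_measure_set1.
    by move=> x /=; apply: contra_notP => /eqP xs _.
  apply: filterS2 (ae_mu01_itv R) => x; rewrite in_itv/= => /andP[x0 x1] xb _.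
  rewrite !indicE !mem_setE !in_itv/= gt_max lt_min x0 x1/=.
  have [xb'|xb'|xb'] := ltgtP x b; rewrite ?andbF//.
  by rewrite xb' eqxx in xb.
- move=> S mS PS mC.
  have -> : indL2 mC = indL2 measurableT + (-1) *: indL2 mS.
    apply/LfuneqP => x; rewrite toL2E.
    transitivity (indL2 measurableT x + (-1) * indL2 mS x) => //.
    rewrite !toL2E !indicE in_setT in_setC.
    by case: (x \in S); rewrite ?mulr1 ?mulr0 ?subrr ?addr0.
  by apply: test_closureD; [exact: cT|apply: test_closureZ; exact: PS].
- move=> F mF tF PF mU; apply: test_closure_lim => e e0.
  pose S n : L2 R := \sum_(i < n) indL2 (mF i).
  (* Disjointness makes the partial sum an indicator, hence bounded by 1 uniformly in [n]. *)
  have SE n x : S n x = `[< exists2 i, (i < n)%N & F i x >]%:R.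
    rewrite L2_sumE; elim: n => [|n IH].
      by rewrite big_ord0; case: asboolP => // -[].
    rewrite big_ord_recr/= {}IH ?toL2E indicE.
    have [Fn|Fn] := boolP (x \in F n); rewrite ?inE in Fn.
      have -> : `[< exists2 i, (i < n)%N & F i x >] = false.
        apply/asboolP => -[i ni Fi].
        have ein : i = n by apply: (tF i n I I); exists x.
        by rewrite ein ltnn in ni.
      by rewrite add0r; case: asboolP => // -[]; exists n.
    rewrite addr0; congr (_%:R); congr nat_of_bool; apply/asboolP/asboolP.
      by move=> [i ni Fi]; exists i => //; exact: ltnW.
    move=> [i]; rewrite ltnS leq_eqVlt => /orP[/eqP -> Fi|ni Fi]; last by exists i.
    by move/negP: Fn; rewrite inE.
  have [||n Hn] := @L2_dominated S (indL2 mU) (cstL2 1) _ _ e e0.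
  + apply: aeW => x; rewrite toL2E indicE.
    have [xU|xU] := boolP (x \in \bigcup_n F n); rewrite ?inE in xU.
      have [k _ Fk] := xU; apply: cvg_near_cst; exists k.+1 => // n /= kn.
      by rewrite SE; case: asboolP => // -[]; exists k.
    apply: cvg_near_cst; apply: nearW => n; rewrite SE; case: asboolP => // -[i _ Fi].
    by move/negP: xU; rewrite inE => -[]; exists i.
  + by move=> n; apply: aeW => x; rewrite SE cstL2E; case: asboolP; rewrite ?normr1 ?normr0.
  + by exists (S n) => //; apply: test_closure_sum => i; exact: PF.
Qed.

Lemma test_closure_ge0 f : (forall x, 0 <= f x) -> test_closure f.
Proof.
move=> f0; apply: test_closure_lim => e e0.
have mf : measurable_fun setT (EFin \o f) by apply/measurable_EFinP; exact: L2_measurable.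
pose s n := nnsfun_approx measurableT mf n.
have s_le n x : s n x <= f x.
  have f0' y : setT y -> (0 <= (EFin \o f) y)%E by rewrite lee_fin.
  by have := le_approx n f0' (I : setT x); rewrite nnsfun_approxE lee_fin.
have mp n (y : R) : measurable (s n @^-1` [set y]) by exact: measurable_sfunP.
pose S n : L2 R := \sum_(y <- finmap.enum_fset (fset_set (range (s n)))) y *: indL2 (mp n y).
have SE n x : S n x = s n x.
  rewrite L2_sumE fimfunE fsbig_finite//=; apply: eq_bigr => y _.
have [||n Hn] := @L2_dominated S f f _ _ e e0.
- apply: aeW => x; under eq_fun do rewrite SE.
  have f0' y : setT y -> (0 <= (EFin \o f) y)%E by rewrite lee_fin.
  exact: fine_cvg (cvg_nnsfun_approx measurableT mf f0' (I : setT x)).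
- by move=> n; apply: aeW => x; rewrite SE ger0_norm.
- by exists (S n) => //; apply: test_closure_sum => y; apply/test_closureZ/test_closure_ind.
Qed.

Lemma test_fun_dense f : test_closure f.
Proof.
have mp : (fun x => Num.max (f x) 0) \in Lfun mu 2%:E.
  apply: Lfun2P; first exact: measurable_maxr.
  apply: le_integrable (integrable_L2M f f) => //.
    apply/measurable_EFinP; apply: measurable_funX; exact: measurable_maxr.
  move=> x _ /=; rewrite lee_fin -expr2 !ger0_norm ?sqr_ge0//.
  by have [_|_] := leP (f x) 0; rewrite ?expr0n/= ?sqr_ge0.
have -> : f = toL2 mp + (-1) *: (toL2 mp - f).
  by rewrite scaleN1r opprB addrC subrK.
apply: test_closureD; [|apply: test_closureZ]; apply: test_closure_ge0 => x.
  by rewrite toL2E le_max lexx orbT.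
have -> : (toL2 mp - f) x = toL2 mp x - f x by [].
by rewrite toL2E subr_ge0 le_max lexx.
Qed.

End Density.

(** * The spaces H1 and H01 *)

Section H1.
Variable R : realType.
Notation mu := (@mu01 R).
Implicit Types (f g b psi : L2 R) (phi : R -> R).

Lemma ae_refl f : f = f %[ae mu].
Proof. exact: aeW. Qed.

Lemma ae_sym f g : f = g %[ae mu] -> g = f %[ae mu].
Proof. by apply: filterS => x h /h. Qed.

Lemma ae_trans f g b : f = g %[ae mu] -> g = b %[ae mu] -> f = b %[ae mu].
Proof. by apply: filterS2 => x h1 h2 _; rewrite h1// h2. Qed.

Lemma ae_lin (a : R) f g f' g' : f = f' %[ae mu] -> g = g' %[ae mu] ->
  a *: f + g = a *: f' + g' %[ae mu].
Proof.
apply: filterS2 => x h1 h2 _.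
by transitivity (a * f x + g x) => //; rewrite h1// h2.
Qed.

Lemma ae_sub f g f' g' : f = f' %[ae mu] -> g = g' %[ae mu] ->
  f - g = f' - g' %[ae mu].
Proof.
apply: filterS2 => x h1 h2 _.
by transitivity (f x - g x) => //; rewrite h1// h2.
Qed.

Lemma wdP f : H1 f -> weak_deriv f (wd f).
Proof. by move=> [g fg]; exact: (xgetPex 0 (ex_intro _ g fg)). Qed.

Lemma weak_deriv_H1 f g : weak_deriv f g -> H1 f.
Proof. by exists g. Qed.

Lemma wd_ae f g : weak_deriv f g -> wd f = g %[ae mu].
Proof. by move=> fg; apply: weak_deriv_uniq (wdP (weak_deriv_H1 fg)) fg. Qed.

Lemma H1_lin (a : R) f g : H1 f -> H1 g -> H1 (a *: f + g).
Proof. by move=> [f' ff] [g' gg]; exists (a *: f' + g'); exact: weak_deriv_lin. Qed.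

Lemma H1B f g : H1 f -> H1 g -> H1 (f - g).
Proof. by move=> [f' ff] [g' gg]; exists (f' - g'); exact: weak_derivB. Qed.

Lemma H1_ae f g : f = g %[ae mu] -> H1 f -> H1 g.
Proof. by move=> fg [f' ff]; exists f'; apply: weak_deriv_ae fg (ae_refl _) ff. Qed.

Lemma H1_0 : H1 (0 : L2 R).
Proof. by exists 0; apply/weak_derivP => phi t; rewrite !inner0l oppr0. Qed.

Lemma wd0 : wd (0 : L2 R) = (0 : L2 R) %[ae mu].
Proof. by apply: wd_ae; apply/weak_derivP => phi t; rewrite !inner0l oppr0. Qed.

Lemma wd_lin (a : R) f g : H1 f -> H1 g ->
  wd (a *: f + g) = a *: wd f + wd g %[ae mu].
Proof. by move=> /wdP ff /wdP gg; apply: wd_ae; exact: weak_deriv_lin. Qed.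

Lemma wdB f g : H1 f -> H1 g -> wd (f - g) = wd f - wd g %[ae mu].
Proof. by move=> /wdP ff /wdP gg; apply: wd_ae; exact: weak_derivB. Qed.

Lemma wd_ae_eq f g : f = g %[ae mu] -> H1 f -> wd f = wd g %[ae mu].
Proof.
move=> fg /wdP ff; apply/ae_sym/wd_ae.
exact: weak_deriv_ae fg (ae_refl _) ff.
Qed.

Lemma H1norm_ge0 f : 0 <= H1norm f.
Proof. exact: sqrtr_ge0. Qed.

Lemma H1norm_sqr f : H1norm f ^+ 2 = L2norm f ^+ 2 + L2norm (wd f) ^+ 2.
Proof. by rewrite sqr_sqrtr// addr_ge0// sqr_ge0. Qed.

Lemma H1norm_ae f g : f = g %[ae mu] -> H1 f -> H1norm f = H1norm g.
Proof.
by move=> fg Hf; rewrite /H1norm (L2norm_ae fg) (L2norm_ae (wd_ae_eq fg Hf)).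
Qed.

Lemma L2norm_le_H1norm f : L2norm f <= H1norm f.
Proof.
rewrite -(@ler_pXn2r _ 2) ?nnegrE ?L2norm_ge0 ?H1norm_ge0// H1norm_sqr lerDl.
exact: sqr_ge0.
Qed.

Lemma L2norm_wd_le_H1norm f : L2norm (wd f) <= H1norm f.
Proof.
rewrite -(@ler_pXn2r _ 2) ?nnegrE ?L2norm_ge0 ?H1norm_ge0// H1norm_sqr lerDr.
exact: sqr_ge0.
Qed.

Lemma H1norm_le f : H1norm f <= L2norm f + L2norm (wd f).
Proof.
rewrite -(@ler_pXn2r _ 2) ?nnegrE ?addr_ge0 ?L2norm_ge0 ?H1norm_ge0// H1norm_sqr.
by rewrite sqrrD lerD2r lerDl mulrn_wge0// mulr_ge0 ?L2norm_ge0.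
Qed.

(** Minkowski's inequality in the plane, which makes [H1norm] subadditive. The Cauchy-Schwarz step
    rests on the square of [a * d - b * c]. *)
Lemma sqrt_sumsq_triangle (a b c d : R) : 0 <= a -> 0 <= b -> 0 <= c -> 0 <= d ->
  Num.sqrt ((a + b) ^+ 2 + (c + d) ^+ 2) <=
  Num.sqrt (a ^+ 2 + c ^+ 2) + Num.sqrt (b ^+ 2 + d ^+ 2).
Proof.
move=> a0 b0 c0 d0.
set s := Num.sqrt (a ^+ 2 + c ^+ 2); set t := Num.sqrt (b ^+ 2 + d ^+ 2).
have s0 : 0 <= s by exact: sqrtr_ge0.
have t0 : 0 <= t by exact: sqrtr_ge0.
have ss : s ^+ 2 = a ^+ 2 + c ^+ 2 by rewrite sqr_sqrtr// addr_ge0// sqr_ge0.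
have tt : t ^+ 2 = b ^+ 2 + d ^+ 2 by rewrite sqr_sqrtr// addr_ge0// sqr_ge0.
rewrite -[leRHS](ger0_norm (addr_ge0 s0 t0)) -sqrtr_sqr ler_sqrt ?sqr_ge0//.
have st : a * b + c * d <= s * t.
  rewrite -(@ler_pXn2r _ 2) ?nnegrE ?addr_ge0 ?mulr_ge0// exprMn ss tt.
  by have := sqr_ge0 (a * d - b * c); nra.
by rewrite [leRHS]sqrrD ss tt; nra.
Qed.

Lemma H1normD f g : H1 f -> H1 g -> H1norm (f + g) <= H1norm f + H1norm g.
Proof.
move=> Hf Hg; have := wd_lin 1 Hf Hg; rewrite !scale1r => wfg.
apply: le_trans (sqrt_sumsq_triangle _ _ _ _); try exact: L2norm_ge0.
rewrite /H1norm ler_sqrt ?addr_ge0 ?sqr_ge0// (L2norm_ae wfg) lerD//;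
  by rewrite lerXn2r ?nnegrE ?addr_ge0 ?L2norm_ge0 ?L2normD.
Qed.

Lemma H1normZ (a : R) f : H1 f -> H1norm (a *: f) = `|a| * H1norm f.
Proof.
move=> Hf; have := wd_lin a Hf H1_0; rewrite addr0 => wf.
rewrite /H1norm (L2norm_ae (f := wd (a *: f)) (g := a *: wd f)); last first.
  by apply: ae_trans wf _; have := ae_lin a (ae_refl (wd f)) wd0; rewrite addr0.
rewrite !L2normZ !exprMn -mulrDr sqrtrM ?sqr_ge0// sqrtr_sqr ger0_norm//.
Qed.

Lemma H1normB f g : H1 f -> H1 g -> H1norm (f - g) = H1norm (g - f).
Proof.
by move=> Hf Hg; rewrite -[in LHS]opprB -scaleN1r H1normZ ?normrN1 ?mul1r//; exact: H1B.
Qed.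

Lemma weak_deriv_test phi (t : test_fun phi) :
  weak_deriv (testL2 t) (testL2 (test_fun_derive1 t)).
Proof.
move=> psi tpsi; rewrite !testL2E.
have := prim_weak_deriv (testL2 (test_fun_derive1 t)) tpsi.
by rewrite testL2E prim_derive1.
Qed.

Lemma H1_test phi (t : test_fun phi) : H1 (testL2 t).
Proof. exact: weak_deriv_H1 (weak_deriv_test t). Qed.

Lemma H01P f : H01 f <-> H1 f /\ forall e : R, 0 < e ->
  exists phi (t : test_fun phi), H1norm (f - testL2 t) < e.
Proof.
split=> -[Hf H]; split => // e e0; have := H e e0.
  move=> [phi [g [t gphi fg]]]; exists phi, t.
  have gt : g = testL2 t %[ae mu] by rewrite testL2E.
  rewrite -(@H1norm_ae (f - g))//; first exact: ae_sub (ae_refl _) gt.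
  apply: H1B => //; exact: H1_ae (ae_sym gt) (H1_test t).
move=> [phi [t ft]]; exists phi, (testL2 t); split => //.
by rewrite testL2E; exact: aeW.
Qed.

Lemma H01_H1 f : H01 f -> H1 f.
Proof. by case. Qed.

Lemma H01_lin (a : R) f g : H01 f -> H01 g -> H01 (a *: f + g).
Proof.
move=> /H01P[Hf cf] /H01P[Hg cg]; apply/H01P; split; first exact: H1_lin.
move=> e e0; have e20 : 0 < e / 2 by rewrite divr_gt0.
have a0 : 0 < `|a| + 1 by rewrite ltr_wpDl.
have [|phi [t ft]] := cf (e / 2 / (`|a| + 1)); first by rewrite divr_gt0.
have [psi [s gs]] := cg _ e20.
exists _, (test_funD (test_funZ a t) s).
have -> : testL2 (test_funD (test_funZ a t) s) = a *: testL2 t + testL2 s.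
  apply/LfuneqP => x; rewrite testL2E.
  by transitivity (a * testL2 t x + testL2 s x) => //; rewrite !testL2E.
rewrite opprD addrACA -scalerBr.
have H1ft : H1 (f - testL2 t) by apply: H1B => //; exact: H1_test.
have H1gs : H1 (g - testL2 s) by apply: H1B => //; exact: H1_test.
have H1aft : H1 (a *: (f - testL2 t)).
  by have := H1_lin a H1ft H1_0; rewrite addr0.
apply: le_lt_trans (H1normD H1aft H1gs) _; rewrite (splitr e); apply: ltrD; last exact: gs.
rewrite H1normZ//; move: ft; rewrite ltr_pdivlMr// => /(le_lt_trans _); apply.
by rewrite mulrC ler_wpM2l ?H1norm_ge0// lerDl.
Qed.

Lemma H01B f g : H01 f -> H01 g -> H01 (f - g).
Proof. by move=> Hf Hg; have := H01_lin (-1) Hg Hf; rewrite scaleN1r addrC. Qed.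

(** The defect of the identity is continuous in [psi] for the H1 norm and vanishes on test
    functions, hence on their closure. *)
Lemma inner_wd_H01 f g psi : weak_deriv f g -> H01 psi ->
  inner f (wd psi) = - inner g psi.
Proof.
move=> /weak_derivP fg /H01P[Hpsi cpsi]; apply/eqP; rewrite -subr_eq0 opprK.
apply: contraT => n0; set c := inner f _ + _ in n0.
have c0 : 0 < `|c| by rewrite normr_gt0.
have N0 : 0 < L2norm f + L2norm g + 1 by rewrite ltr_wpDl// addr_ge0// L2norm_ge0.
have [|phi [t pt]] := cpsi (`|c| / (L2norm f + L2norm g + 1)); first by rewrite divr_gt0.
have ce : c = inner f (wd psi - testL2 (test_fun_derive1 t)) + inner g (psi - testL2 t).
  by rewrite /c !innerBr fg; ring.
have wpt : wd (psi - testL2 t) = wd psi - testL2 (test_fun_derive1 t) %[ae mu].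
  by apply: wd_ae; apply: weak_derivB (wdP Hpsi) (weak_deriv_test t).
have : `|c| <= (L2norm f + L2norm g) * H1norm (psi - testL2 t).
  rewrite {1}ce -(inner_aer _ wpt) (le_trans (ler_normD _ _))// mulrDl lerD//.
    rewrite (le_trans (CauchySchwarz _ _))// ler_wpM2l ?L2norm_ge0//.
    exact: L2norm_wd_le_H1norm.
  by rewrite (le_trans (CauchySchwarz _ _))// ler_wpM2l ?L2norm_ge0 ?L2norm_le_H1norm.
move: pt; rewrite ltr_pdivlMr// => pt cl.
have := le_lt_trans cl (le_lt_trans _ pt); rewrite ltxx; apply.
by rewrite mulrC ler_wpM2l ?H1norm_ge0// lerDl.
Qed.

(** The derivative is approximated rather than the function: it has mean 0 because [f] takes equal
    values at the ends, so it is an L2 limit of mean-free test functions. Their primitives are test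
    functions that converge to [f] in H1. *)
Lemma vanishes_at_ends_H01 f : H1 f -> vanishes_at_ends f -> H01 f.
Proof.
move=> Hf [h [ch fh h0 h1]].
have [c fc] := weak_deriv_repr (wdP Hf); set g := wd f in fc *.
have hg x : x \in `[0, 1] -> h x = c + prim g x.
  move=> x01; have cd : continuous (fun x => (h \o clamp01) x - prim g x).
    move=> y; apply: cvgB; first exact: clamp01_continuous.
    exact: prim_continuous.
  have := ae_continuous_eq (c := c) cd _ x01.
  rewrite /= clamp01_id// => H; apply/eqP; rewrite -subr_eq; apply/eqP; apply: H.
  have : {ae mu, forall x : R, (x \in `]0, 1[) /\ (h x = (cstL2 c + primL2 g : L2 R) x)}.
    apply: filterS3 (ae_mu01_itv R) fh fc => y y01 fy fcy; split => //.
    by rewrite -fy// fcy.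
  apply: filterS => y [y01 hy] _; rewrite /= clamp01_id; last first.
    by move: y01; rewrite !in_itv/= => /andP[? ?]; rewrite !ltW.
  rewrite hy; have -> : (cstL2 c + primL2 g) y = cstL2 c y + primL2 g y by [].
  by rewrite cstL2E primL2E addrK.
have c0 : c = 0.
  by have := hg 0; rewrite in_itv/= lexx ler01 prim_le0// h0 addr0 => /(_ isT).
have m0 : \int[mu]_y g y = 0.
  have := hg 1; rewrite in_itv/= lexx ler01 prim_ge1// h1 c0 add0r.
  by move=> /(_ isT).
apply/H01P; split => // e e0.
have [phi0 t0 int0] := exists_unit_test R.
(* Making the approximation mean-free costs a factor [1 + L2norm (testL2 t0)]; the factor 2 covers
   the function and its derivative. *)
have N0 : 0 < 2 * (1 + L2norm (testL2 t0)).
  by rewrite mulr_gt0// ltr_wpDr ?L2norm_ge0.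
have [|phi [t gt]] := @test_fun_dense _ g (e / (2 * (1 + L2norm (testL2 t0)))).
  by rewrite divr_gt0.
have tm := test_fun_meanfree t0 t.
have tp := test_fun_prim tm (Rintegral_meanfree t0 t int0).
have td : testL2 (test_fun_derive1 tp) = testL2 tm.
  by apply/LfuneqP => x; rewrite !testL2E (is_derive_derive1 (is_derive_prim_test tm)).
have tpE : testL2 tp = primL2 (testL2 tm).
  by apply/LfuneqP => x; rewrite primL2E !testL2E.
exists _, tp.
have wft : wd (f - testL2 tp) = g - testL2 tm %[ae mu].
  by apply: wd_ae; rewrite -td; apply: weak_derivB (wdP Hf) (weak_deriv_test tp).
have ft : f - testL2 tp = primL2 (g - testL2 tm) %[ae mu].
  apply: filterS fc => x /(_ I) fx _.
  have -> : (f - testL2 tp) x = f x - testL2 tp x by [].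
  rewrite fx c0 tpE; have -> : (cstL2 0 + primL2 g) x = cstL2 0 x + primL2 g x by [].
  by rewrite cstL2E !primL2E add0r !primE innerBl.
have tmE : testL2 tm = testL2 t - (\int[mu]_y phi y) *: testL2 t0.
  apply/LfuneqP => x; rewrite testL2E.
  by transitivity (testL2 t x - (\int[mu]_y phi y) * testL2 t0 x) => //; rewrite !testL2E.
(* As [g] has integral 0, the integral of [phi] is minus that of [g - phi]. *)
have phi_le : `|\int[mu]_y phi y| <= L2norm (g - testL2 t).
  have := prim_ge1 (g - testL2 t) (lexx 1) => p1.
  have := prim_bound (g - testL2 t) 1; apply: le_trans.
  rewrite primE innerBl -!primE !prim_ge1// m0 sub0r normrN testL2E//.
have gm : L2norm (g - testL2 tm) <= L2norm (g - testL2 t) * (1 + L2norm (testL2 t0)).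
  rewrite tmE opprB addrCA addrC (le_trans (L2normD _ _))// mulrDr mulr1 lerD2l.
  by rewrite L2normZ ler_wpM2r ?L2norm_ge0.
rewrite (le_lt_trans (H1norm_le _))// (L2norm_ae wft) (L2norm_ae ft).
apply: (@le_lt_trans _ _ (2 * L2norm (g - testL2 tm))).
  have := L2norm_prim (g - testL2 tm).
  by move: (L2norm (g - testL2 tm)) (L2norm (primL2 _)) => x y; lra.
move: gt; rewrite ltr_pdivlMr// mulrCA; apply: le_lt_trans.
by rewrite ler_wpM2l.
Qed.

End H1.

(** * The energy identity and Gronwall's inequality *)

Section Calculus.
Variable R : realType.
Implicit Types (f df : R -> R) (x y l : R).

Lemma is_derive_cont f x l : is_derive x 1 f l -> {for x, continuous f}.
Proof. by move=> [D _]; apply/differentiable_continuous/derivable1_diffP. Qed.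

Lemma is_derive_approx f x l :
  (forall e : R, 0 < e -> exists2 d : R, 0 < d & forall y, `|y - x| < d ->
     `|f y - f x - l * (y - x)| <= e * `|y - x|) ->
  is_derive x 1 f l.
Proof.
move=> H.
have D : h^-1 *: (f (h *: 1 + x) - f x) @[h --> 0^'] --> l.
  apply/cvgrPdist_le => e e0; have [d d0 Hd] := H e e0.
  near=> h; have h0 : h != 0 by near: h; exact: nbhs_dnbhs_neq.
  have hd : `|h| < d by near: h; exact: dnbhs0_lt.
  have := Hd (h + x); rewrite addrK => /(_ hd).
  rewrite /GRing.scale/= mulr1 distrC => Hh.
  have -> : l - h^-1 * (f (h + x) - f x) = h^-1 * (l * h - (f (h + x) - f x)).
    by field.
  by rewrite normrM normfV mulrC ler_pdivrMr ?normr_gt0.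
have dv : derivable f x 1 by apply/cvg_ex; exists l.
by apply: (DeriveDef dv); apply/cvg_lim.
Unshelve. all: by end_near.
Qed.

Lemma is_derive_approxP f x l : is_derive x 1 f l ->
  forall e : R, 0 < e -> exists2 d : R, 0 < d & forall y, `|y - x| < d ->
     `|f y - f x - l * (y - x)| <= e * `|y - x|.
Proof.
move=> [dv dl] e e0; have : h^-1 *: (f (h *: 1 + x) - f x) @[h --> 0^'] --> l.
  by rewrite -dl; exact: dv.
move=> /cvgrPdist_le /(_ e e0) /nbhs_ballP[d /= d0 Hd].
exists d => // y yd; have [->|yx] := eqVneq y x.
  by rewrite !subrr mulr0 subrr normr0 mulr0.
have yx0 : y - x != 0 by rewrite subr_eq0.
have := Hd (y - x); rewrite /ball/= sub0r normrN => /(_ yd yx0).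
rewrite /GRing.scale/= mulr1 subrK distrC => H.
have -> : f y - f x - l * (y - x) = ((y - x)^-1 * (f y - f x) - l) * (y - x).
  by field.
by rewrite normrM ler_wpM2r.
Qed.

(** The mean value theorem without an order between [x] and [y]. The point [c] is located by its
    distance to [x], the form in which moduli of continuity use it. *)
Lemma MVToo f df (u w : R) :
  (forall x, u < x < w -> is_derive x 1 f (df x)) ->
  forall x y, u < x < w -> u < y < w ->
  exists c, [/\ u < c < w, `|c - x| <= `|y - x| &
     f y - f x = df c * (y - x)].
Proof.
move=> H.
have main x y : x < y -> u < x < w -> u < y < w ->
   exists c, [/\ x < c, c < y & f y - f x = df c * (y - x)].
  move=> xy xI yI.
  have D z : z \in `]x, y[ -> is_derive z 1 f (df z).
    by rewrite in_itv/= => /andP[xz zy]; apply: H; lra.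
  have C : {within `[x, y], continuous f}.
    apply: continuous_in_subspaceT => z; rewrite inE/= in_itv/= => /andP[xz zy].
    by apply: (@is_derive_cont _ _ (df z)); apply: H; lra.
  have [c] := MVT xy D C.
  by rewrite in_itv/= => /andP[xc cy] E; exists c.
move=> x y xI yI; have [xy|yx|<-] := ltgtP x y.
- have [c [xc cy E]] := main _ _ xy xI yI; exists c; split => //; first by lra.
  by rewrite !gtr0_norm ?subr_gt0//; lra.
- have [c [xc cy E]] := main _ _ yx yI xI; exists c; split => //; first by lra.
    by rewrite !ltr0_norm ?subr_lt0//; lra.
  by apply: oppr_inj; rewrite opprB E; ring.
- by exists x; rewrite !subrr normr0 mulr0.
Qed.

Lemma MVT01 f df : (forall x, x \in `]0, 1[ -> is_derive x 1 f (df x)) ->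
  forall x y, x \in `]0, 1[ -> y \in `]0, 1[ ->
  exists c, [/\ c \in `]0, 1[, `|c - x| <= `|y - x| &
     f y - f x = df c * (y - x)].
Proof.
move=> H x y; rewrite !in_itv/= => x01 y01.
have D (z : R) : 0 < z < 1 -> is_derive z 1 f (df z).
  by move=> z01; apply: H; rewrite in_itv.
have [c [c01 cx E]] := MVToo D x01 y01.
by exists c; rewrite in_itv.
Qed.

Definition jcont (F : R -> R -> R) x y : Prop := forall e : R, 0 < e ->
  exists2 d : R, 0 < d & forall x' y', `|x' - x| < d -> `|y' - y| < d ->
    `|F x' y' - F x y| < e.

Lemma jcont_diag F (h x : R) : jcont F x (x + h) ->
  {for x, continuous (fun s => F s (s + h))}.
Proof.
move=> H; apply/cvgrPdist_lt => e e0; have [d d0 Hd] := H e e0.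
near=> t; rewrite distrC; have tx : `|t - x| < d.
  by rewrite distrC; near: t; apply: (@cvgr_dist_lt _ _ _ _ _ id x cvg_id).
apply: Hd => //.
by rewrite (_ : t + h - (x + h) = t - x)//; ring.
Unshelve. all: by end_near.
Qed.

(** Joint continuity of one partial derivative is enough: the increment in the first variable is
    treated by the mean value theorem, the one in the second by differentiability at the point. *)
Lemma is_derive_diag (A A1 A2 : R -> R -> R) (h x : R) :
  (forall x y, x \in `]0, 1[ -> y \in `]0, 1[ -> is_derive x 1 (A ^~ y) (A1 x y)) ->
  (forall x y, x \in `]0, 1[ -> y \in `]0, 1[ -> is_derive y 1 (A x) (A2 x y)) ->
  (forall x y, x \in `]0, 1[ -> y \in `]0, 1[ -> jcont A1 x y) ->
  x \in `]0, 1[ -> x + h \in `]0, 1[ ->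
  is_derive x 1 (fun s => A s (s + h)) (A1 x (x + h) + A2 x (x + h)).
Proof.
move=> D1 D2 J1 x01 h01; apply: is_derive_approx => e e0.
have e20 : 0 < e / 2 by rewrite divr_gt0.
have [d d0 Hd] := J1 _ _ x01 h01 _ e20.
have [d' d'0 Hd'] := is_derive_approxP (D2 _ _ x01 h01) e20.
pose m := Num.min (Num.min x (1 - x)) (Num.min (x + h) (1 - (x + h))).
have m0 : 0 < m by move: x01 h01; rewrite /m !in_itv/= !lt_min; lra.
exists (Num.min m (Num.min d d')); first by rewrite lt_min m0 lt_min d0.
move=> y; rewrite !lt_min => /andP[/andP[/andP[m1 m2] /andP[m3 m4]] /andP[yd yd']].
have y01 : y \in `]0, 1[.
  rewrite in_itv/=; have := ler_norm (y - x); have := ler_norm (x - y).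
  by rewrite (distrC x); lra.
have yh01 : y + h \in `]0, 1[.
  rewrite in_itv/=; have := ler_norm (y - x); have := ler_norm (x - y).
  by rewrite (distrC x); lra.
have yhE : y + h - (x + h) = y - x by ring.
have [c [c01 cx E]] := MVT01 (fun x x01 => D1 x _ x01 yh01) x01 y01.
have := Hd' (y + h); rewrite yhE => /(_ yd') H2.
have H1 : `|A1 c (y + h) - A1 x (x + h)| < e / 2.
  by apply: Hd; [exact: le_lt_trans yd|rewrite yhE].
have -> : A y (y + h) - A x (x + h) - (A1 x (x + h) + A2 x (x + h)) * (y - x) =
    (A1 c (y + h) - A1 x (x + h)) * (y - x) +
    (A x (y + h) - A x (x + h) - A2 x (x + h) * (y - x)).
  by rewrite -[A y (y + h)](subrK (A x (y + h))) E; ring.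
rewrite (le_trans (ler_normD _ _))// (splitr e) [leRHS]mulrDl lerD//.
by rewrite normrM ler_wpM2r// ltW.
Qed.

Lemma primitive_itv (k : R -> R) (u w : R) : u < w ->
  (forall s, u <= s <= w -> {for s, continuous k}) ->
  exists K : R -> R, forall s, u < s < w -> is_derive s 1 K (k s).
Proof.
move=> uw ck; exists (fun x => \int[lebesgue_measure]_(t in `[u, x]) k t).
have ki : lebesgue_measure.-integrable `[u, w] (EFin \o k).
  apply: continuous_compact_integrable; first exact: segment_compact.
  apply: continuous_in_subspaceT => s; rewrite inE/= in_itv/=; exact: ck.
move=> s /andP[us sw].
have [|D1 D2] := continuous_FTC1_closed sw ki us.
  by apply: ck; rewrite !ltW.
by apply: (DeriveDef D1); rewrite -derive1E; exact: D2.
Qed.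

(* [A x t], [a x t], [b x t], [c x t] and [dc x t] stand for the pairings
   <w'(x), w(t)>, <w'(x), w'(t)>, <w_y(x), w_y(t)>, <g(x), w(t)> and
   <g(x), w'(t)> of a solution of w'' = w_yy + g, for which w'' need not pair
   with w'.  The difference quotient of [Phi_h] below only involves [c]. *)
Lemma energy_identity (A a b c dc : R -> R -> R) :
  (forall x y, x \in `]0, 1[ -> y \in `]0, 1[ -> is_derive y 1 (A x) (a x y)) ->
  (forall x y, x \in `]0, 1[ -> y \in `]0, 1[ ->
     is_derive x 1 (A ^~ y) (c x y - b x y)) ->
  (forall x y, x \in `]0, 1[ -> y \in `]0, 1[ -> is_derive y 1 (c x) (dc x y)) ->
  (forall x y, a x y = a y x) -> (forall x y, b x y = b y x) ->
  (forall x y, x \in `]0, 1[ -> y \in `]0, 1[ ->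
     [/\ jcont a x y, jcont b x y, jcont c x y & jcont dc x y]) ->
  forall x, x \in `]0, 1[ ->
  is_derive x 1 (fun x => a x x + b x x) (2 * dc x x).
Proof.
move=> DA2 DA1 Dc sa sb J x x01.
have Jcb u v : u \in `]0, 1[ -> v \in `]0, 1[ -> jcont (fun x y => c x y - b x y) u v.
  move=> u01 v01 e e0; have [_ Jb Jc _] := J _ _ u01 v01.
  have e20 : 0 < e / 2 by rewrite divr_gt0.
  have [d d0 Hd] := Jb _ e20; have [d' d'0 Hd'] := Jc _ e20.
  exists (Num.min d d'); first by rewrite lt_min d0.
  move=> x' y'; rewrite !lt_min => /andP[h1 h2] /andP[h3 h4].
  have -> : c x' y' - b x' y' - (c u v - b u v) = (c x' y' - c u v) - (b x' y' - b u v) by ring.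
  rewrite (le_lt_trans (ler_normB _ _))// (splitr e) ltrD//; [exact: Hd'|exact: Hd].
have Jab u v : u \in `]0, 1[ -> v \in `]0, 1[ -> jcont (fun x y => a x y - b x y) u v.
  move=> u01 v01 e e0; have [Ja Jb _ _] := J _ _ u01 v01.
  have e20 : 0 < e / 2 by rewrite divr_gt0.
  have [d d0 Hd] := Ja _ e20; have [d' d'0 Hd'] := Jb _ e20.
  exists (Num.min d d'); first by rewrite lt_min d0.
  move=> x' y'; rewrite !lt_min => /andP[h1 h2] /andP[h3 h4].
  have -> : a x' y' - b x' y' - (a u v - b u v) = (a x' y' - a u v) - (b x' y' - b u v) by ring.
  rewrite (le_lt_trans (ler_normB _ _))// (splitr e) ltrD//; [exact: Hd|exact: Hd'].
apply: is_derive_approx => e e0.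
have e20 : 0 < e / 2 by rewrite divr_gt0.
have [_ _ _ Jdc] := J _ _ x01 x01.
have [r r0 Hr] := Jdc _ e20.
(* Points within [4 * m] of [x] stay in (0,1) and in the range where [dc] varies by less than
   [e / 2], which leaves room for the shifts by [h]. *)
pose m := Num.min (Num.min x (1 - x)) r / 4.
have [x0 x1] : 0 < x /\ x < 1 by move: x01; rewrite in_itv/= => /andP.
have m0 : 0 < m by rewrite /m divr_gt0// !lt_min x0 subr_gt0 x1.
have mr : 4 * m <= r by rewrite /m mulrC divfK// ge_min lexx orbT.
have mx : 4 * m <= x by rewrite /m mulrC divfK// !ge_min lexx.
have m1x : 4 * m <= 1 - x by rewrite /m mulrC divfK// !ge_min lexx orbT.
clearbody m.
exists m => // y yx.
have nx s (k : R) : `|s - x| < k * m -> x - k * m < s < x + k * m.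
  by rewrite ltr_distl.
have in01 s : `|s - x| < 4 * m -> s \in `]0, 1[.
  by move=> /nx; rewrite in_itv/=; lra.
(* The estimate is proved up to an arbitrary [e'], since [h] below has to depend on [y]. With
   multiplicity six errors of size [e' / 8] occur: two of weight 2 and two of weight 1. *)
apply/ler_addgt0Pl => e' e'0.
have yx4 : `|y - x| < 4 * m by clear - yx m0; lra.
have y01 := in01 _ yx4.
have e'80 : 0 < e' / 8 by rewrite divr_gt0.
have [Jax Jbx _ _] := J _ _ x01 x01; have [Jay Jby _ _] := J _ _ y01 y01.
have [d1 d10 H1] := Jax _ e'80; have [d2 d20 H2] := Jab _ _ x01 x01 _ e'80.
have [d3 d30 H3] := Jay _ e'80; have [d4 d40 H4] := Jab _ _ y01 y01 _ e'80.
pose h := Num.min m (Num.min (Num.min d1 d2) (Num.min d3 d4)) / 4.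
have h0 : 0 < h by rewrite /h divr_gt0// !lt_min m0 d10 d20 d30.
have hm : 4 * h <= m by rewrite /h mulrC divfK// ge_min lexx.
have hd1 : 4 * h <= d1 by rewrite /h mulrC divfK// !ge_min lexx !orbT.
have hd2 : 4 * h <= d2 by rewrite /h mulrC divfK// !ge_min lexx !orbT.
have hd3 : 4 * h <= d3 by rewrite /h mulrC divfK// !ge_min lexx !orbT.
have hd4 : 4 * h <= d4 by rewrite /h mulrC divfK// !ge_min lexx !orbT.
clearbody h.
have in01' s : x - 4 * m < s < x + 4 * m -> s \in `]0, 1[.
  by move=> H; apply: in01; rewrite ltr_distl.
have [yl yu] : x - m < y /\ y < x + m by have := nx y 1; rewrite !mul1r => /(_ yx) /andP.
(* the primitive of the part of [d/dx (A x (x + h) - A x (x - h))] that telescopes *)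
have [|s sI|K HK] := @primitive_itv (fun s => a s (s + h) - b s (s + h)) (x - 3 * m) (x + 3 * m).
- by clear - m0; lra.
- apply: (@jcont_diag (fun u v => a u v - b u v)); apply: Jab; apply: in01';
    clear - sI m0 h0 hm; lra.
(* To first order in [h] the first difference is [2 h a s s] and the second [h (a - b) s s], so that
   [Phi s] is about [h (a + b) s s]. In its derivative [a] and [b] cancel, because by symmetry
   [(a - b) s (s - h) = (a - b) (s - h) s]; what is left, [c s (s + h) - c s (s - h)], is about
   [2 h dc s s]. *)
pose Phi s := A s (s + h) - A s (s + - h) - (K s - K (s - h)).
have DPhi s : x - m < s < x + m -> is_derive s 1 Phi (c s (s + h) - c s (s + - h)).
  move=> sI.
  have s01 : s \in `]0, 1[ by apply: in01'; clear - sI m0; lra.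
  have sh01 : s + h \in `]0, 1[ by apply: in01'; clear - sI m0 h0 hm; lra.
  have sNh01 : s + - h \in `]0, 1[ by apply: in01'; clear - sI m0 h0 hm; lra.
  have Da := is_derive_diag DA1 DA2 Jcb s01 sh01.
  have Db := is_derive_diag DA1 DA2 Jcb s01 sNh01.
  have Dc' : is_derive s 1 K (a s (s + h) - b s (s + h)) by apply: HK; clear - sI m0; lra.
  have Dd : is_derive s 1 (fun s => K (s - h)) ((a (s - h) (s - h + h) - b (s - h) (s - h + h)) * 1).
    apply: (@is_derive1_chain _ K (fun s => s - h)); first by apply: HK; clear - sI m0 h0 hm; lra.
    by rewrite -[X in is_derive _ _ _ X]subr0; apply: is_derive1B.
  apply: is_derive_eq (is_derive1B (is_derive1B Da Db) (is_derive1B Dc' Dd)) _.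
  by rewrite subrK (sa (s - h)) (sb (s - h)); ring.
(* The exact form of this expansion, from the mean value theorem in [A s] and in [K]. *)
have PhiE s : `|s - x| < m -> exists th ta, [/\ `|th - s| <= 3 * h, `|ta - s| <= 2 * h &
    Phi s = h * (2 * a s th - (a ta (ta + h) - b ta (ta + h)))].
  move=> sxm; have := nx s 1; rewrite !mul1r => /(_ sxm)/andP[sl su].
  have s01 : s \in `]0, 1[ by apply: in01'; clear - sl su m0; lra.
  have sh01 : s + h \in `]0, 1[ by apply: in01'; clear - sl su m0 h0 hm; lra.
  have sNh01 : s + - h \in `]0, 1[ by apply: in01'; clear - sl su m0 h0 hm; lra.
  have [th [th01 ths E1]] := MVT01 (fun y y01 => DA2 s y s01 y01) sNh01 sh01.
  have sh : s - h < s by rewrite ltrBlDr ltrDl.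
  have DK z : z \in `](s - h), s[ -> is_derive z 1 K (a z (z + h) - b z (z + h)).
    by rewrite in_itv/= => zI; apply: HK; clear - zI sl su m0 h0 hm; lra.
  have CK : {within `[s - h, s], continuous K}.
    apply: continuous_in_subspaceT => z; rewrite inE/= in_itv/= => zI.
    by apply: (@is_derive_cont _ _ (a z (z + h) - b z (z + h))); apply: HK; clear - zI sl su m0 h0 hm; lra.
  have [ta] := MVT sh DK CK.
  rewrite in_itv/= => /andP[ta1 ta2] E2; exists th, ta; split.
  - move: ths; rewrite (_ : s + h - (s + - h) = 2 * h); last by ring.
    have h20 : 0 <= 2 * h by clear - h0; lra.
    by rewrite (ger0_norm h20) !ler_distl; clear - h0; lra.
  - by rewrite ler_distl; clear - ta1 ta2 h0; lra.
  - by rewrite /Phi E1 E2; ring.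
have x_x : `|x - x| < m by rewrite subrr normr0.
have [th1 [ta1 [H11 H12 E1]]] := PhiE _ x_x.
have [th2 [ta2 [H21 H22 E2]]] := PhiE _ yx.
have mI s : `|s - x| < m -> x - m < s < x + m by have := nx s 1; rewrite !mul1r.
have [xi [xiI xix EPhi]] := MVToo DPhi (mI _ x_x) (mI _ yx).
have xi01 : xi \in `]0, 1[ by apply: in01'; clear - xiI m0; lra.
have xih01 : xi + h \in `]0, 1[ by apply: in01'; clear - xiI m0 h0 hm; lra.
have xiNh01 : xi + - h \in `]0, 1[ by apply: in01'; clear - xiI m0 h0 hm; lra.
have [ze [ze01 zexi Ec]] := MVT01 (fun y y01 => Dc xi y xi01 y01) xiNh01 xih01.
have hE : xi + h - (xi + - h) = 2 * h by ring.
rewrite hE in zexi Ec.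
have zex : `|ze - x| < r.
  have h20 : 0 < 2 * h by rewrite mulr_gt0.
  move: zexi; rewrite (gtr0_norm h20) ler_distl => /andP[z1 z2].
  by rewrite ltr_distl; clear - z1 z2 xiI m0 h0 hm mr; lra.
have xir : `|xi - x| < r by rewrite (le_lt_trans xix)//; clear - yx m0 mr; lra.
have dcb := Hr _ _ xir zex.
(* Two expressions for the increment of [Phi] from [x] to [y], divided by [h]: one from its values,
   one from its derivative. *)
have key : 2 * a y th2 - (a ta2 (ta2 + h) - b ta2 (ta2 + h)) -
    (2 * a x th1 - (a ta1 (ta1 + h) - b ta1 (ta1 + h))) = 2 * dc xi ze * (y - x).
  apply: (@mulfI _ h); first by rewrite gt_eqF.
  by rewrite mulrBr -E1 -E2 EPhi Ec; ring.
have tah s ta : `|ta - s| <= 2 * h -> `|ta + h - s| <= 3 * h.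
  by rewrite !ler_distl => /andP[t1 t2]; clear - t1 t2; lra.
have t1 : `|th1 - x| < d1 by rewrite (le_lt_trans H11)//; clear - h0 hd1; lra.
have := H1 x th1; rewrite subrr normr0 => /(_ d10 t1); rewrite ltr_norml => B1.
have t2 : `|th2 - y| < d3 by rewrite (le_lt_trans H21)//; clear - h0 hd3; lra.
have := H3 y th2; rewrite subrr normr0 => /(_ d30 t2); rewrite ltr_norml => B3.
have t3 : `|ta1 - x| < d2 by rewrite (le_lt_trans H12)//; clear - h0 hd2; lra.
have t4 : `|ta1 + h - x| < d2 by rewrite (le_lt_trans (tah _ _ H12))//; clear - h0 hd2; lra.
have := H2 ta1 (ta1 + h) t3 t4; rewrite ltr_norml => B2.
have t5 : `|ta2 - y| < d4 by rewrite (le_lt_trans H22)//; clear - h0 hd4; lra.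
have t6 : `|ta2 + h - y| < d4 by rewrite (le_lt_trans (tah _ _ H22))//; clear - h0 hd4; lra.
have := H4 ta2 (ta2 + h) t5 t6; rewrite ltr_norml => B4.
have : `|2 * (dc xi ze - dc x x) * (y - x)| <= e * `|y - x|.
  by rewrite normrM ler_wpM2r// normrM ger0_norm//; clear - dcb; lra.
rewrite ler_norml => B5.
have -> : a y y + b y y - (a x x + b x x) - 2 * dc x x * (y - x) =
  2 * (a y y - a y th2) - (a y y - b y y - (a ta2 (ta2 + h) - b ta2 (ta2 + h))) -
  (2 * (a x x - a x th1) - (a x x - b x x - (a ta1 (ta1 + h) - b ta1 (ta1 + h)))) +
  2 * (dc xi ze - dc x x) * (y - x).
  have -> : 2 * (dc xi ze - dc x x) * (y - x) = 2 * dc xi ze * (y - x) - 2 * dc x x * (y - x) by ring.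
  by rewrite -key; ring.
rewrite ler_norml; clear - B1 B2 B3 B4 B5; lra.
Qed.

(** Formally [(sqrt S)' <= sqrt S / 2 + G], which is integrated with the factor [exp (- x / 2)];
    then [x <= 1]. As the square root is not differentiable at 0, it is applied to [S + d] for a
    small [d]. *)
Lemma sqrt_gronwall (S dS : R -> R) (X G : R) : 0 <= G -> 0 <= X <= 1 ->
  {within `[0, 1], continuous S} -> (forall x, 0 <= S x) ->
  (forall x, x \in `]0, 1[ -> is_derive x 1 S (dS x)) ->
  (forall x, x \in `]0, 1[ -> x < X -> dS x <= S x + 2 * G * Num.sqrt (S x)) ->
  forall x, 0 <= x <= X -> Num.sqrt (S x) <= expR (2^-1) * (Num.sqrt (S 0) + G * x).
Proof.
move=> G0 X01 cS S0 DS HS x /andP[x0 xX].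
have [->|xn0] := eqVneq x 0.
  rewrite mulr0 addr0 ler_peMl ?sqrtr_ge0//.
  by rewrite -expR0 ler_expR.
have {xn0}x0 : 0 < x by rewrite lt_def xn0.
set E := expR _.
have E0 : 0 < E by exact: expR_gt0.
apply/ler_addgt0Pl => e e0.
(* Chosen so that the shift contributes at most [E * sqrt d = e] to the final bound. *)
pose d := (e / E) ^+ 2.
have d0 : 0 < d by rewrite exprn_gt0// divr_gt0.
pose T x := Num.sqrt (S x + d).
have Sd y : 0 < S y + d by rewrite ltr_wpDl.
have T0 y : 0 < T y by rewrite sqrtr_gt0.
(* The differential inequality makes the derivative of [r] at most [G * exp (- y / 2) - G], which is
   nonpositive. *)
pose r y := T y * expR (- (2^-1 * y)) - G * y.
have Dr y : y \in `]0, x[ -> is_derive y 1 r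
   ((2 * T y)^-1 * dS y * expR (- (2^-1 * y)) + T y * (expR (- (2^-1 * y)) * - 2^-1) - G).
  rewrite in_itv/= => /andP[y0 yx].
  have y01 : y \in `]0, 1[ by rewrite in_itv/=; lra.
  have D1 : is_derive y 1 T ((2 * T y)^-1 * (dS y + 0)).
    apply: (@is_derive1_chain _ Num.sqrt (fun y => S y + d)).
      exact: is_derive1_sqrt.
    by apply: is_derive1D; exact: DS.
  have D2 : is_derive y 1 (fun y => expR (- (2^-1 * y))) (expR (- (2^-1 * y)) * - (2^-1 * 1)).
    apply: (@is_derive1_chain _ expR (fun y => - (2^-1 * y))).
  have D3 : is_derive y 1 (fun y => G * y) (G * 1) by apply: is_derive1Z.
  apply: is_derive_eq (is_derive1B (is_derive1M D1 D2) D3) _.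
  by rewrite addr0 !mulr1.
have Cr : {within `[0, x], continuous r}.
  have cS' : {within `[0, x], continuous S}.
    apply: continuous_subspaceW cS => z /=; rewrite !in_itv/= => /andP[-> /le_trans]; apply.
    by lra.
  move=> z; apply: cvgB; last first.
    apply: cvgMr; exact: (@continuous_subspaceT _ _ `[0, x]%classic id (fun _ => cvg_id)).
  apply: cvgM.
    apply: (@continuous_comp _ _ _ (fun z : subspace `[0, x] => S z + d) Num.sqrt).
      by apply: cvgD; [exact: cS'|exact: cvg_cst].
    exact: sqrt_continuous.
  apply: (@continuous_subspaceT _ _ `[0, x]%classic (fun y => expR (- (2^-1 * y)))) => t.
  apply: (@continuous_comp _ _ _ (fun y => - (2^-1 * y)) expR); last exact: continuous_expR.
  by apply: cvgN; apply: cvgMr.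
have [z] := MVT x0 Dr Cr; rewrite in_itv/= subr0 => /andP[z0 zx] Er.
have z01 : z \in `]0, 1[ by rewrite in_itv/=; lra.
have ST : Num.sqrt (S z) <= T z by rewrite ler_sqrt ?lerDl ltW.
have TT : T z ^+ 2 = S z + d by rewrite sqr_sqrtr// ltW.
have ez : expR (- (2^-1 * z)) <= 1 by rewrite -expR0 ler_expR oppr_le0 mulr_ge0 ?ltW.
have rx : r x <= r 0.
  rewrite -subr_le0 Er pmulr_lle0// subr_le0.
  have -> : (2 * T z)^-1 * dS z * expR (- (2^-1 * z)) + T z * (expR (- (2^-1 * z)) * - 2^-1)
     = (dS z - T z ^+ 2) / (2 * T z) * expR (- (2^-1 * z)).
    by field; rewrite gt_eqF.
  have Q : (dS z - T z ^+ 2) / (2 * T z) <= G.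
    rewrite ler_pdivrMr ?mulr_gt0// TT.
    have := HS z z01 ltac:(lra).
    have : G * Num.sqrt (S z) <= G * T z by rewrite ler_wpM2l.
    by lra.
  rewrite (@le_trans _ _ (G * expR (- (2^-1 * z))))// ?ler_wpM2r ?expR_ge0//.
  by rewrite ler_piMr.
have T00 : T 0 <= Num.sqrt (S 0) + e / E.
  have eE : 0 <= e / E by rewrite divr_ge0 ?ltW.
  rewrite -(@ler_pXn2r _ 2) ?nnegrE ?sqrtr_ge0 ?addr_ge0 ?sqrtr_ge0//.
  rewrite sqr_sqrtr ?(ltW (Sd _))// sqrrD sqr_sqrtr// -/d.
  have : 0 <= Num.sqrt (S 0) * (e / E) by rewrite mulr_ge0 ?sqrtr_ge0.
  by lra.
move: rx; rewrite /r !mulr0 subr0 oppr0 expR0 mulr1 expRN lerBlDr.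
rewrite ler_pdivrMr ?expR_gt0// => Tx.
have xE : expR (2^-1 * x) <= E by rewrite ler_expR ler_piMr//; lra.
have Sx : Num.sqrt (S x) <= T x by rewrite ler_sqrt ?lerDl ltW.
rewrite (le_trans Sx)// (le_trans Tx)//.
have P : 0 <= Num.sqrt (S 0) + e / E + G * x.
  have Gx : 0 <= G * x by rewrite mulr_ge0// ltW.
  have eE : 0 < e / E by rewrite divr_gt0.
  have s0 := sqrtr_ge0 (S 0).
  by clear - Gx eE s0; lra.
apply: (@le_trans _ _ ((Num.sqrt (S 0) + e / E + G * x) * E)).
  apply: ler_pM => //; rewrite ?expR_ge0 ?lerD2r//.
  by rewrite addr_ge0 ?(ltW (T0 _))// mulr_ge0// ltW.
rewrite [leLHS]mulrC -[e in leRHS](divfK (lt0r_neq0 E0)) [e / E * E]mulrC -mulrDr.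
by rewrite ler_pM2l//; lra.
Qed.


End Calculus.

(** * Evolution equations in weak form *)

Section Curves.
Variable R : realType.
Notation mu := (@mu01 R).
Implicit Types (f psi : L2 R) (v w p g : R -> L2 R).

Lemma itvoo_cc (x : R) : x \in `]0, 1[ -> x \in `[0, 1].
Proof. by rewrite !in_itv/= => /andP[/ltW -> /ltW ->]. Qed.

Lemma cont01P (N : L2 R -> R) v : (forall f, 0 <= N f) ->
  cont01 N v <-> forall x, x \in `[0, 1] -> forall e : R, 0 < e ->
    exists2 d : R, 0 < d & forall t, t \in `[0, 1] -> `|t - x| < d ->
      N (v t - v x) < e.
Proof.
move=> N0; split=> H x x01.
  move=> e e0; have /cvgrPdist_lt /(_ e e0) := H x x01.
  rewrite near_withinE => /nbhs_ballP[d /= d0 Hd]; exists d => // t t01 tx.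
  have := Hd t; rewrite /ball/= distrC => /(_ tx t01).
  by rewrite sub0r normrN ger0_norm.
apply/cvgrPdist_lt => e e0; have [d d0 Hd] := H x x01 e e0.
rewrite near_withinE; apply/nbhs_ballP; exists d => // t; rewrite /ball/= distrC.
by move=> tx t01; rewrite sub0r normrN ger0_norm// Hd.
Qed.

Lemma cont01_L2P v : cont01 (@L2norm R) v <->
  forall x, x \in `[0, 1] -> forall e : R, 0 < e ->
    exists2 d : R, 0 < d & forall t, t \in `[0, 1] -> `|t - x| < d ->
      L2norm (v t - v x) < e.
Proof. by apply: cont01P => f; exact: L2norm_ge0. Qed.

Lemma cont01_le (N N' : L2 R -> R) v v' : (forall f, 0 <= N f) ->
  (forall f, 0 <= N' f) ->
  (exists C : R, forall x t, x \in `[0, 1] -> t \in `[0, 1] ->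
    N' (v' t - v' x) <= C * N (v t - v x)) ->
  cont01 N v -> cont01 N' v'.
Proof.
move=> N0 N'0 [C HC] /(cont01P _ N0) H; apply/(cont01P _ N'0) => x x01 e e0.
have C0 : 0 < `|C| + 1 by rewrite ltr_wpDl.
have [|d d0 Hd] := H x x01 (e / (`|C| + 1)); first by rewrite divr_gt0.
exists d => // t t01 tx; rewrite (le_lt_trans (HC x t x01 t01))//.
have := Hd t t01 tx; rewrite ltr_pdivlMr// mulrC; apply: le_lt_trans.
by rewrite ler_wpM2r// (le_trans (ler_norm C))// lerDl.
Qed.

Lemma cont01_H1_L2 v : cont01 (@H1norm R) v -> cont01 (@L2norm R) v.
Proof.
apply: cont01_le; [exact: H1norm_ge0|exact: L2norm_ge0|exists 1 => x t _ _].
by rewrite mul1r L2norm_le_H1norm.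
Qed.

Lemma cont01_wd v : (forall x, x \in `[0, 1] -> H1 (v x)) ->
  cont01 (@H1norm R) v -> cont01 (@L2norm R) (fun x => wd (v x)).
Proof.
move=> Hv; apply: cont01_le; [exact: H1norm_ge0|exact: L2norm_ge0|exists 1 => x t x01 t01].
rewrite mul1r (L2norm_ae (g := wd (v t - v x))) ?L2norm_wd_le_H1norm//.
by apply: ae_sym; apply: wdB; exact: Hv.
Qed.

Lemma cont01B v w : cont01 (@L2norm R) v -> cont01 (@L2norm R) w ->
  cont01 (@L2norm R) (fun x => v x - w x).
Proof.
move=> /cont01_L2P cv /cont01_L2P cw; apply/cont01_L2P => x x01 e e0.
have e20 : 0 < e / 2 by rewrite divr_gt0.
have [d d0 Hd] := cv x x01 _ e20; have [d' d'0 Hd'] := cw x x01 _ e20.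
exists (Num.min d d'); first by rewrite lt_min d0.
move=> t t01; rewrite lt_min => /andP[td td'].
have -> : v t - w t - (v x - w x) = (v t - v x) - (w t - w x).
  by rewrite !opprD !opprK addrACA.
apply: le_lt_trans (L2normD _ _) _; rewrite L2normN (splitr e); apply: ltrD.
  exact: Hd.
exact: Hd'.
Qed.

Lemma cont01_dist v x : cont01 (@L2norm R) v -> x \in `[0, 1] ->
  forall e : R, 0 < e -> exists2 d : R, 0 < d & forall t, t \in `[0, 1] ->
    `|t - x| < d -> L2norm (v t - v x) < e.
Proof. by move=> /cont01_L2P H x01 e e0; exact: H. Qed.

Lemma inner_dist (f g f' g' : L2 R) : `|inner f g - inner f' g'| <=
  L2norm (f - f') * L2norm (g - g') + L2norm (f - f') * L2norm g' +
  L2norm f' * L2norm (g - g').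
Proof.
have -> : inner f g - inner f' g' = inner (f - f') (g - g') + inner (f - f') g' + inner f' (g - g').
  by rewrite !innerBr !innerBl; ring.
by rewrite (le_trans (ler_normD _ _))// lerD ?CauchySchwarz//
  (le_trans (ler_normD _ _))// lerD ?CauchySchwarz.
Qed.

Lemma inner_approx (f' g' : L2 R) (e : R) : 0 < e ->
  exists2 d : R, 0 < d & forall f g : L2 R,
  L2norm (f - f') < d -> L2norm (g - g') < d -> `|inner f g - inner f' g'| < e.
Proof.
move=> e0; pose M := 1 + L2norm f' + L2norm g'.
have f0 := L2norm_ge0 f'; have g0 := L2norm_ge0 g'.
have M0 : 0 < M by rewrite /M; clear - f0 g0; lra.
(* The bound 1 turns the product of the two errors into a linear term. *)
exists (Num.min 1 (e / M)); first by rewrite lt_min ltr01 divr_gt0.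
move=> f g; rewrite !lt_min => /andP[f1 fe] /andP[g1 ge].
apply: le_lt_trans (inner_dist _ _ _ _) _.
have ff0 := L2norm_ge0 (f - f'); have gg0 := L2norm_ge0 (g - g').
set a := L2norm (f - f') in f1 fe ff0 *; set b := L2norm (g - g') in g1 ge gg0 *.
have eM : e = e / M + e / M * L2norm f' + e / M * L2norm g'.
  by rewrite /M; field; rewrite gt_eqF.
rewrite eM addrAC; apply: ltr_leD; first apply: ltr_leD.
- by apply: le_lt_trans ge; rewrite ler_piMl// ltW.
- by rewrite mulrC ler_wpM2r// ltW.
- by rewrite ler_wpM2r// ltW.
Qed.

Lemma jcont_inner v w x t : cont01 (@L2norm R) v -> cont01 (@L2norm R) w ->
  x \in `]0, 1[ -> t \in `]0, 1[ -> jcont (fun x t => inner (v x) (w t)) x t.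
Proof.
move=> cv cw x01 t01 e e0; have [d d0 Hd] := inner_approx (v x) (w t) e0.
have [d1 d10 H1] := cont01_dist cv (itvoo_cc x01) d0.
have [d2 d20 H2] := cont01_dist cw (itvoo_cc t01) d0.
move: x01 t01; rewrite !in_itv/= => /andP[x0 x1] /andP[t0 t1].
exists (Num.min (Num.min (Num.min x (1 - x)) (Num.min t (1 - t))) (Num.min d1 d2)).
  by rewrite !lt_min x0 t0 !subr_gt0 x1 t1 d10.
move=> x' t'; rewrite !lt_min => /andP[/andP[/andP[a1 a2] _] /andP[a3 _]].
move=> /andP[/andP[_ /andP[b1 b2]] /andP[_ b3]].
apply: Hd; [apply: H1 => //|apply: H2 => //]; rewrite in_itv/=.
  have := ler_norm (x' - x); have := ler_norm (x - x'); rewrite (distrC x).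
  by clear - a1 a2; lra.
have := ler_norm (t' - t); have := ler_norm (t - t'); rewrite (distrC t).
by clear - b1 b2; lra.
Qed.

Lemma inner_within_continuous v w : cont01 (@L2norm R) v -> cont01 (@L2norm R) w ->
  {within `[0, 1], continuous (fun x => inner (v x) (w x))}.
Proof.
move=> cv cw; apply/subspace_continuousP => x x01; apply/cvgrPdist_lt => e e0.
have [d d0 Hd] := inner_approx (v x) (w x) e0.
have [d1 d10 H1] := cont01_dist cv x01 d0.
have [d2 d20 H2] := cont01_dist cw x01 d0.
rewrite near_withinE; apply/nbhs_ballP; exists (Num.min d1 d2) => /=.
  by rewrite lt_min d10.
move=> t; rewrite /ball/= distrC lt_min => /andP[t1 t2] t01.
by rewrite distrC; apply: Hd; [exact: H1|exact: H2].
Qed.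

Lemma cont01_cst f : cont01 (@L2norm R) (fun=> f).
Proof.
by apply/cont01_L2P => x _ e e0; exists 1 => // t _ _; rewrite subrr L2norm0.
Qed.

Lemma C1_L2P v vx : C1_L2 v vx -> forall x, x \in `[0, 1] -> forall e : R, 0 < e ->
  exists2 d : R, 0 < d & forall t, t \in `[0, 1] -> `|t - x| < d ->
    L2norm (v t - v x - (t - x) *: vx x) <= e * `|t - x|.
Proof.
move=> [H _] x x01 e e0; have /cvgrPdist_lt /(_ e e0) := H x x01.
rewrite near_withinE => /nbhs_ballP[d /= d0 Hd]; exists d => // t t01 tx.
have [->|tn] := eqVneq t x.
  by rewrite !subrr scale0r subrr L2norm0 normr0 mulr0.
have tx0 : t - x != 0 by rewrite subr_eq0.
have := Hd t; rewrite /ball/= distrC => /(_ tx tn t01).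
rewrite sub0r normrN ger0_norm ?L2norm_ge0// => /ltW Hle.
have -> : v t - v x - (t - x) *: vx x =
   (t - x) *: ((t - x)^-1 *: (v t - v x) - vx x).
  by rewrite scalerBr scalerA mulfV// scale1r.
by rewrite L2normZ mulrC ler_wpM2r.
Qed.

Lemma C1_L2_cont v vx : C1_L2 v vx -> cont01 (@L2norm R) v.
Proof.
move=> H; apply/cont01_L2P => x x01 e e0; have [d d0 Hd] := C1_L2P H x01 ltr01.
have N0 : 0 < 1 + L2norm (vx x) by rewrite ltr_wpDr// L2norm_ge0.
exists (Num.min d (e / (1 + L2norm (vx x)))); first by rewrite lt_min d0 divr_gt0.
move=> t t01; rewrite lt_min => /andP[td]; rewrite ltr_pdivlMr//; apply: le_lt_trans.
rewrite -[v t - v x](subrK ((t - x) *: vx x)) (le_trans (L2normD _ _))//.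
rewrite mulrDr mulr1 lerD// ?L2normZ//.
by have := Hd t t01 td; rewrite mul1r.
Qed.

Lemma is_derive_inner_C1 f v vx (x : R) : C1_L2 v vx -> x \in `]0, 1[ ->
  is_derive x 1 (fun t => inner f (v t)) (inner f (vx x)).
Proof.
move=> H x01; apply: is_derive_approx => e e0.
have N0 : 0 < L2norm f + 1 by rewrite ltr_wpDl// L2norm_ge0.
have [|d d0 Hd] := C1_L2P H (itvoo_cc x01) (e := e / (L2norm f + 1)).
  by rewrite divr_gt0.
have := x01; rewrite in_itv/= => /andP[x0 x1].
exists (Num.min (Num.min x (1 - x)) d); first by rewrite !lt_min x0 subr_gt0 x1.
move=> t; rewrite !lt_min => /andP[/andP[t1 t2] td].
have t01 : t \in `[0, 1].
  rewrite in_itv/=; have := ler_norm (t - x); have := ler_norm (x - t).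
  by rewrite (distrC x); clear - t1 t2; lra.
have -> : inner f (v t) - inner f (v x) - inner f (vx x) * (t - x) =
    inner f (v t - v x - (t - x) *: vx x).
  by rewrite !innerBr innerZr; ring.
rewrite (le_trans (CauchySchwarz _ _))//.
apply: (@le_trans _ _ (L2norm f * (e / (L2norm f + 1) * `|t - x|))).
  by rewrite ler_wpM2l ?L2norm_ge0// Hd.
rewrite mulrA ler_wpM2r// mulrCA ler_piMr ?(ltW e0)// ler_pdivrMr// mul1r.
by rewrite lerDl.
Qed.

Lemma is_derive_inner_C1_sqr v vx (x : R) : C1_L2 v vx -> x \in `]0, 1[ ->
  is_derive x 1 (fun t => inner (v t) (v t)) (2 * inner (v x) (vx x)).
Proof.
move=> H x01; have cv := C1_L2_cont H; have [_ cvx] := H.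
have D1 (s t : R) : s \in `]0, 1[ -> t \in `]0, 1[ ->
    is_derive s 1 (fun s => inner (v s) (v t)) (inner (vx s) (v t)).
  move=> s01 t01; rewrite innerC; under eq_fun do rewrite innerC.
  exact: is_derive_inner_C1.
have D2 (s t : R) : s \in `]0, 1[ -> t \in `]0, 1[ ->
    is_derive t 1 (fun t => inner (v s) (v t)) (inner (v s) (vx t)).
  by move=> s01 t01; exact: is_derive_inner_C1.
have J s t : s \in `]0, 1[ -> t \in `]0, 1[ -> jcont (fun s t => inner (vx s) (v t)) s t.
  exact: jcont_inner.
have x01' : x + 0 \in `]0, 1[ by rewrite addr0.
have := is_derive_diag D1 D2 J x01 x01'.
under eq_fun do rewrite addr0.
rewrite addr0 => D; apply: is_derive_eq D _.
by rewrite (innerC (vx x)); ring.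
Qed.

(* [d/dx <p, psi> = <g, psi> - <w_y, psi_y>], that is [p_x = w_yy + g] in
   the dual of [H01]. *)
Definition evolution w p g := forall psi, H01 psi -> forall x : R, x \in `]0, 1[ ->
  is_derive x 1 (fun x => inner (p x) psi)
    (inner (g x) psi - inner (wd (w x)) (wd psi)).

Lemma evolutionB w p g w' p' g' : (forall x, x \in `[0, 1] -> H1 (w x)) ->
  (forall x, x \in `[0, 1] -> H1 (w' x)) ->
  evolution w p g -> evolution w' p' g' ->
  evolution (fun x => w x - w' x) (fun x => p x - p' x) (fun x => g x - g' x).
Proof.
move=> Hw Hw' E E' psi Hpsi x x01.
under eq_fun do rewrite innerBl.
apply: is_derive_eq (is_derive1B (E psi Hpsi x x01) (E' psi Hpsi x x01)) _.
rewrite (inner_ael _ (wdB (Hw _ (itvoo_cc x01)) (Hw' _ (itvoo_cc x01)))) !innerBl.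
by rewrite !opprD !opprK addrACA.
Qed.

Definition energy w p x : R := L2norm (p x) ^+ 2 + H1norm (w x) ^+ 2.

Lemma energy_ge0 w p x : 0 <= energy w p x.
Proof. by rewrite addr_ge0// sqr_ge0. Qed.

(** The energy identity contributes [2 <g, p> <= 2 G sqrt S]. The term [|w|^2] contributes
    [2 <w, p>], which is at most [|w|^2 + |p|^2] and hence at most [S]; this is the hypothesis of
    [sqrt_gronwall]. *)
Lemma energy_estimate w p g (X G : R) : (forall x, x \in `[0, 1] -> H01 (w x)) ->
  cont01 (@H1norm R) w -> C1_L2 w p -> cont01 (@L2norm R) g -> evolution w p g ->
  0 <= G -> 0 <= X <= 1 -> (forall x, 0 <= x <= X -> L2norm (g x) <= G) ->
  forall x, 0 <= x <= X ->
    Num.sqrt (energy w p x) <= expR (2^-1) * (Num.sqrt (energy w p 0) + G * x).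
Proof.
move=> Hw cw Cw cg E G0 X01 gG.
have cwL := cont01_H1_L2 cw; have [_ cp] := Cw.
have cv : cont01 (@L2norm R) (fun x => wd (w x)).
  by apply: cont01_wd => // x /Hw; exact: H01_H1.
have SE x : energy w p x = inner (p x) (p x) + inner (wd (w x)) (wd (w x)) + inner (w x) (w x).
  by rewrite /energy H1norm_sqr !L2norm_sqr (addrC (inner (w x) _)) addrA.
apply: (@sqrt_gronwall R (energy w p) (fun x => 2 * inner (g x) (p x) + 2 * inner (w x) (p x)) X G) => //.
- rewrite (_ : energy w p = fun x => inner (p x) (p x) + inner (wd (w x)) (wd (w x)) + inner (w x) (w x)); last first.
    by apply/funext => x; exact: SE.
  move=> x; apply: cvgD; first apply: cvgD; exact: inner_within_continuous.
- by move=> x; exact: energy_ge0.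
- move=> x x01.
  rewrite (_ : energy w p = fun x => (inner (p x) (p x) + inner (wd (w x)) (wd (w x))) + inner (w x) (w x)); last first.
    by apply/funext => y; exact: SE.
  apply: is_derive1D; last exact: is_derive_inner_C1_sqr.
  apply: (@energy_identity R (fun x t => inner (p x) (w t))
    (fun x t => inner (p x) (p t)) (fun x t => inner (wd (w x)) (wd (w t)))
    (fun x t => inner (g x) (w t)) (fun x t => inner (g x) (p t)) _ _ _ _ _ _ x x01).
  + by move=> s t s01 t01; exact: is_derive_inner_C1.
  + by move=> s t s01 t01; exact: E (Hw _ (itvoo_cc t01)) _ s01.
  + by move=> s t s01 t01; exact: is_derive_inner_C1.
  + by move=> s t; exact: innerC.
  + by move=> s t; exact: innerC.
  + move=> s t s01 t01; split; exact: jcont_inner.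
- move=> x x01 xX.
  set s := Num.sqrt _; have sE : s ^+ 2 = energy w p x by rewrite sqr_sqrtr// energy_ge0.
  have ps : L2norm (p x) <= s.
    rewrite -(@ler_pXn2r _ 2) ?nnegrE ?L2norm_ge0 ?sqrtr_ge0// sE lerDl; exact: sqr_ge0.
  have gp : inner (g x) (p x) <= G * s.
    rewrite (le_trans (ler_norm _))// (le_trans (CauchySchwarz _ _))//.
    rewrite ler_pM ?L2norm_ge0// gG//; move: x01; rewrite in_itv/= => /andP[x0 _].
    by rewrite !ltW.
  have wp : 2 * inner (w x) (p x) <= energy w p x.
    have := le_trans (ler_norm _) (CauchySchwarz (w x) (p x)).
    rewrite /energy H1norm_sqr; have := sqr_ge0 (L2norm (w x) - L2norm (p x)).
    have := sqr_ge0 (L2norm (wd (w x))).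
    set i := inner _ _; set a := L2norm (w x); set b := L2norm (p x); set c := L2norm (wd _).
    by clear; nra.
  by rewrite -mulrA; clear - gp wp; lra.
Qed.

Lemma du_Bois_Reymond_derive (a b : R -> R) : {within `[0, 1], continuous a} ->
  {within `[0, 1], continuous b} ->
  (forall phi, test_fun phi ->
     \int[mu]_x (a x * derive1 phi x) = - \int[mu]_x (b x * phi x)) ->
  forall x : R, x \in `]0, 1[ -> is_derive x 1 a (b x).
Proof.
move=> ca cb H x x01; pose B := toL2 (clamp01_Lfun cb).
have HB phi : test_fun phi -> \int[mu]_x (a x * derive1 phi x) = - \int[mu]_x (B x * phi x).
  move=> tphi; rewrite H// toL2E; congr (- _); apply: eq_Rintegral => y _ /=.
  have [y01|y01] := boolP (y \in `]0, 1[); first by rewrite clamp01_id// itvoo_cc.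
  by rewrite (test_fun_out tphi y01) !mulr0.
have aE := du_Bois_Reymond ca HB.
have DB : is_derive x 1 (prim B) (b x).
  have cB : {for x, continuous B} by rewrite toL2E; exact: clamp01_continuous.
  have := is_derive_prim x01 cB; rewrite toL2E/= clamp01_id//; exact: itvoo_cc.
have D : is_derive x 1 (fun x => a 0 + prim B x) (0 + b x).
  by apply: is_derive1D.
apply: near_eq_is_derive (is_derive_eq D (add0r _)).
have := x01; rewrite in_itv/= => /andP[x0 x1].
near=> t; have t01 : t \in `[0, 1].
  rewrite in_itv/=; apply/andP; split; apply: ltW.
    by near: t; exact: lt_nbhsr.
  by near: t; exact: lt_nbhsl.
by rewrite [RHS](aE t t01) toL2E.
Unshelve. all: by end_near.
Qed.

Lemma measurable_mul_test (h phi : R -> R) : test_fun phi ->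
  measurable_fun (`]0, 1[ : set (measurableTypeR R)) h ->
  measurable_fun setT ((fun x => h x * phi x) : measurableTypeR R -> R).
Proof.
move=> tphi mh.
have mI : measurable (`]0%R, 1%R[%classic : set (measurableTypeR R)) by exact: measurable_itv.
rewrite -(setUv (`]0%R, 1%R[%classic : set (measurableTypeR R))).
apply/measurable_funU => //; first exact: measurableC.
split.
  apply: measurable_funM => //; apply: measurable_funTS; exact: test_fun_measurable.
apply: (eq_measurable_fun ((fun=> 0) : measurableTypeR R -> R)); last exact: measurable_cst.
by move=> x; rewrite inE/= => /negP x01; rewrite (test_fun_out tphi x01) mulr0.
Qed.

(** Paired with a fixed [psi], the second derivative agrees a.e. with a continuous function of [x],
    so that [<vx x, psi>] is differentiable at every [x] of (0,1). *)
Lemma wave_evolution g (v0 : L2 R) v vx : cont01 (@L2norm R) g ->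
  wave_weak_solution g v0 v vx -> evolution v vx g.
Proof.
move=> cg [[Hv cv] C1v [vxx [[_ mvxx _ _] dvxx vxxE] _ _]] psi Hpsi.
have [_ cvx] := C1v.
have cwd : cont01 (@L2norm R) (fun x => wd (v x)).
  by apply: cont01_wd => // x /Hv; exact: H01_H1.
have cb : {within `[0, 1], continuous (fun x => inner (g x) psi - inner (wd (v x)) (wd psi))}.
  move=> x; apply: cvgB.
    exact: (inner_within_continuous cg (cont01_cst psi)).
  exact: (inner_within_continuous cwd (cont01_cst (wd psi))).
apply: (du_Bois_Reymond_derive _ cb).
  exact: (inner_within_continuous cvx (cont01_cst psi)).
move=> phi tphi; rewrite dvxx//; congr (- _); apply: Rintegral_ae_eq.
- by apply: measurable_mul_test => //; exact: mvxx.
- apply: measurable_mul_test => //.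
  apply: subspace_continuous_measurable_fun; first exact: measurable_itv.
  apply: continuous_subspaceW cb => x /=; exact: itvoo_cc.
- by apply: filterS (vxxE _ Hpsi) => x <- _; rewrite addrK.
Qed.

End Curves.

Lemma ae_le_Rintegral d (T : measurableType d) (R : realType)
    (m : {measure set T -> \bar R}) (f g : T -> R) :
  measurable_fun setT f -> (forall x, 0 <= f x) -> (forall x, 0 <= g x) ->
  m.-integrable setT (EFin \o g) -> {ae m, forall x, f x <= g x} ->
  m.-integrable setT (EFin \o f) /\ \int[m]_x f x <= \int[m]_x g x.
Proof.
move=> mf f0 g0 ig fg; have mg : measurable_fun setT (EFin \o g) by case/integrableP: ig.
have le : (\int[m]_x (EFin \o f) x <= \int[m]_x (EFin \o g) x)%E.
  apply: ae_ge0_le_integral => //.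
  - by move=> x _; rewrite lee_fin.
  - exact/measurable_EFinP.
  - by move=> x _; rewrite lee_fin.
  - by apply: filterS fg => x fgx _; rewrite lee_fin.
have iF : m.-integrable setT (EFin \o f).
  apply/integrableP; split; first exact/measurable_EFinP.
  rewrite (eq_integral (EFin \o f)) => [|x _]; last by rewrite /= ger0_norm.
  by apply: le_lt_trans le _; exact: integrable_lty.
by split=> //; apply: fine_le => //; exact: integrable_fin_num.
Qed.

(** * Square-integrable kernels *)

Section Kernel.
Variable R : realType.
Notation mu := (@mu01 R).
Notation "'mR'" := (measurableTypeR R).
Notation mu2 := (@mu01 R \x @mu01 R)%E.
Implicit Types (F H : mR * mR -> R) (c psi : L2 R).

Definition sq_integrable F := measurable_fun setT F /\
  mu2.-integrable setT (EFin \o (fun z => F z ^+ 2)).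

Lemma sq_integrable_Lfun F : F \in Lfun (@mu01sq R) 2%:E -> sq_integrable F.
Proof.
move=> HF; split.
  by move: HF; rewrite inE => /andP[]; rewrite inE.
by apply/Lfun1_integrable/Lfun2_mul_Lfun1.
Qed.

Lemma sq_integrableM F H : sq_integrable F -> sq_integrable H ->
  mu2.-integrable setT (EFin \o (fun z => F z * H z)).
Proof.
move=> [mF iF] [mH iH].
apply: (@le_integrable _ _ _ mu2 _ measurableT _ (fun z => (F z ^+ 2 + H z ^+ 2)%:E)).
- by apply/measurable_EFinP; exact: measurable_funM.
- move=> z _ /=; rewrite lee_fin [leRHS]ger0_norm ?addr_ge0 ?sqr_ge0//.
  rewrite normrM -(@real_normK _ (F z)) ?num_real// -(@real_normK _ (H z)) ?num_real//.
  set a := `|F z|; set b := `|H z|; have a0 : 0 <= a by rewrite /a.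
  have b0 : 0 <= b by rewrite /b.
  by clearbody a b; clear -a0 b0; nra.
- by under eq_fun do rewrite EFinD; exact: integrableD.
Qed.

Lemma measurable_tensor (f g : mR -> R) : measurable_fun setT f ->
  measurable_fun setT g ->
  measurable_fun setT (fun z : mR * mR => f z.1 * g z.2).
Proof.
move=> mf mg; apply: measurable_funM.
  exact: (measurableT_comp mf measurable_fst).
exact: (measurableT_comp mg measurable_snd).
Qed.

Lemma sq_integrable_tensor c psi : sq_integrable (fun z => c z.1 * psi z.2).
Proof.
have m : measurable_fun setT (fun z : mR * mR => c z.1 * psi z.2).
  by apply: measurable_tensor; exact: L2_measurable.
split=> //; apply: (integrable12ltyP _ _ _).2.
  by apply/measurable_EFinP; exact: measurable_funX.
rewrite (eq_integral (fun x => (c x ^+ 2 * L2norm psi ^+ 2)%:E)) => [|x _].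
  apply: integrable_lty => //.
  under eq_fun do rewrite mulrC EFinM.
  by apply: integrableZl => //; exact: integrable_L2M.
rewrite (eq_integral (fun y => ((c x ^+ 2)%:E * (psi y * psi y)%:E))%E) => [|y _].
  rewrite integralZl//; last exact: integrable_L2M.
  rewrite L2norm_sqr [RHS]EFinM; congr (_ * _)%E; rewrite -[LHS]fineK//.
  by apply: integrable_fin_num => //; exact: integrable_L2M.
by rewrite /= ger0_norm ?sqr_ge0// exprMn EFinM.
Qed.

Lemma sq_integrable_bounded F (M : R) : measurable_fun setT F ->
  (forall z, `|F z| <= M) -> sq_integrable F.
Proof.
move=> mF FM; split=> //.
apply: (@le_integrable _ _ _ mu2 _ measurableT _ (cst (M ^+ 2)%:E)).
- by apply/measurable_EFinP; exact: measurable_funX.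
- move=> z _ /=; rewrite lee_fin normrX [leRHS]ger0_norm ?sqr_ge0//.
  by rewrite lerXn2r// ?nnegrE// (le_trans _ (FM z)).
(* Constants are integrable on the square, as products of constant tensors. *)
- have := sq_integrableM (sq_integrable_tensor (cstL2 (M ^+ 2)) (cstL2 1))
    (sq_integrable_tensor (cstL2 1) (cstL2 1)).
  by under eq_fun do rewrite !cstL2E !mulr1.
Qed.

Lemma sq_integrable_tensor_integrable F c psi : sq_integrable F ->
  mu2.-integrable setT (EFin \o (fun z => F z * (c z.1 * psi z.2))).
Proof. by move=> hF; apply: sq_integrableM => //; exact: sq_integrable_tensor. Qed.

Lemma sq_integrable_swap F : sq_integrable F -> sq_integrable (F \o unstable.swap).
Proof.
move=> [mF iF]; have m : measurable_fun setT (F \o unstable.swap).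
  by apply: (measurableT_comp mF); exact: measurable_swap.
split=> //; apply: (integrable21ltyP _ _ _).2.
  by apply/measurable_EFinP; exact: measurable_funX.
by have := (integrable12ltyP _ _ _).1 iF; apply; case/integrableP: iF.
Qed.

Lemma Rintegral_swap F : mu2.-integrable setT (EFin \o F) ->
  mu2.-integrable setT (EFin \o (F \o unstable.swap)) ->
  \int[mu2]_z F (unstable.swap z) = \int[mu2]_z F z.
Proof.
by move=> iF iFs; rewrite -(Rintegral12_prod iF) -(Rintegral21_prod iFs).
Qed.

Lemma kernel_integrable F psi : sq_integrable F ->
  mu2.-integrable setT (EFin \o (fun z => F z * psi z.2)).
Proof.
move=> hF; have := sq_integrable_tensor_integrable (cstL2 1) psi hF.
by under eq_fun do rewrite cstL2E mul1r.
Qed.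

Lemma kernel_sqr_le F psi : sq_integrable F -> {ae mu, forall x,
  (\int[mu]_y (F (x, y) * psi y)) ^+ 2 <=
  L2norm psi ^+ 2 * \int[mu]_y F (x, y) ^+ 2}.
Proof.
move=> [mF iF]; have /= := ae_integrable1 iF; apply: filterS => x ix.
have mFx : measurable_fun setT (fun y : mR => F (x, y)).
  exact: (measurableT_comp mF (measurable_pair1 x)).
pose f := toL2 (Lfun2P mFx ix).
have := CauchySchwarz f psi; rewrite /inner /f toL2E => CS.
rewrite -(@real_normK _ (\int[_]_y _)) ?num_real//.
have : L2norm f ^+ 2 = \int[mu]_y F (x, y) ^+ 2 by rewrite L2norm_sqr /inner toL2E.
move=> <-; rewrite -exprMn lerXn2r// ?nnegrE// ?mulr_ge0 ?L2norm_ge0//.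
by rewrite mulrC.
Qed.

Lemma kernel_Lfun_le F psi : sq_integrable F ->
  let k := fun x => \int[mu]_y (F (x, y) * psi y) in
  k \in Lfun mu 2%:E /\
  \int[mu]_x (k x * k x) <= L2norm psi ^+ 2 * \int[mu2]_z F z ^+ 2.
Proof.
move=> hF k; have mk : measurable_fun setT (k : mR -> R).
  have := integrable_Rfubini_F (kernel_integrable psi hF).
  by case/integrableP => /measurable_EFinP.
have iF := hF.2.
have [|//|||ik le] := @ae_le_Rintegral _ mR R mu (fun x => k x ^+ 2)
  (fun x => L2norm psi ^+ 2 * \int[mu]_y F (x, y) ^+ 2) _ (fun x => sqr_ge0 (k x)).
- exact: measurable_funX.
- move=> x; rewrite mulr_ge0 ?sqr_ge0//; apply: Rintegral_ge0 => y _; exact: sqr_ge0.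
- exact: (integrableZl measurableT (L2norm psi ^+ 2) (integrable_Rfubini_F iF)).
- exact: kernel_sqr_le.
split; first exact: Lfun2P.
apply: le_trans le _; rewrite RintegralZl//; last exact: (integrable_Rfubini_F iF).
by rewrite (Rintegral12_prod iF).
Qed.

(** The Hilbert-Schmidt operator with kernel [F]. Through it and its transpose [kernelT], the weak
    derivatives on the square enter arguments in one variable. *)
Definition kernel F (hF : sq_integrable F) psi : L2 R :=
  toL2 (kernel_Lfun_le psi hF).1.

Lemma kernelE F (hF : sq_integrable F) psi :
  kernel hF psi = (fun x => \int[mu]_y (F (x, y) * psi y)) :> (R -> R).
Proof. exact: toL2E. Qed.

Lemma L2norm_kernel F (hF : sq_integrable F) psi :
  L2norm (kernel hF psi) ^+ 2 <= L2norm psi ^+ 2 * \int[mu2]_z F z ^+ 2.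
Proof. by rewrite L2norm_sqr /inner kernelE; exact: (kernel_Lfun_le psi hF).2. Qed.

Lemma inner_kernel F (hF : sq_integrable F) psi c :
  inner (kernel hF psi) c = \int[mu2]_z (F z * (c z.1 * psi z.2)).
Proof.
rewrite /inner kernelE -(Rintegral12_prod (sq_integrable_tensor_integrable c psi hF)).
have /= := ae_integrable1 (kernel_integrable psi hF) => ai.
have mk := (kernel_Lfun_le psi hF).1.
apply: Rintegral_ae_eq.
- apply: measurable_funM; last exact: L2_measurable.
  by move: mk; rewrite inE => /andP[]; rewrite inE.
- have := integrable_Rfubini_F (sq_integrable_tensor_integrable c psi hF).
  by case/integrableP => /measurable_EFinP.
apply: filterS ai => x ix _; rewrite mulrC -RintegralZl//.
by apply: eq_Rintegral => y _ /=; ring.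
Qed.

Definition kernelT F (hF : sq_integrable F) c : L2 R :=
  kernel (sq_integrable_swap hF) c.

Lemma inner_kernelT F (hF : sq_integrable F) psi c :
  inner (kernelT hF c) psi = \int[mu2]_z (F z * (c z.1 * psi z.2)).
Proof.
rewrite inner_kernel.
pose H (z : mR * mR) := F z * (c z.1 * psi z.2).
transitivity (\int[mu2]_z (H (unstable.swap z))).
  by apply: eq_Rintegral => z _; rewrite /H /= (mulrC (psi _)).
apply: (@Rintegral_swap H); first exact: sq_integrable_tensor_integrable.
have := sq_integrable_tensor_integrable psi c (sq_integrable_swap hF).
by congr (_.-integrable _ _); apply/funext => z; rewrite /H/= (mulrC (psi _)).
Qed.

Lemma L2norm_kernelT F (hF : sq_integrable F) c :
  L2norm (kernelT hF c) ^+ 2 <= L2norm c ^+ 2 * \int[mu2]_z F z ^+ 2.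
Proof.
apply: le_trans (L2norm_kernel _ _) _.
have iF := hF.2; have iFs := (sq_integrable_swap hF).2.
by rewrite (@Rintegral_swap (fun z => F z ^+ 2)).
Qed.

End Kernel.

(** * The Laplace solution *)

Section SquareClamp.
Variable R : realType.
Notation mu := (@mu01 R).
Notation "'mR'" := (measurableTypeR R).
Notation mu2 := (@mu01 R \x @mu01 R)%E.
Variable U : R * R -> R.
Hypothesis cU : {within `[0, 1] `*` `[0, 1], continuous U}.

Definition clamp_square (z : R * R) : R := U (clamp01 z.1, clamp01 z.2).

Lemma clamp_square_near (z : R * R) (e : R) : 0 < e ->
  exists2 d : R, 0 < d & forall w : R * R, `|w.1 - z.1| < d -> `|w.2 - z.2| < d ->
    `|clamp_square w - clamp_square z| < e.
Proof.
move=> e0; pose p (z : R * R) := (clamp01 z.1, clamp01 z.2).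
have pA w : (`[0, 1] `*` `[0, 1])%classic (p w).
  by split; exact: clamp01_itv.
have /subspace_continuousP H := cU.
have /cvgrPdist_lt /(_ e e0) := H _ (pA z).
rewrite near_withinE => /nbhs_ballP[d /= d0 Hd]; exists d => // w w1 w2.
have bw : ball (p z) d (p w).
  split.
    change (`|clamp01 z.1 - clamp01 w.1| < d); rewrite distrC.
    by apply: le_lt_trans w1; exact: clamp01_dist.
  change (`|clamp01 z.2 - clamp01 w.2| < d); rewrite distrC.
  by apply: le_lt_trans w2; exact: clamp01_dist.
by rewrite distrC; exact: (Hd (p w) bw (pA w)).
Qed.

Lemma clamp_square_bounded : exists M : R, forall z, `|clamp_square z| <= M.
Proof.
have cA : compact (`[0 : R, 1 : R] `*` `[0 : R, 1 : R]).
  by apply: compact_setX; exact: segment_compact.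
have /compact_bounded[M [_ HM]] := continuous_compact cU cA.
exists (M + 1) => z; apply: (HM (M + 1)); first by rewrite ltrDl.
by exists (clamp01 z.1, clamp01 z.2) => //; split; exact: clamp01_itv.
Qed.

Lemma continuous_clamp_square x : continuous (fun y => clamp_square (x, y)).
Proof.
move=> y; apply/cvgrPdist_lt => e e0; have [d d0 Hd] := clamp_square_near (x, y) e0.
near=> t; rewrite distrC; apply: Hd => /=; first by rewrite subrr normr0.
by rewrite distrC; near: t; apply: (@cvgr_dist_lt _ _ _ _ _ id y cvg_id).
Unshelve. all: by end_near.
Qed.

(** Rounding the first variable down to a multiple of [1 / n.+1] splits every preimage into
    countably many pieces, on each of which only continuity in the second variable matters. The
    roundings converge by continuity in the first. *)
Lemma measurable_clamp_square : measurable_fun setT (clamp_square : mR * mR -> R).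
Proof.
pose g n (x : R) : R := n.+1%:R * clamp01 x.
have g0 n x : 0 <= g n x.
  by rewrite mulr_ge0//; have := clamp01_itv x; rewrite in_itv/= => /andP[].
have mg n : measurable_fun setT (g n : mR -> R).
  apply: continuous_measurable => x; apply: cvgM; first exact: cvg_cst.
  apply/cvgrPdist_lt => e e0; near=> t; apply: le_lt_trans (clamp01_dist _ _) _.
  by near: t; apply: (@cvgr_dist_lt _ _ _ _ _ id x cvg_id).
pose f n (z : mR * mR) := clamp_square ((Num.truncn (g n z.1))%:R / n.+1%:R, z.2).
have mf n : measurable_fun setT (f n).
  move=> _ Y mY; rewrite setTI.
  have -> : f n @^-1` Y = \bigcup_k ((fun z : mR * mR => g n z.1) @^-1` `[k%:R, k.+1%:R[ `&`
     ((fun z : mR * mR => clamp_square (k%:R / n.+1%:R, z.2)) @^-1` Y)).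
    apply/seteqP; split=> z /=.
      by move=> fY; exists (Num.truncn (g n z.1)) => //; split => //=; rewrite in_itv/= truncn_itv.
    by move=> [k _ [/=]]; rewrite in_itv/= => /truncn_def kE; rewrite /f kE.
  apply: bigcupT_measurable => k; apply: measurableI.
    rewrite -[X in measurable X]setTI.
    exact: (measurableT_comp (mg n) measurable_fst).
  rewrite -[X in measurable X]setTI.
  exact: (measurableT_comp (continuous_measurable (@continuous_clamp_square (k%:R / n.+1%:R))) measurable_snd).
apply/measurable_EFinP.
apply: (emeasurable_fun_cvg (fun n z => (f n z)%:E)) => [n|z _].
  exact/measurable_EFinP.
apply/fine_cvgP; split; first exact: nearW.
apply/cvgrPdist_lt => e e0.
have zE : clamp_square z = clamp_square (clamp01 z.1, z.2).
  by rewrite /clamp_square/= (clamp01_id (clamp01_itv z.1)).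
have [d d0 Hd] := clamp_square_near (clamp01 z.1, z.2) e0.
near=> n; rewrite /= zE distrC; apply: Hd => /=; last by rewrite subrr normr0.
have n0 : 0 < n.+1%:R :> R by [].
have /andP[t1 t2] := truncn_itv (g0 n z.1); set k := Num.truncn _ in t1 t2 *.
have nd : n.+1%:R^-1 < d by near: n; exact: (near_infty_natSinv_lt (PosNum d0)).
apply: le_lt_trans nd; rewrite -(ler_pM2l n0) mulfV ?gt_eqF// -[X in X * _]ger0_norm ?ltW// -normrM.
rewrite mulrBr mulrCA divff ?gt_eqF// mulr1 -/(g n z.1).
rewrite -[k.+1]addn1 natrD in t2.
by rewrite ltr_norml; clear - t1 t2; lra.
Unshelve. all: by end_near.
Qed.

Lemma sq_integrable_clamp_square : sq_integrable (clamp_square : mR * mR -> R).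
Proof.
have [M HM] := clamp_square_bounded.
exact: sq_integrable_bounded measurable_clamp_square HM.
Qed.

Lemma clamp_square_id x y : x \in `]0, 1[ -> y \in `]0, 1[ ->
  clamp_square (x, y) = U (x, y).
Proof. by move=> x01 y01; rewrite /clamp_square/= !clamp01_id//; exact: itvoo_cc. Qed.

End SquareClamp.

Section Tensor.
Variable R : realType.
Notation mu := (@mu01 R).
Implicit Types (phi psi : R -> R).

Lemma test_fun_derive1n n phi : test_fun phi -> test_fun (derive1n n phi).
Proof.
move=> tphi; elim: n => [|n IH]; first by rewrite derive1n0.
by rewrite derive1nS; exact: test_fun_derive1.
Qed.

Lemma is_derive_derive1n n phi (x : R) : test_fun phi ->
  is_derive x 1 (derive1n n phi) (derive1n n.+1 phi x).
Proof.
move=> tphi; have D1 : derivable (derive1n n phi) x 1 by exact: tphi.1.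
by apply: (DeriveDef D1); rewrite derive1nS derive1E.
Qed.

Lemma test_fun2_tensor phi psi : test_fun phi -> test_fun psi ->
  test_fun2 (fun i j x y => derive1n i phi x * derive1n j psi y).
Proof.
move=> tphi tpsi; split.
- move=> i j z; apply: cvgM.
    apply: (@continuous_comp _ _ _ fst (derive1n i phi) z); first exact: cvg_fst.
    exact: (test_fun_continuous (test_fun_derive1n i tphi)).
  apply: (@continuous_comp _ _ _ snd (derive1n j psi) z); first exact: cvg_snd.
  exact: (test_fun_continuous (test_fun_derive1n j tpsi)).
- move=> i j x y.
  apply: is_derive_eq (is_derive1M (is_derive_derive1n i x tphi) (is_derive_cst (derive1n j psi y) x 1)) _.
  by rewrite mulr0 addr0.
- move=> i j x y.
  apply: is_derive_eq (is_derive1M (is_derive_cst (derive1n i phi x) y 1) (is_derive_derive1n j y tpsi)) _.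
  by rewrite mul0r add0r.
have [_ [a [b [a0 b1 H]]]] := tphi; have [_ [a' [b' [a'0 b'1 H']]]] := tpsi.
exists (Num.min a a'), (Num.max b b'); split.
- by rewrite lt_min a0.
- by rewrite gt_max b1.
move=> x y; rewrite negb_and => /orP[nx|ny].
  rewrite (_ : derive1n 0 phi x = 0) ?mul0r// derive1n0 H//.
  apply: contra nx => /andP[ax xb]; rewrite ge_min ax/=.
  by rewrite le_max xb.
rewrite (_ : derive1n 0 psi y = 0) ?mulr0// derive1n0 H'//.
apply: contra ny => /andP[ax xb]; rewrite ge_min ax orbT/=.
by rewrite le_max xb orbT.
Qed.

Lemma integrable_cont_test (h : R -> R) phi : {within `[0, 1], continuous h} ->
  test_fun phi -> mu.-integrable setT (EFin \o (fun x => h x * phi x)).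
Proof.
move=> ch tphi; have := integrable_L2M (toL2 (clamp01_Lfun ch)) (testL2 tphi).
rewrite testL2E toL2E; congr (_.-integrable _ (_ \o _)); apply/funext => x /=.
have [x01|x01] := boolP (x \in `]0, 1[); first by rewrite clamp01_id ?itvoo_cc.
by rewrite (test_fun_out tphi x01) !mulr0.
Qed.

(** For a test function the increment is an exact mean value, and the modulus of [q] does not depend
    on the test function. Hence the approximation of [psi] may be chosen after the increment
    [t - x]. *)
Lemma is_derive_H01 (p q : R -> L2 R) (psi : L2 R) (x : R) :
  (forall phi (t : test_fun phi) (x : R), x \in `]0, 1[ ->
     is_derive x 1 (fun x => inner (p x) (testL2 t)) (inner (q x) (testL2 (test_fun_derive1 t)))) ->
  cont01 (@L2norm R) q -> H01 psi -> x \in `]0, 1[ ->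
  is_derive x 1 (fun x => inner (p x) psi) (inner (q x) (wd psi)).
Proof.
move=> D cq /H01P[Hpsi cpsi] x01; apply: is_derive_approx => e e0.
pose N := L2norm (wd psi) + 1; have N0 : 0 < N by rewrite ltr_wpDl// L2norm_ge0.
have [|d d0 Hd] := cont01_dist cq (itvoo_cc x01) (e := e / 2 / N).
  by rewrite !divr_gt0.
have := x01; rewrite in_itv/= => /andP[x0 x1].
exists (Num.min (Num.min x (1 - x)) d); first by rewrite !lt_min x0 subr_gt0 x1.
move=> t; rewrite !lt_min => /andP[/andP[t1 t2] td].
have t01 : t \in `]0, 1[.
  rewrite in_itv/=; have := ler_norm (t - x); have := ler_norm (x - t).
  by rewrite (distrC x); clear - t1 t2; lra.
have [->|tx] := eqVneq t x; first by rewrite !subrr mulr0 subrr normr0 mulr0.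
have tx0 : 0 < `|t - x| by rewrite normr_gt0 subr_eq0.
pose K := L2norm (p t - p x) + L2norm (q x) * `|t - x| + 1.
have K0 : 0 < K by rewrite ltr_wpDl// addr_ge0 ?mulr_ge0 ?L2norm_ge0.
(* The bound 1 yields [L2norm f' <= N]; the other makes the error of replacing [psi] by [f] at most
   [e / 2 * |t - x|]. *)
pose dl := Num.min 1 (e / 2 * `|t - x| / K).
have dl0 : 0 < dl by rewrite lt_min ltr01/= divr_gt0// mulr_gt0// divr_gt0.
have [phi [tphi Hphi]] := cpsi _ dl0.
pose f := testL2 tphi; pose f' := testL2 (test_fun_derive1 tphi).
have wpt : wd (psi - f) = wd psi - f' %[ae mu].
  by apply: wd_ae; apply: weak_derivB (wdP Hpsi) (weak_deriv_test tphi).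
have n1 : L2norm (psi - f) <= dl by rewrite (le_trans (L2norm_le_H1norm _))// ltW.
have n2 : L2norm (wd psi - f') <= dl.
  by rewrite -(L2norm_ae wpt) (le_trans (L2norm_wd_le_H1norm _))// ltW.
have n3 : L2norm f' <= N.
  rewrite -[f'](subKr (wd psi)) (le_trans (L2normD _ _))// L2normN lerD//.
  by rewrite (le_trans n2)// /dl ge_min lexx.
have [c [c01 cx E]] := MVT01 (D phi tphi) x01 t01.
have -> : inner (p t) psi - inner (p x) psi - inner (q x) (wd psi) * (t - x) =
  inner (q c - q x) f' * (t - x) +
  (inner (p t - p x) (psi - f) - inner (q x) (wd psi - f') * (t - x)).
  move: E; rewrite -/f -/f' !innerBr !innerBl.
  set a1 := inner (p t) f; set a2 := inner (p x) f; set a3 := inner (q c) f'.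
  set a4 := inner (q x) f'; set a5 := inner (p t) psi; set a6 := inner (p x) psi.
  by set a7 := inner (q x) (wd psi); clear; move=> E; rewrite E; ring.
rewrite (le_trans (ler_normD _ _))// (splitr e) mulrDl lerD//.
  rewrite normrM ler_wpM2r// (le_trans (CauchySchwarz _ _))//.
  have qc : L2norm (q c - q x) <= e / 2 / N.
    by apply/ltW/Hd; [exact: itvoo_cc|exact: le_lt_trans cx td].
  apply: le_trans (ler_pM (L2norm_ge0 _) (L2norm_ge0 _) qc n3) _.
  by rewrite mulfVK// gt_eqF.
rewrite (le_trans (ler_normB _ _))// normrM.
have dlK : K * dl <= e / 2 * `|t - x|.
  rewrite (@le_trans _ _ (K * (e / 2 * `|t - x| / K)))//.
    by rewrite ler_wpM2l ?(ltW K0)// /dl ge_min lexx orbT.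
  by rewrite mulrCA mulfV ?gt_eqF// mulr1.
apply: le_trans dlK; rewrite /K !mulrDl mul1r ler_wpDr ?(ltW dl0)//.
rewrite lerD//.
  by rewrite (le_trans (CauchySchwarz _ _))// ler_wpM2l ?L2norm_ge0.
rewrite mulrAC ler_wpM2r// (le_trans (CauchySchwarz _ _))//.
by rewrite ler_wpM2l ?L2norm_ge0.
Qed.

End Tensor.

Section Solution.
Variable R : realType.
Notation mu := (@mu01 R).
Notation "'mR'" := (measurableTypeR R).
Notation mu2 := (@mu01 R \x @mu01 R)%E.
Variables (u0 : L2 R) (u ux : R -> L2 R).
Variables (U : R * R -> R) (G : nat -> nat -> R * R -> R).
Hypothesis cU : {within `[0, 1] `*` `[0, 1], continuous U}.
Hypothesis HG : H2_square U G.
Hypothesis lapl : {ae mu01sq, forall z, G 2%N 0%N z + G 0%N 2%N z = 0}.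
Hypothesis U01 : forall x, x \in `[0, 1] -> U (x, 0) = 0 /\ U (x, 1) = 0.
Hypothesis uU : forall x, x \in `[0, 1] -> u x = (fun y => U (x, y)) %[ae mu01].
Hypothesis C1u : C1_L2 u ux.
Hypothesis u0E : u 0 = u0 %[ae mu01].
Hypothesis u0_H1 : H1 u0.

Let sqG i j : (i + j <= 2)%N -> sq_integrable (G i j : mR * mR -> R).
Proof. by move=> /HG[+ _]; exact: sq_integrable_Lfun. Qed.

Let cuL : cont01 (@L2norm R) u. Proof. exact: C1_L2_cont C1u. Qed.
Let cuxL : cont01 (@L2norm R) ux. Proof. by case: C1u. Qed.

Lemma weak_tensor i j phi psi (tphi : test_fun phi) (tpsi : test_fun psi) :
  (i + j <= 2)%N ->
  \int[mu]_x (inner (u x) (testL2 (test_fun_derive1n j tpsi)) * derive1n i phi x) =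
  (-1) ^+ (i + j) * \int[mu2]_z (G i j z * (testL2 tphi z.1 * testL2 tpsi z.2)).
Proof.
move=> ij; have [_ /(_ _ (test_fun2_tensor tphi tpsi))] := HG ij.
rewrite !derive1n0 !testL2E => <-.
have [c cE] : exists c : L2 R, c = derive1n i phi :> (R -> R).
  by exists (testL2 (test_fun_derive1n i tphi)); exact: testL2E.
have : testL2 (test_fun_derive1n j tpsi) = derive1n j psi :> (R -> R) by exact: testL2E.
set p := testL2 _; move: p => p pE.
have sU := sq_integrable_clamp_square cU.
(* [U] is controlled on the closed square only. Its extension is measurable and bounded on the
   plane, and agrees with it wherever the test functions do not vanish. *)
transitivity (\int[mu2]_z (clamp_square U z * (c z.1 * p z.2))); last first.
  apply: eq_Rintegral => -[x y] _ /=; rewrite cE pE.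
  have [x01|x01] := boolP (x \in `]0, 1[); last first.
    by rewrite (test_fun_out (test_fun_derive1n i tphi) x01) !mul0r !mulr0.
  have [y01|y01] := boolP (y \in `]0, 1[); last first.
    by rewrite (test_fun_out (test_fun_derive1n j tpsi) y01) !mulr0.
  by rewrite clamp_square_id.
rewrite -(inner_kernel sU p c) /inner kernelE cE.
apply: eq_Rintegral => x _; have [x01|x01] := boolP (x \in `]0, 1[); last first.
  by rewrite (test_fun_out (test_fun_derive1n i tphi) x01) !mulr0.
congr (_ * _); apply: Rintegral_ae_eq.
- by apply: measurable_funM; exact: L2_measurable.
- apply: measurable_funM; last exact: L2_measurable.
  exact: (measurableT_comp sU.1 (measurable_pair1 x)).
apply: filterS2 (ae_mu01_itv R) (uU (itvoo_cc x01)) => y y01 /(_ I) -> _.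
by rewrite clamp_square_id.
Qed.

Let hG11 := sqG (isT : (1 + 1 <= 2)%N).
Let hG20 := sqG (isT : (2 + 0 <= 2)%N).
Let hG02 := sqG (isT : (0 + 2 <= 2)%N).

(** By [weak_tensor] with [i = j = 1], [b] is the distributional derivative of [<u x, psi'>]. It is
    integrated from [x'] to [x], and [stepL2 x - stepL2 x'] is the signed indicator of that
    interval. *)
Lemma inner_sol_test x x' psi (tpsi : test_fun psi) :
  x \in `[0, 1] -> x' \in `[0, 1] ->
  inner (u x - u x') (testL2 (test_fun_derive1 tpsi)) =
  - inner (kernelT hG11 (stepL2 x - stepL2 x')) (testL2 tpsi).
Proof.
move=> x01 x'01; pose p := testL2 (test_fun_derive1 tpsi).
have cp : {within `[0, 1], continuous (fun x => inner (u x) p)}.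
  exact: (inner_within_continuous cuL (cont01_cst p)).
pose b := - kernel hG11 (testL2 tpsi).
have H phi : test_fun phi ->
    \int[mu]_x (inner (u x) p * derive1 phi x) = - \int[mu]_x (b x * phi x).
  move=> tphi; have := weak_tensor (i := 1) (j := 1) tphi tpsi isT.
  rewrite sqrrN expr1n mul1r -inner_kernel inner_testr.
  rewrite (_ : testL2 (test_fun_derive1n 1 tpsi) = p); last first.
    by apply/LfuneqP => y; rewrite /p !testL2E derive1n1.
  rewrite derive1n1 => ->.
  by rewrite -!(inner_testr _ tphi) innerNl opprK.
rewrite innerBl (du_Bois_Reymond cp H x01) (du_Bois_Reymond cp H x'01).
rewrite !primE !innerNl inner_kernelT -inner_kernel innerBr.
by rewrite opprD addrACA subrr add0r opprD.
Qed.

Lemma sol_weak_deriv x x' : x \in `[0, 1] -> x' \in `[0, 1] ->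
  weak_deriv (u x - u x') (kernelT hG11 (stepL2 x - stepL2 x')).
Proof. by move=> x01 x'01; apply/weak_derivP => phi t; exact: inner_sol_test. Qed.

(** The mixed derivative only controls differences; the base point is the initial datum. *)
Lemma sol_H1 x : x \in `[0, 1] -> H1 (u x).
Proof.
move=> x01; have z01 : (0 : R) \in `[0, 1] by rewrite in_itv/= lexx ler01.
have H := weak_deriv_H1 (sol_weak_deriv x01 z01).
have Hu0 : H1 (u 0) by apply: H1_ae u0_H1; exact: ae_sym.
by have := H1_lin 1 H Hu0; rewrite scale1r subrK.
Qed.

(** The squared L2 norm of the derivative of [u t - u x] is at most [|t - x|] times that of the
    mixed derivative on the square. *)
Lemma sol_cont_H1 : cont01 (@H1norm R) u.
Proof.
apply/(cont01P _ (@H1norm_ge0 R)) => x x01 e e0.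
pose N := \int[mu2]_z G 1%N 1%N z ^+ 2.
have N0 : 0 <= N by apply: Rintegral_ge0 => z _; exact: sqr_ge0.
have e20 : 0 < e / 2 by rewrite divr_gt0.
have [d d0 Hd] := cont01_dist cuL x01 e20.
exists (Num.min d ((e / 2) ^+ 2 / (N + 1))).
  by rewrite lt_min d0 divr_gt0 ?exprn_gt0// ltr_wpDl.
move=> t t01; rewrite lt_min => /andP[td]; rewrite ltr_pdivlMr ?ltr_wpDl// => tN.
have w := sol_weak_deriv t01 x01.
rewrite (le_lt_trans (H1norm_le _))// (splitr e) ltr_leD ?Hd//.
rewrite (L2norm_ae (wd_ae w)) -(@ler_pXn2r _ 2) ?nnegrE ?L2norm_ge0 ?(ltW e20)//.
apply: le_trans (L2norm_kernelT _ _) _; apply: le_trans (ltW tN).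
rewrite -/N; apply: ler_pM => //; first exact: sqr_ge0.
  exact: L2norm_stepB.
by rewrite lerDl.
Qed.

Lemma sol_H01 x : x \in `[0, 1] -> H01 (u x).
Proof.
move=> x01; apply: vanishes_at_ends_H01; first exact: sol_H1.
exists (fun y => U (x, y)); have [Ux0 Ux1] := U01 x01; split=> //; last exact: uU.
have cc := @continuous_clamp_square _ _ cU x.
have : {within `[0, 1], continuous (fun y => clamp_square U (x, y))}.
  exact: continuous_subspaceT.
apply: subspace_eq_continuous => y; rewrite inE/= => y01.
by rewrite /from_subspace /clamp_square/= !clamp01_id.
Qed.

Lemma C1_weak_deriv psi phi : test_fun phi ->
  \int[mu]_x (inner (u x) psi * derive1 phi x) =
  - \int[mu]_x (inner (ux x) psi * phi x).
Proof.
move=> tphi.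
have ca : {within `[0, 1], continuous (fun x => inner (u x) psi)}.
  exact: (inner_within_continuous cuL (cont01_cst psi)).
have cb : {within `[0, 1], continuous (fun x => inner (ux x) psi)}.
  exact: (inner_within_continuous cuxL (cont01_cst psi)).
pose B := toL2 (clamp01_Lfun cb).
have D (x : R) : x \in `]0, 1[ -> is_derive x 1 (fun x => inner (u x) psi - prim B x) 0.
  move=> x01; apply: is_derive_eq (is_derive1B (f := fun x => inner (u x) psi) _ (is_derive_prim x01 _)) _.
  - under eq_fun do rewrite innerC; exact: (is_derive_inner_C1 psi C1u x01).
  - by rewrite toL2E; exact: clamp01_continuous.
  - by rewrite toL2E/= clamp01_id ?itvoo_cc// innerC subrr.
(* An interior base point, as differentiability is available inside (0,1) only. *)
have h01 : (2^-1 : R) \in `]0, 1[ by rewrite in_itv/=; apply/andP; split; lra.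
pose c := inner (u 2^-1) psi - prim B 2^-1.
have aE (x : R) : x \in `]0, 1[ -> inner (u x) psi = c + prim B x.
  move=> x01; have [_ [_ _ E]] := MVT01 D h01 x01.
  by move: E; rewrite mul0r /c => /eqP; rewrite subr_eq0 => /eqP <-; rewrite subrK.
transitivity (\int[mu]_x ((cstL2 c + primL2 B : L2 R) x * derive1 phi x)).
  apply: eq_Rintegral => x _; have [x01|x01] := boolP (x \in `]0, 1[).
    by rewrite aE//; congr (_ * _); rewrite -(cstL2E c) -(primL2E B).
  by rewrite (test_fun_out (test_fun_derive1 tphi) x01) !mulr0.
have BE x : B x * phi x = inner (ux x) psi * phi x.
  have [x01|x01] := boolP (x \in `]0, 1[); last by rewrite (test_fun_out tphi x01) !mulr0.
  by rewrite toL2E/= clamp01_id ?itvoo_cc.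
rewrite (weak_derivD (weak_deriv_cst c) (weak_deriv_prim B) tphi) add0r.
have E : \int[mu]_x (B x * phi x) = \int[mu]_x (inner (ux x) psi * phi x).
  by apply: eq_Rintegral => x _; exact: BE.
by rewrite E.
Qed.

Lemma laplace_Rintegral (c p : L2 R) :
  \int[mu2]_z (G 2%N 0%N z * (c z.1 * p z.2)) =
  - \int[mu2]_z (G 0%N 2%N z * (c z.1 * p z.2)).
Proof.
have i02 := sq_integrable_tensor_integrable c p hG02.
have i20 := sq_integrable_tensor_integrable c p hG20.
rewrite -mulN1r -RintegralZl//.
have i02' := integrableZl measurableT (-1) i02.
apply: Rintegral_ae_eq.
- by case/integrableP: i20 => /measurable_EFinP.
- by case/integrableP: i02' => /measurable_EFinP.
apply: (@filterS _ _ (ae_filter_ringOfSetsType mu01sq) _ _ _ lapl) => z /eqP; rewrite addr_eq0 => /eqP -> _.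
by rewrite mulN1r mulNr.
Qed.

Lemma inner_wd_sol x psi (tpsi : test_fun psi) : x \in `[0, 1] ->
  inner (wd (u x)) (testL2 tpsi) = - inner (u x) (testL2 (test_fun_derive1 tpsi)).
Proof.
move=> x01; have /weak_derivP -> := wdP (sol_H1 x01).
by rewrite opprK.
Qed.

Let cwd : cont01 (@L2norm R) (fun x => wd (u x)).
Proof. exact: cont01_wd sol_H1 sol_cont_H1. Qed.

(** In the sense of distributions [<u_x, psi>' = <u_xx, psi> = - <u_yy, psi> = <u_y, psi'>]. The
    last expression is continuous in [x], which makes the derivative a classical one. *)
Lemma sol_derive_test psi (tpsi : test_fun psi) (x : R) : x \in `]0, 1[ ->
  is_derive x 1 (fun x => inner (ux x) (testL2 tpsi))
    (inner (wd (u x)) (testL2 (test_fun_derive1 tpsi))).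
Proof.
move: x; apply: du_Bois_Reymond_derive.
- exact: (inner_within_continuous cuxL (cont01_cst _)).
- exact: (inner_within_continuous cwd (cont01_cst _)).
move=> phi tphi; have tphi' := test_fun_derive1 tphi.
have := C1_weak_deriv (testL2 tpsi) tphi'.
move=> /(congr1 -%R); rewrite opprK => <-.
have := weak_tensor (i := 2) (j := 0) tphi tpsi isT.
rewrite laplace_Rintegral sqrrN expr1n mul1r.
rewrite (_ : testL2 (test_fun_derive1n 0 tpsi) = testL2 tpsi); last first.
  by apply/LfuneqP => y; rewrite !testL2E derive1n0.
rewrite derive1nS derive1n1 => ->; rewrite opprK.
have := weak_tensor (i := 0) (j := 2) tphi tpsi isT.
rewrite sqrrN expr1n mul1r => <-; rewrite derive1n0.
rewrite -mulN1r -RintegralZl//; last first.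
  exact: (integrable_cont_test (inner_within_continuous cwd (cont01_cst _)) tphi).
apply: eq_Rintegral => x _; rewrite mulN1r -mulNr.
have [x01|x01] := boolP (x \in `]0, 1[); last by rewrite (test_fun_out tphi x01) !mulr0.
rewrite (inner_wd_sol (test_fun_derive1 tpsi) (itvoo_cc x01)) opprK.
by congr (inner _ _ * _).
Qed.

(** For a fixed [psi] the identity [<u x, psi''> = <G 0 2 (x, .), psi>] holds off a null set that
    depends on [psi]. Primitives of mean-free bumps form a countable family, and for these [psi'] is
    a mean-free bump: off one null set, [wd (u x)] minus the primitive of [G 0 2 (x, .)] is
    orthogonal to all mean-free bumps, hence constant. *)
Lemma sol_ae_H2 : {ae mu, forall x, x \in `]0, 1[ -> H2 (u x)}.
Proof.
have [phi0 t0 m0] := exists_unit_test R.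
have kerE psi (tpsi : test_fun psi) : {ae mu, forall x, x \in `]0, 1[ ->
    inner (u x) (testL2 (test_fun_derive1n 2 tpsi)) =
    \int[mu]_y (G 0%N 2%N (x, y) * testL2 tpsi y)}.
  pose p := testL2 (test_fun_derive1n 2 tpsi).
  have cp : {within `[0, 1], continuous (fun x => inner (u x) p)}.
    exact: (inner_within_continuous cuL (cont01_cst p)).
  pose A := toL2 (clamp01_Lfun cp); pose k := kernel hG02 (testL2 tpsi).
  have Ak : A - k = 0 %[ae mu].
    apply: L2_eq0_test => phi tphi; rewrite -(inner_testr _ tphi) innerBl.
    apply/eqP; rewrite subr_eq0; apply/eqP.
    have := weak_tensor (i := 0) (j := 2) tphi tpsi isT.
    rewrite sqrrN expr1n mul1r -inner_kernel -/k => <-; rewrite inner_testr.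
    apply: eq_Rintegral => x _; rewrite derive1n0 /A toL2E /=.
    have [x01|x01] := boolP (x \in `]0, 1[); first by rewrite clamp01_id ?itvoo_cc.
    by rewrite (test_fun_out tphi x01) !mulr0.
  apply: filterS Ak => x /(_ I) Ax x01.
  have : A x - k x = 0 by exact: Ax.
  by rewrite /A /k toL2E kernelE/= clamp01_id ?itvoo_cc// => /subr0_eq.
have sec := ae_integrable1 hG02.2.
pose mf p q n := meanfree phi0 (bump (ratr p : R) (ratr q) n).
(* The triples [(p, q, n)] are enumerated by [m], so that the exceptional sets unite to a null
   set. *)
have all : {ae mu, forall x, forall m : nat,
    if (unpickle m : option (rat * rat * nat)) is Some (p, q, n) then
      0 < ratr p :> R -> ratr q < 1 :> R -> x \in `]0, 1[ ->
      forall t : test_fun (prim (mf p q n)),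
      inner (u x) (testL2 (test_fun_derive1n 2 t)) =
      \int[mu]_y (G 0%N 2%N (x, y) * testL2 t y)
    else True}.
  apply/ae_foralln => m; case: (unpickle m) => [[[p q] n]|]; last exact: aeW.
  have [p0|np0] := pselect (0 < ratr p :> R); last by apply: aeW => x /np0.
  have [q1|nq1] := pselect (ratr q < 1 :> R); last by apply: aeW => x _ /nq1.
  have tb := test_fun_bump n p0 q1.
  have tm := test_fun_meanfree t0 tb.
  have tp := test_fun_prim tm (Rintegral_meanfree t0 tb m0).
  apply: filterS (kerE _ tp) => x H _ _ x01 t.
  by rewrite (Prop_irrelevance t tp) H.
apply: filterS2 sec all => x ig H x01.
have mGx : measurable_fun setT (fun y : mR => G 0%N 2%N (x, y)).
  exact: (measurableT_comp hG02.1 (measurable_pair1 x)).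
pose g := toL2 (Lfun2P mGx ig).
split; first exact: sol_H1 (itvoo_cc x01).
have [|c wc] := L2_eq_cst_bump (f := wd (u x) - primL2 g) t0 m0.
  move=> p q n p0 q1; have := H (pickle (p, q, n)); rewrite pickleK => /(_ p0 q1 x01).
  have tb := test_fun_bump n p0 q1.
  have tm := test_fun_meanfree t0 tb.
  have tp := test_fun_prim tm (Rintegral_meanfree t0 tb m0).
  have dp : derive1 (prim (mf p q n)) = mf p q n.
    exact: is_derive_derive1 (is_derive_prim_test tm).
  move=> /(_ tp) E.
  have -> : \int[mu]_y ((wd (u x) - primL2 g : L2 R) y * mf p q n y) =
     inner (wd (u x) - primL2 g) (testL2 (test_fun_derive1 tp)).
    by rewrite inner_testr dp.
  rewrite innerBl inner_wd_sol ?itvoo_cc//.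
  have /weak_derivP -> := weak_deriv_prim g.
  rewrite opprK (_ : testL2 (test_fun_derive1 _) = testL2 (test_fun_derive1n 2 tp)); last first.
    by apply/LfuneqP => y; rewrite !testL2E derive1nS derive1n1.
  by rewrite E /inner /g toL2E addNr.
apply: weak_deriv_H1 (_ : weak_deriv _ (0 + g)).
apply: weak_deriv_ae _ (ae_refl _) (weak_derivD (weak_deriv_cst c) (weak_deriv_prim g)).
apply: filterS wc => y /(_ I) wy _.
have : wd (u x) y - primL2 g y = cstL2 c y by exact: wy.
by move=> /eqP; rewrite subr_eq => /eqP ->.
Qed.

(** Since [u_xx = - u_yy = u_yy - 2 u_yy], the claim amounts to [<g x, psi> = 2 <u_y, psi_y>]. This
    is integration by parts at those [x] where [u x] is in H2, and both sides are continuous in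
    [x]. *)
Lemma sol_evolution (g : R -> L2 R) : cont01 (@L2norm R) g ->
  {ae mu, forall x, x \in `]0, 1[ -> g x = - (2 : R) *: wd (wd (u x)) %[ae mu]} ->
  evolution u ux g.
Proof.
move=> cg gE psi Hpsi x x01.
suff E : inner (g x) psi - inner (wd (u x)) (wd psi) = inner (wd (u x)) (wd psi).
  apply: is_derive_eq (is_derive_H01 _ cwd Hpsi x01) (esym E).
  by move=> phi t s s01; exact: sol_derive_test.
pose F x := inner (g x) psi - 2 * inner (wd (u x)) (wd psi).
suff F0 : F x = 0.
  have -> : inner (g x) psi = 2 * inner (wd (u x)) (wd psi).
    by apply/eqP; rewrite -subr_eq0; exact/eqP.
  by rewrite mulr_natl mulr2n addrK.
have cF : {within `[0, 1], continuous F}.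
  have c2 := inner_within_continuous cwd (cont01_cst (wd psi)).
  move=> y; apply: cvgB; first exact: (inner_within_continuous cg (cont01_cst psi)).
  by apply: cvgM; [exact: cvg_cst|exact: c2].
have cF' := clamp01_continuous cF.
have := ae_continuous_eq (c := 0) cF' _ (itvoo_cc x01).
rewrite /= clamp01_id ?itvoo_cc//; apply.
apply: filterS3 (ae_mu01_itv R) gE sol_ae_H2 => y y01 /(_ y01) gy /(_ y01) [_ H2y].
rewrite clamp01_id ?itvoo_cc// /F (inner_ael _ gy) innerZl.
by rewrite (inner_wd_H01 (wdP H2y) Hpsi) mulNr mulrN subrr.
Qed.

End Solution.

(** * The iteration *)

Section Operators.
Variable R : realType.
Implicit Types (f g : L2 R) (v w : R -> L2 R).

Lemma ae_0 f : f = 0 %[ae mu01] -> f = (0 : L2 R) %[ae mu01].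
Proof. by apply: filterS => y /(_ I) -> _. Qed.

Lemma linear_onB (D : set (L2 R)) (T : L2 R -> L2 R) f g : linear_on D T ->
  D f -> D g -> T (f - g) = T f - T g %[ae mu01].
Proof.
move=> [_ H] Df Dg; have := H (-1) g f Dg Df.
by rewrite !scaleN1r (addrC (- g)) (addrC (- T g)).
Qed.

Lemma stabilized_dist (C1 c : R) (P : L2 R -> L2 R) f g : stabilized C1 c P ->
  H1 f -> H1 g -> L2norm (P f - P g) <= C1 * ln c * H1norm (f - g).
Proof.
move=> [lP bP] Hf Hg; rewrite -(L2norm_ae (linear_onB lP Hf Hg)).
exact: bP (H1B Hf Hg).
Qed.

Lemma perturbing_dist (W : normedModType R) (iW : W -> L2 R) (C0 c : R)
    (Q : L2 R -> L2 R) f g (a b : W) :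
  L2_subspace iW -> perturbing iW C0 c Q ->
  f = iW a %[ae mu01] -> g = iW b %[ae mu01] ->
  L2norm (Q f - Q g) <= C0 * `|a - b| / c.
Proof.
move=> [iWl _] [lQ bQ] fa gb; have [Qae _] := lQ.
rewrite -(L2norm_ae (linear_onB lQ I I)).
have E : f - g = iW (a - b) %[ae mu01].
  apply: ae_trans (ae_sub fa gb) _; apply: ae_sym.
  have := iWl (-1) b a; rewrite !scaleN1r (addrC (- b)) => H.
  by apply: ae_trans H _; rewrite addrC; exact: ae_refl.
by rewrite (L2norm_ae (Qae _ _ I I E)).
Qed.

Lemma cont01_stabilized (C1 c : R) (P : L2 R -> L2 R) v : stabilized C1 c P ->
  (forall x, x \in `[0, 1] -> H1 (v x)) -> cont01 (@H1norm R) v ->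
  cont01 (@L2norm R) (fun x => P (v x)).
Proof.
move=> sP Hv; apply: cont01_le; [exact: H1norm_ge0|exact: L2norm_ge0|].
exists (C1 * ln c) => x t x01 t01; apply: (stabilized_dist sP); exact: Hv.
Qed.

Lemma cont01_perturbing (W : normedModType R) (iW : W -> L2 R) (C0 c : R)
    (Q : L2 R -> L2 R) (uW : R -> W) v : 0 < C0 -> 0 < c ->
  L2_subspace iW -> perturbing iW C0 c Q -> {within `[0, 1], continuous uW} ->
  (forall x, x \in `[0, 1] -> v x = iW (uW x) %[ae mu01]) ->
  cont01 (@L2norm R) (fun x => Q (v x)).
Proof.
move=> C00 c0 sW pQ /subspace_continuousP cW vW; apply/cont01_L2P => x x01 e e0.
have e'0 : 0 < e * c / C0 by rewrite divr_gt0// mulr_gt0.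
have /cvgrPdist_lt /(_ _ e'0) := cW x x01.
rewrite near_withinE => /nbhs_ballP[d /= d0 Hd]; exists d => // t t01 tx.
have := Hd t; rewrite /ball/= distrC => /(_ tx t01); rewrite distrC => H.
apply: le_lt_trans (perturbing_dist sW pQ (vW t t01) (vW x x01)) _.
rewrite ltr_pdivrMr// mulrC; move: H; rewrite ltr_pdivlMr//.
Qed.

Lemma cont01_inP (W : normedModType R) (iW : W -> L2 R) v :
  cont01_in iW v -> exists (uW : R -> W) (M : R),
  [/\ {within `[0, 1], continuous uW}, 0 <= M,
      (forall x, x \in `[0, 1] -> v x = iW (uW x) %[ae mu01]) &
      (forall x, x \in `[0, 1] -> `|uW x| <= M)].
Proof.
move=> [uW [cW vW]].
have cn : {within `[0 : R, 1 : R], continuous (fun x => `|uW x|)}.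
  by move=> x; apply: cvg_norm; exact: cW.
have [z _ Hz] := EVT_max ler01 cn.
by exists uW, `|uW z|; split.
Qed.

Lemma cont01_bounded v : cont01 (@L2norm R) v ->
  exists M : R, forall x, x \in `[0, 1] -> L2norm (v x) <= M.
Proof.
move=> cv; have [z _ Hz] := EVT_max ler01 (inner_within_continuous cv cv).
exists (L2norm (v z)) => x x01.
by rewrite -(@ler_pXn2r _ 2) ?nnegrE ?L2norm_ge0// !L2norm_sqr Hz.
Qed.

Lemma cont01_H1_bounded v : (forall x, x \in `[0, 1] -> H1 (v x)) ->
  cont01 (@H1norm R) v ->
  exists2 M : R, 0 <= M & forall x, x \in `[0, 1] -> H1norm (v x) <= M.
Proof.
move=> Hv cv; have [M HM] := cont01_bounded (cont01_H1_L2 cv).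
have [M' HM'] := cont01_bounded (cont01_wd Hv cv).
have z01 : (0 : R) \in `[0, 1] by rewrite in_itv/= lexx ler01.
exists (M + M') => [|x x01].
  by rewrite (le_trans _ (lerD (HM _ z01) (HM' _ z01)))// addr_ge0 ?L2norm_ge0.
by rewrite (le_trans (H1norm_le _))// lerD ?HM ?HM'.
Qed.

Lemma cont01_H1B v w : (forall x, x \in `[0, 1] -> H1 (v x)) ->
  (forall x, x \in `[0, 1] -> H1 (w x)) ->
  cont01 (@H1norm R) v -> cont01 (@H1norm R) w ->
  cont01 (@H1norm R) (fun x => v x - w x).
Proof.
have N0 := @H1norm_ge0 R.
move=> Hv Hw /(cont01P _ N0) cv /(cont01P _ N0) cw; apply/(cont01P _ N0) => x x01 e e0.
have e20 : 0 < e / 2 by rewrite divr_gt0.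
have [d d0 Hd] := cv x x01 _ e20; have [d' d'0 Hd'] := cw x x01 _ e20.
exists (Num.min d d'); first by rewrite lt_min d0.
move=> t t01; rewrite lt_min => /andP[td td'].
have -> : v t - w t - (v x - w x) = (v t - v x) - (w t - w x).
  by rewrite !opprD !opprK addrACA.
have Hvt := H1B (Hv t t01) (Hv x x01); have Hwt := H1B (Hw x x01) (Hw t t01).
rewrite -(opprB (w x)) opprK; apply: le_lt_trans (H1normD Hvt Hwt) _.
rewrite (H1normB (Hw x x01) (Hw t t01)).
by rewrite (splitr e); apply: ltrD; [exact: Hd|exact: Hd'].
Qed.

Lemma C1_L2B v vx w wx : C1_L2 v vx -> C1_L2 w wx ->
  C1_L2 (fun x => v x - w x) (fun x => vx x - wx x).
Proof.
move=> [Dv cv] [Dw cw]; split; last exact: cont01B.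
move=> x x01.
pose h t := L2norm ((t - x)^-1 *: (v t - v x) - vx x) +
  L2norm ((t - x)^-1 *: (w t - w x) - wx x).
have ch : h t @[t --> within `[0, 1] (x^')] --> (0 : R).
  by rewrite -[X in _ --> X](addr0 (0 : R)); apply: cvgD; [exact: Dv|exact: Dw].
apply: squeeze_cvgr (cvg_cst 0) ch; apply: nearW => t; rewrite L2norm_ge0/= /h.
set a := (t - x)^-1.
have -> : a *: (v t - w t - (v x - w x)) - (vx x - wx x) =
  (a *: (v t - v x) - vx x) - (a *: (w t - w x) - wx x).
  have -> : v t - w t - (v x - w x) = (v t - v x) - (w t - w x).
    by rewrite !opprD !opprK addrACA.
  by rewrite scalerBr opprD opprK addrACA [in RHS]opprD opprK.
by rewrite (le_trans (L2normD _ _))// L2normN.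
Qed.

End Operators.

(** * Elementary inequalities for the contraction ratio *)

Section Ratio.
Variable R : realType.
Implicit Types t r : R.

(** From [exp (- 1/2) >= 1 - 1/2]. *)
Lemma expR_half_le2 : expR (2^-1 : R) <= 2.
Proof.
have := expR_ge1Dx (- (2^-1 : R)); rewrite expRN => H.
have a0 : 0 < expR (2^-1 : R) := expR_gt0 _.
have aa : expR (2^-1 : R) * (expR 2^-1)^-1 = 1 by rewrite mulfV ?gt_eqF.
move: aa H a0; set a := expR _; set b := a^-1; clearbody b; clearbody a; nra.
Qed.

(** As [exp t >= 1 + t], the hypothesis gives [2 t (1 + t) < 1] and so [2 t <= 3 / 4]. With
    [exp (1/2) <= 2] one gets [r <= 2 t <= 1], whence [r^2 <= r <= 2 t <= 2 t exp t]. *)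
Lemma expR_ratio t : 0 <= t -> 2 * t * expR t < 1 ->
  let r := expR 2^-1 * t in [/\ 0 <= r, r <= 3 / 4 & r ^+ 2 <= 2 * t * expR t].
Proof.
move=> t0 H r.
have e1 : 1 + t <= expR t by exact: expR_ge1Dx.
have a0 : 0 < expR (2^-1 : R) by exact: expR_gt0.
have a2 := expR_half_le2.
have tt : 2 * t * (1 + t) <= 2 * t * expR t by rewrite ler_wpM2l// mulr_ge0.
have t34 : 2 * t <= 3 / 4.
  by rewrite leNgt; apply/negP => t34; clear - t34 tt H; nra.
have rt : r <= 2 * t by rewrite /r ler_wpM2r.
have r0 : 0 <= r by rewrite mulr_ge0// ltW.
split=> //; first exact: le_trans rt t34.
apply: (@le_trans _ _ (2 * t)).
  rewrite expr2; apply: (@le_trans _ _ (r * 1)); last by rewrite mulr1.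
  by rewrite ler_wpM2l// (le_trans rt)// (le_trans t34)//; clear; lra.
apply: le_trans tt; clear - t0; nra.
Qed.

Lemma ratio_gap r : r <= 3 / 4 -> 0 < 1 - r /\ 2 <= 8 * (1 - r).
Proof. by move=> H; split; lra. Qed.

(** The factor [X] is dropped from [q] but kept with [L]: it is what makes [a * (L * X)] a ratio
    below 1. *)
Lemma ratio_step (a L b X d q : R) : 0 <= a -> 0 <= q -> X <= 1 ->
  a * (d + (L * b + q) * X) <= a * (L * X) * b + a * (d + q).
Proof.
move=> a0 q0 X1; rewrite -subr_ge0.
rewrite (_ : _ - _ = a * (q * (1 - X))); last by ring.
by rewrite !mulr_ge0// subr_ge0.
Qed.

Lemma sqr_add_le (a b : R) : (a + b) ^+ 2 <= 2 * a ^+ 2 + 2 * b ^+ 2.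
Proof. by have := sqr_ge0 (a - b); nra. Qed.

End Ratio.

Lemma laplace_H1 (R : realType) (u0 : L2 R) (u ux : R -> L2 R) : H1 u0 ->
  laplace_strong_solution u0 u ux ->
  (forall x, x \in `[0, 1] -> H1 (u x)) /\ cont01 (@H1norm R) u.
Proof.
move=> u0_H1 [U [G [[cU HG] _ _ [uU C1u] [u0E _]]]]; split.
  exact: (sol_H1 cU HG uU C1u u0E u0_H1).
exact: (sol_cont_H1 cU HG uU C1u).
Qed.

(** * The affine recursion for the errors of the iterates *)

Section Iteration.
Variable R : realType.
Variables (W : normedModType R) (iW : W -> L2 R) (C0 C1 : R).
Hypotheses (W_sub : L2_subspace iW) (C0_gt0 : 0 < C0) (C1_gt0 : 0 < C1).
Variables (u0 : L2 R) (u ux : R -> L2 R) (uW : R -> W) (M Mu : R).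
Hypothesis u0_H1 : H1 u0.
Hypothesis u_sol : laplace_strong_solution u0 u ux.
Hypothesis cW : {within `[0, 1], continuous uW}.
Hypothesis uuW : forall x, x \in `[0, 1] -> u x = iW (uW x) %[ae mu01].
Hypothesis HM : forall x, x \in `[0, 1] -> `|uW x| <= M.
Hypothesis HMu : forall x, x \in `[0, 1] -> H1norm (u x) <= Mu.

Variables (c : R) (P Q : L2 R -> L2 R).
Hypotheses (c_ge1 : 1 <= c) (Q_pert : perturbing iW C0 c Q).
Hypotheses (P_stab : stabilized C1 c P) (PQ : stabilizes P Q).

Lemma source_cont : cont01 (@L2norm R) (fun x => Q (u x) - P (u x)).
Proof.
have [U [G [[cU HG] _ U01 [uU C1u] [u0E _]]]] := u_sol.
apply: cont01B.
  exact: cont01_perturbing C0_gt0 (lt_le_trans ltr01 c_ge1) W_sub Q_pert cW uuW.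
apply: (cont01_stabilized P_stab).
  by move=> x x01; exact: (sol_H1 cU HG uU C1u u0E u0_H1 x01).
exact: (sol_cont_H1 cU HG uU C1u).
Qed.

Lemma source_evolution : evolution u ux (fun x => Q (u x) - P (u x)).
Proof.
have [U [G [[cU HG] lapl U01 [uU C1u] [u0E _]]]] := u_sol.
apply: (sol_evolution cU HG lapl uU C1u u0E u0_H1 source_cont).
apply: filterS (sol_ae_H2 cU HG uU C1u u0E u0_H1) => x H x01.
have uH01 := sol_H01 cU HG U01 uU C1u u0E u0_H1 (itvoo_cc x01).
apply: filterS (PQ (H x01) uH01) => y /(_ I) Py _.
have -> : (Q (u x) - P (u x) : L2 R) y = Q (u x) y - P (u x) y by [].
have -> : (- (2 : R) *: wd (wd (u x)) : L2 R) y = - 2 * wd (wd (u x)) y by [].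
rewrite Py; have -> : (Q (u x) + 2 *: wd (wd (u x)) : L2 R) y = Q (u x) y + 2 * wd (wd (u x)) y by [].
by rewrite opprD addNKr mulNr.
Qed.

Lemma iterate_step (v v' vx' : R -> L2 R) (v0 : L2 R) (X F e : R) :
  (forall x, x \in `[0, 1] -> H1 (v x)) -> cont01 (@H1norm R) v ->
  wave_weak_solution (fun x => - P (v x)) v0 v' vx' ->
  0 < X <= 1 -> 0 <= F -> H1norm (v0 - u0) <= e ->
  (forall x, x \in `[0, X] -> H1norm (v x - u x) <= F) ->
  forall x, x \in `[0, X] ->
  Num.sqrt (energy (fun x => v' x - u x) (fun x => vx' x - ux x) x) <=
  expR (2^-1) * (e + (C1 * ln c * F + C0 * M / c) * X).
Proof.
move=> Hv cv wv /andP[X0 X1] F0 He vF x xX.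
have [U [G [[cU HG] lapl U01 [uU C1u] [u0E ux0]]]] := u_sol.
have uH1 := sol_H1 cU HG uU C1u u0E u0_H1.
have uH01 := sol_H01 cU HG U01 uU C1u u0E u0_H1.
have cu := sol_cont_H1 cU HG uU C1u.
have [[v'H01 cv'] C1v' _ v'0 vx'0] := wv.
have c0 : 0 < c := lt_le_trans ltr01 c_ge1.
have lnc0 : 0 <= ln c by rewrite ln_ge0.
have L0 : 0 <= C1 * ln c by rewrite mulr_ge0// ltW.
have M0 : 0 <= M.
  by apply: le_trans (HM (x := 0) _); rewrite ?in_itv/= ?lexx ?ler01.
have q0 : 0 <= C0 * M / c by rewrite divr_ge0 ?mulr_ge0// ltW.
have cPv : cont01 (@L2norm R) (fun x => - P (v x)).
  have := cont01B (cont01_cst (0 : L2 R)) (cont01_stabilized P_stab Hv cv).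
  by under [X in cont01 _ X]eq_fun do rewrite add0r.
have E := evolutionB (fun x x01 => H01_H1 (v'H01 x x01)) uH1
   (wave_evolution cPv wv) source_evolution.
have H01w y : y \in `[0, 1] -> H01 (v' y - u y).
  by move=> y01; apply: H01B; [exact: v'H01|exact: uH01].
have cw : cont01 (@H1norm R) (fun x => v' x - u x).
  by apply: cont01_H1B => // y y01; exact: H01_H1 (v'H01 y y01).
have G0 : 0 <= C1 * ln c * F + C0 * M / c by rewrite addr_ge0// mulr_ge0.
have X01 : 0 <= X <= 1 by rewrite (ltW X0).
have gG y : 0 <= y <= X -> L2norm (- P (v y) - (Q (u y) - P (u y))) <= C1 * ln c * F + C0 * M / c.
  move=> /andP[y0 yX].
  have y01 : y \in `[0, 1] by rewrite in_itv/= y0 (le_trans yX).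
  have -> : - P (v y) - (Q (u y) - P (u y)) = - (P (v y) - P (u y)) - Q (u y).
    by rewrite !opprD !opprK addrCA addrA (addrC (- Q _)) addrAC.
  rewrite (le_trans (L2normD _ _))// !L2normN; apply: lerD.
    rewrite (le_trans (stabilized_dist P_stab (Hv y y01) (uH1 y y01)))// ler_wpM2l// vF//.
    by rewrite in_itv/= y0.
  have [Qae _] := Q_pert.1; rewrite (L2norm_ae (Qae _ _ I I (uuW y01))).
  apply: le_trans (Q_pert.2 _) _.
  by rewrite ler_pM2r ?invr_gt0// ler_wpM2l ?(ltW C0_gt0)// HM.
have z01 : (0 : R) \in `[0, 1] by rewrite in_itv/= lexx ler01.
have x0X : 0 <= x <= X by rewrite in_itv/= in xX.
have cg := cont01B cPv source_cont.
apply: le_trans (energy_estimate H01w cw (C1_L2B C1v' C1u) cg E G0 X01 gG x0X) _.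
rewrite ler_pM2l ?expR_gt0//; apply: lerD; last first.
  by rewrite ler_wpM2l//; case/andP: x0X.
apply: le_trans He.
have -> : energy (fun x => v' x - u x) (fun x => vx' x - ux x) 0 = H1norm (v0 - u0) ^+ 2.
  have p0 : vx' 0 - ux 0 = (0 : L2 R) %[ae mu01].
    by rewrite -(subrr (0 : L2 R)); apply: ae_sub; [exact: ae_0 vx'0|exact: ae_0 ux0].
  rewrite /energy (L2norm_ae p0) L2norm0 expr0n add0r.
  by rewrite (H1norm_ae (ae_sub v'0 u0E) (H1B (H01_H1 (v'H01 _ z01)) (uH1 _ z01))).
by rewrite sqrtr_sqr ger0_norm// H1norm_ge0.
Qed.

Variables (v0 : L2 R) (v vx : nat -> R -> L2 R) (X e : R).
Hypothesis v_0 : forall x, x \in `[0, 1] -> v 0%N x = 0 %[ae mu01].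
Hypothesis v_S : forall k, (1 <= k)%N ->
  wave_weak_solution (fun x => - P (v k.-1 x)) v0 (v k) (vx k).
Hypothesis X01 : 0 < X <= 1.
Hypothesis v0e : H1norm (v0 - u0) <= e.
Hypothesis eta_lt1 : eta2 C1 c X < 1.

Lemma iterate_H1 k : (forall x, x \in `[0, 1] -> H1 (v k x)) /\
  cont01 (@H1norm R) (v k).
Proof.
case: k => [|k]; last first.
  by have [[H cv] _ _ _ _] := v_S (ltn0Sn k); split=> // x /H; exact: H01_H1.
have H x : x \in `[0, 1] -> H1 (v 0%N x).
  by move=> x01; exact: H1_ae (ae_sym (ae_0 (v_0 x01))) (H1_0 R).
split=> //.
apply/(cont01P _ (@H1norm_ge0 R)) => x x01 d d0; exists 1 => // t t01 _.
rewrite (H1norm_ae (ae_sub (ae_0 (v_0 t01)) (ae_0 (v_0 x01))) (H1B (H t t01) (H x x01))) subrr.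
by rewrite (le_lt_trans (H1norm_le _))// (L2norm_ae (wd0 R)) !L2norm0 addr0.
Qed.

Let t := C1 * ln c * X.

Lemma eta2E : eta2 C1 c X = 2 * t * expR t.
Proof.
have c0 : 0 < c := lt_le_trans ltr01 c_ge1.
rewrite /eta2 /powR gt_eqF// /t; congr (_ * expR _); ring.
Qed.

Lemma iterate_time_ge0 : 0 <= t.
Proof. by case/andP: X01 => /ltW X0 _; rewrite !mulr_ge0 ?ln_ge0 ?(ltW C1_gt0). Qed.

Let r := expR (2^-1) * t.

Lemma ratio_bounds : [/\ 0 <= r, r <= 3 / 4 & r ^+ 2 <= eta2 C1 c X].
Proof. by have := eta_lt1; rewrite eta2E; exact: expR_ratio iterate_time_ge0. Qed.

Let q := C0 * M / c.
Let A := expR (2^-1) * (e + q).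
(** The fixed point of [b |-> r * b + A] plus a geometric term. At [k = 0] it exceeds [Mu], a bound
    for the error of the zero iterate. *)
Let B k := r ^+ k * Mu + A / (1 - r).

Lemma iterate_majorant_S k : B k.+1 = r * B k + A.
Proof.
have [_ r34 _] := ratio_bounds.
have r1 : 1 - r != 0 by rewrite gt_eqF//; exact: (ratio_gap r34).1.
by rewrite /B exprS; field.
Qed.

Lemma perturbation_size_ge0 : 0 <= q.
Proof.
have M0 : 0 <= M.
  by apply: le_trans (HM (x := 0) _); rewrite ?in_itv/= ?lexx ?ler01.
by rewrite divr_ge0 ?mulr_ge0 ?(ltW C0_gt0)// (le_trans ler01).
Qed.

(** The velocity [vx 0] is not prescribed, so the induction starts from the H1 norm of [v 0 - u],
    and the energy is bounded from the first iterate on. *)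
Lemma iterate_energy k x : x \in `[0, X] ->
  Num.sqrt (energy (fun x => v k.+1 x - u x) (fun x => vx k.+1 x - ux x) x) <= B k.+1.
Proof.
have [r0 r34 _] := ratio_bounds.
have [r1 r8] := ratio_gap r34.
have e0 : 0 <= e := le_trans (H1norm_ge0 _) v0e.
have A0 : 0 <= A by rewrite mulr_ge0 ?addr_ge0 ?perturbation_size_ge0// ltW// expR_gt0.
have Mu0 : 0 <= Mu.
  apply: le_trans (HMu (x := 0) _); first exact: H1norm_ge0.
  by rewrite in_itv/= lexx ler01.
have B0 k' : 0 <= B k'.
  rewrite /B; apply: addr_ge0; first by rewrite mulr_ge0 ?exprn_ge0.
  by rewrite divr_ge0// ltW.
have [X0 X1] := andP X01.
have step k' : (forall y, y \in `[0, X] -> H1norm (v k' y - u y) <= B k') ->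
   forall y, y \in `[0, X] ->
  Num.sqrt (energy (fun x => v k'.+1 x - u x) (fun x => vx k'.+1 x - ux x) y) <= B k'.+1.
  move=> IH y yX; have [Hk ck] := iterate_H1 k'.
  apply: le_trans (iterate_step Hk ck (v_S (ltn0Sn k')) X01 (B0 k') v0e IH yX) _.
  by rewrite iterate_majorant_S; apply: ratio_step X1; [exact: ltW (expR_gt0 _)|exact: perturbation_size_ge0].
elim: k x => [|k IH] x xX.
  apply: step xX => y; rewrite in_itv/= => /andP[y0 yX].
  have y01 : y \in `[0, 1] by rewrite in_itv/= y0 (le_trans yX).
  have -> : H1norm (v 0 y - u y) = H1norm (u y).
    have Hu := (laplace_H1 u0_H1 u_sol).1 y y01.
    rewrite (H1norm_ae (ae_sub (ae_0 (v_0 y01)) (ae_refl (u y)))).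
      by rewrite sub0r -scaleN1r H1normZ// normrN1 mul1r.
    exact: H1B ((iterate_H1 0).1 y y01) Hu.
  rewrite /B expr0 mul1r (le_trans (HMu y01))// lerDl mulr_ge0// invr_ge0 ltW//.
apply: step xX => y yX; apply: le_trans (IH y yX).
rewrite -[leLHS]ger0_norm ?H1norm_ge0// -sqrtr_sqr ler_sqrt ?energy_ge0//.
by rewrite /energy lerDr sqr_ge0.
Qed.

(** From [exp (1/2) <= 2] and [1 / (1 - r) <= 4] one has [A / (1 - r) <= 8 (e + q)]. Squaring the
    sum in [B] doubles both squares, so that [128 = 2 * 8^2]. *)
Lemma iterate_bound k x : (1 <= k)%N -> x \in `[0, X] ->
  energy (fun x => v k x - u x) (fun x => vx k x - ux x) x <=
  2 * Mu ^+ 2 * eta2 C1 c X ^+ k + 128 * (e + C0 * M / c) ^+ 2.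
Proof.
case: k => // k _ xX; have H := iterate_energy k xX.
have [r0 r34 r2] := ratio_bounds.
have [r1 r8] := ratio_gap r34.
have e0 : 0 <= e := le_trans (H1norm_ge0 _) v0e.
have eq0 : 0 <= e + q by rewrite addr_ge0// perturbation_size_ge0.
have A8 : A / (1 - r) <= 8 * (e + q).
  rewrite ler_pdivrMr// /A; have := expR_half_le2 R; set a := expR _ => a2.
  apply: (@le_trans _ _ (2 * (e + q))); first by rewrite ler_wpM2r.
  by rewrite mulrAC ler_wpM2r.
have A0 : 0 <= A / (1 - r).
  by rewrite divr_ge0 ?(ltW r1)//; exact: mulr_ge0 (ltW (expR_gt0 _)) eq0.
rewrite -(sqr_sqrtr (energy_ge0 _ _ _)).
set s := Num.sqrt _ in H *.
have s0 : 0 <= s by exact: sqrtr_ge0.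
have BB : B k.+1 ^+ 2 <= 2 * (r ^+ k.+1 * Mu) ^+ 2 + 2 * (A / (1 - r)) ^+ 2.
  exact: sqr_add_le.
have sB : s ^+ 2 <= B k.+1 ^+ 2 by rewrite lerXn2r// nnegrE// (le_trans s0).
apply: le_trans sB _; apply: le_trans BB _; apply: lerD.
  rewrite exprMn -exprM mulnC exprM -mulrA ler_wpM2l// mulrC ler_wpM2l ?sqr_ge0//.
  by rewrite lerXn2r// nnegrE ?sqr_ge0// (le_trans _ r2)// sqr_ge0.
have -> : 128 * (e + q) ^+ 2 = 2 * (8 * (e + q)) ^+ 2 by ring.
by rewrite ler_wpM2l// lerXn2r// nnegrE mulr_ge0.
Qed.

End Iteration.

(** * Convergence rates in terms of gamma *)

Lemma eta2_ge0 (R : realType) (C1 c X : R) : 0 < C1 -> 1 <= c -> 0 < X <= 1 ->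
  0 <= eta2 C1 c X.
Proof.
move=> C10 c1 /andP[X0 _].
by rewrite /eta2 mulr_ge0 ?powR_ge0// mulr_ge0 ?(ltW X0)// mulr_ge0 ?ln_ge0// mulr_ge0 ?(ltW C10).
Qed.

Lemma rate_combine (R : realType) (m n E g h : R) : 0 <= m -> 0 <= n -> 0 <= E ->
  0 <= g -> h <= n * g -> m * E + 128 * h <= (m + 128 * n) * (g + E).
Proof.
move=> m0 n0 E0 g0 hn; rewrite -subr_ge0.
have -> : (m + 128 * n) * (g + E) - (m * E + 128 * h) =
  m * g + 128 * (n * E) + 128 * (n * g - h) by ring.
by rewrite !addr_ge0 ?mulr_ge0// subr_ge0.
Qed.

Lemma powR_rate_ge (R : realType) (C1 c : R) : 0 < C1 -> 1 <= c ->
  (c ^+ 2)^-1 <= c `^ (7 * C1 / 3 - 2).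
Proof.
move=> C10 c1; have c0 : 0 < c := lt_le_trans ltr01 c1.
rewrite -powR_mulrn ?(ltW c0)// -powRN ler_powR//.
by clear - C10; lra.
Qed.

Theorem theorem5p2 (R : realType)
  (gamma : R -> R)
  (gamma_ge1 : forall b, b \in `]0, 1[ -> 1 <= gamma b)
  (gamma_lim : gamma b @[b --> 0^'+] --> +oo)
  (beta : R -> R)
  (beta01 : forall eps, eps \in `]0, 1[ -> beta eps \in `]0, 1[)
  (beta_lim : beta eps @[eps --> 0^'+] --> (0 : R))
  (u0 : L2 R) (u0e : R -> L2 R)
  (u0_H1 : H1 u0)
  (u0e_H1 : forall eps, eps \in `]0, 1[ -> H1 (u0e eps))
  (u0e_close : forall eps, eps \in `]0, 1[ -> H1norm (u0e eps - u0) <= eps)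
  (u0e_ends : forall eps, eps \in `]0, 1[ -> vanishes_at_ends (u0e eps))
  (W : normedModType R) (iW : W -> L2 R) (W_sub : L2_subspace iW)
  (C0 C1 : R) (C0_gt0 : 0 < C0) (C1_gt0 : 0 < C1) (C1_lt : C1 < 6 / 7)
  (* Q eps b and P eps b are the operators with parameters eps and beta = b *)
  (Q P : R -> R -> L2 R -> L2 R)
  (Q_pert : forall eps, eps \in `]0, 1[ ->
     perturbing iW C0 (gamma (beta eps)) (Q eps (beta eps)))
  (P_stab : forall eps, eps \in `]0, 1[ ->
     stabilized C1 (gamma (beta eps)) (P eps (beta eps)))
  (PQ : forall eps, eps \in `]0, 1[ ->
     stabilizes (P eps (beta eps)) (Q eps (beta eps)))
  (u ux : R -> L2 R)
  (u_sol : laplace_strong_solution u0 u ux)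
  (u_W : cont01_in iW u)
  (* uk eps k and ukx eps k are the k-th iterate and its x-derivative *)
  (uk ukx : R -> nat -> R -> L2 R)
  (uk0 : forall eps, eps \in `]0, 1[ ->
     forall x, x \in `[0, 1] -> uk eps 0%N x = 0 %[ae mu01])
  (ukS : forall eps, eps \in `]0, 1[ -> forall k, (1 <= k)%N ->
     wave_weak_solution (fun x => - P eps (beta eps) (uk eps k.-1 x))
       (u0e eps) (uk eps k) (ukx eps k))
  (xbar : R -> R)
  (xbar01 : forall eps, eps \in `]0, 1[ -> xbar eps \in `]0, 1])
  (xbar_small : forall eps, eps \in `]0, 1[ ->
     eta2 C1 (gamma (beta eps)) (xbar eps) < 1) :
  (forall K1 : R, 0 < K1 ->
     eps * gamma (beta eps) * ln (gamma (beta eps)) @[eps --> 0^'+] --> K1 ->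
     exists2 C : R, 0 <= C & \forall eps \near 0^'+,
       forall k, (1 <= k)%N -> forall x, x \in `[0, xbar eps] ->
       L2norm (ukx eps k x - ux x) ^+ 2 + H1norm (uk eps k x - u x) ^+ 2 <=
       C * (gamma (beta eps) `^ (7 * C1 / 3 - 2)
            + eta2 C1 (gamma (beta eps)) (xbar eps) ^+ k)) /\
  (forall K2 : R, 0 < K2 ->
     eps * gamma (beta eps) @[eps --> 0^'+] --> K2 ->
     exists2 C : R, 0 <= C & \forall eps \near 0^'+,
       forall k, (1 <= k)%N -> forall x, x \in `[0, xbar eps] ->
       L2norm (uk eps k x - u x) ^+ 2 <=
       C * (gamma (beta eps) `^ (7 * C1 / 3 - 2)
            + eta2 C1 (gamma (beta eps)) (xbar eps) ^+ k)).
Proof.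
have [uW [M [cW M0 uuW HM]]] := cont01_inP u_W.
have [uH1 cu] := laplace_H1 u0_H1 u_sol.
have [Mu Mu0 HMu] := cont01_H1_bounded uH1 cu.
(* [D] stands for a bound on [eps * gamma], under which [eps + C0 * M / gamma <= (D + C0 * M) /
   gamma]. The two regimes differ in the origin of [D]. *)
pose C (D : R) := 2 * Mu ^+ 2 + 128 * (D + C0 * M) ^+ 2.
have C_ge0 D : 0 <= C D by rewrite addr_ge0// mulr_ge0// sqr_ge0.
have main eps k x D : eps \in `]0, 1[ -> (1 <= k)%N -> x \in `[0, xbar eps] ->
    eps * gamma (beta eps) <= D ->
    L2norm (ukx eps k x - ux x) ^+ 2 + H1norm (uk eps k x - u x) ^+ 2 <=
    C D * (gamma (beta eps) `^ (7 * C1 / 3 - 2)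
           + eta2 C1 (gamma (beta eps)) (xbar eps) ^+ k).
  move=> e01 k1 xX eD; have c1 := gamma_ge1 _ (beta01 _ e01).
  have X01 : 0 < xbar eps <= 1 by have := xbar01 _ e01; rewrite in_itv.
  have H := iterate_bound W_sub C0_gt0 C1_gt0 u0_H1 u_sol cW uuW HM HMu c1
    (Q_pert _ e01) (P_stab _ e01) (PQ _ e01) (uk0 _ e01) (ukS _ e01) X01
    (u0e_close _ e01) (xbar_small _ e01) k1 xX.
  apply: le_trans H _.
  have eta0 := eta2_ge0 C1_gt0 c1 X01; have := powR_rate_ge C1_gt0 c1.
  move: eD c1 eta0; set c := gamma _; set eta := eta2 _ _ _; set g := c `^ _ => eD c1 eta0 cg.
  have c0 : 0 < c := lt_le_trans ltr01 c1.
  have e0 : 0 <= eps by move: e01; rewrite in_itv/= => /andP[/ltW].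
  have ec : eps + C0 * M / c <= (D + C0 * M) / c.
    by rewrite mulrDl lerD2r ler_pdivlMr.
  have CM0 : 0 <= C0 * M by rewrite mulr_ge0// ltW.
  have sq : (eps + C0 * M / c) ^+ 2 <= (D + C0 * M) ^+ 2 * g.
    apply: (@le_trans _ _ (((D + C0 * M) / c) ^+ 2)).
      by rewrite lerXn2r// nnegrE ?(le_trans _ ec)// addr_ge0// divr_ge0// ltW.
    by rewrite exprMn ler_wpM2l ?sqr_ge0// exprVn.
  have g0 : 0 <= g by exact: powR_ge0.
  apply: rate_combine sq;
    [by rewrite mulr_ge0// sqr_ge0|exact: sqr_ge0|exact: exprn_ge0|exact: g0].
have near01 : \forall eps \near (0 : R)^'+, eps \in `]0, 1[.
  near=> eps; rewrite in_itv/=; apply/andP; split.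
    by near: eps; exact: nbhs_right_gt.
  by near: eps; exact: nbhs_right_lt.
split=> [K1 K10|K2 K20] /cvgr_lt Heps.
  exists (C (K1 + 1)) => //.
  (* Once [ln gamma >= 1], the quantity [eps * gamma] is at most [eps * gamma * ln gamma], which is
     eventually below [K1 + 1]. *)
  have gl : \forall eps \near (0 : R)^'+, 1 <= ln (gamma (beta eps)).
    have /cvgryPge /(_ (expR 1)) := gamma_lim.
    rewrite near_withinE => /nbhs_ballP[d /= d0 Hd].
    have /cvgrPdist_lt /(_ d d0) Hb := beta_lim.
    near=> eps; have e01 : eps \in `]0, 1[ by near: eps.
    have b01 := beta01 _ e01.
    have gb : expR 1 <= gamma (beta eps).
      apply: Hd; first by near: eps.
      by move: b01; rewrite in_itv/= => /andP[].
    rewrite -[leLHS](expRK 1) ler_ln// posrE ?expR_gt0//.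
    exact: lt_le_trans (expR_gt0 _) gb.
  near=> eps => k k1 x xX; have e01 : eps \in `]0, 1[ by near: eps.
  apply: main => //.
  apply: (@le_trans _ _ (eps * gamma (beta eps) * ln (gamma (beta eps)))).
    rewrite ler_peMr//; first last.
      by near: eps.
    have c1 := gamma_ge1 _ (beta01 _ e01).
    move: e01; rewrite in_itv/= => /andP[e0 _].
    by rewrite mulr_ge0 ?(ltW e0)// (le_trans ler01).
  by apply: ltW; near: eps; apply: Heps; rewrite ltrDl.
exists (C (K2 + 1)) => //.
near=> eps => k k1 x xX; have e01 : eps \in `]0, 1[ by near: eps.
apply: le_trans (main eps k x (K2 + 1) e01 k1 xX _).
  apply: (@le_trans _ _ (H1norm (uk eps k x - u x) ^+ 2)).
    by rewrite lerXn2r ?nnegrE ?L2norm_ge0 ?H1norm_ge0 ?L2norm_le_H1norm.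
  by rewrite lerDr sqr_ge0.
by apply: ltW; near: eps; apply: Heps; rewrite ltrDl.
Unshelve. all: by end_near.
Qed.
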